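(* Let $K\ge1$, $\alpha\in[1,2]$, $\lambda>0$ and $m\in\mathbb{N}$. Let $R^*_{K,m,\alpha,\lambda}\in(0,1)$ be the unique root in $(0,1)$ of the equation $$f_{\alpha}(r^m)+\frac{2K\lambda}{K+1}f_{\alpha}(r)-\frac{1}{2\alpha}=0,\qquad f_\alpha(z)=\frac{1}{2\alpha}\left[\left(\frac{1+z}{1-z}\right)^\alpha-1\right].$$ Suppose that $f(z)=h(z)+\overline{g(z)}=\sum_{n=0}^{\infty}a_nz^n+\overline{\sum_{n=1}^{\infty}b_nz^n}$ is a sense-preserving $K$-quasiconformal harmonic mapping in $\mathbb{D}$ and $h\prec\phi$, where $\phi\in\widehat{\mathcal{C}_0}(\alpha)$. Then $$|h(z^m)|+\lambda\sum_{n=1}^{\infty}(|a_n|+|b_n|)r^n\le|\phi(0)|+d(\phi(0),\partial\phi(\mathbb{D}))$$ for $|z|=r\le\min\{1/3,R^*_{K,m,\alpha,\lambda}\}$. Moreover, if $R^*_{K,m,\alpha,\lambda}\le1/3$, the radius $R^*_{K,m,\alpha,\lambda}$ is sharp, i.e. it cannot be replaced by any larger number in this statement (over all admissible $f$ and $\phi$).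
   Context: $\mathbb{D}=\{z\in\mathbb{C}:|z|<1\}$. For $\alpha\in[1,2]$, $\widehat{\mathcal{C}_0}(\alpha)$ (concave univalent functions with opening angle $\pi\alpha$) is the class of analytic functions $\phi$ in $\mathbb{D}$ such that: (1) $\phi$ maps $\mathbb{D}$ conformally onto $\phi(\mathbb{D})$; (2) $\phi(1)=\infty$; (3) the set $(\mathbb{C}\cup\{\infty\})\setminus\phi(\mathbb{D})$ is convex, and the opening angle of $\phi(\mathbb{D})$ at infinity is less than or equal to $\pi\alpha$. $d(\phi(0),\partial\phi(\mathbb{D}))$ is the Euclidean distance from $\phi(0)$ to the boundary of $\phi(\mathbb{D})$. For analytic $h,\phi$ in $\mathbb{D}$, $h\prec\phi$ ($h$ is subordinate to $\phi$) means $h=\phi\circ w$ for some analytic $w:\mathbb{D}\to\mathbb{D}$ with $w(0)=0$. A harmonic mapping $f=h+\overline g$ in $\mathbb{D}$ ($h,g$ analytic) is sense-preserving $K$-quasiconformal if it is locally univalent and sense-preserving (i.e. $h'\ne0$ and $|\omega|<1$ in $\mathbb{D}$, where $\omega=g'/h'$) and $|\omega(z)|\le k<1$ in $\mathbb{D}$, where $K=(1+k)/(1-k)\ge1$, i.e. $k=(K-1)/(K+1)$. *)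

(* Defs.v *)
From Stdlib Require Import Reals.
From Coquelicot Require Import Coquelicot.

Local Open Scope R_scope.

Definition unit_disc (z : C) : Prop := Cmod z < 1.

Definition analytic_on_disc (h : C -> C) : Prop :=
  forall z : C, unit_disc z -> ex_derive h z.

Definition disc_image (phi : C -> C) (w : C) : Prop :=
  exists z : C, unit_disc z /\ phi z = w.

Definition convex_set (E : C -> Prop) : Prop :=
  forall (u v : C) (t : R), E u -> E v -> 0 <= t <= 1 ->
    E (RtoC (1 - t) * u + RtoC t * v)%C.

Definition boundary (Omega : C -> Prop) (w : C) : Prop :=
  ~ locally w Omega /\ ~ locally w (fun v : C => ~ Omega v).

Definition dist_to_set (p : C) (E : C -> Prop) : R :=
  real (Glb_Rbar (fun d : R => exists w : C, E w /\ d = Cmod (w - p)%C)).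

(* Closed sector with vertex [p], axis direction [t0] and opening angle
   [gamma]; it is the whole plane as soon as [gamma >= 2 * PI]. *)
Definition sector (p : C) (t0 gamma : R) (w : C) : Prop :=
  exists s t : R, 0 <= s /\ Rabs (t - t0) <= gamma / 2 /\
    w = (p + RtoC s * (cos t, sin t))%C.

(* The infimum of the angles of the sectors that contain [Omega] near
   infinity.  When the complement of [Omega] is closed, convex and unbounded,
   this is [2 * PI] minus the angle of the recession cone of the complement:
   [PI] for a half-plane, [2 * PI] for a plane slit along a ray. *)
Definition opening_angle_at_infinity (Omega : C -> Prop) : R :=
  real (Glb_Rbar (fun gamma : R =>
    0 <= gamma /\
    exists (p : C) (t0 rho : R),
      forall w : C, Omega w -> rho < Cmod w -> sector p t0 gamma w)).

(* [phi 1 = infinity] is the boundary limit of [phi] at 1 from inside the disc.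
   In the convexity condition only finite points need to be mentioned:
   infinity is never in the image, and the complement of the image of a
   univalent analytic map of the disc, when convex in the plane, is closed and
   unbounded, hence contains a half-line from each of its points. *)
Record concave_univalent (alpha : R) (phi : C -> C) : Prop := {
  cu_analytic : analytic_on_disc phi;
  cu_injective : forall z1 z2 : C,
    unit_disc z1 -> unit_disc z2 -> phi z1 = phi z2 -> z1 = z2;
  cu_infinity :
    filterlim (fun z : C => Cmod (phi z))
      (within unit_disc (locally (RtoC 1))) (Rbar_locally p_infty);
  cu_convex : convex_set (fun w : C => ~ disc_image phi w);
  cu_angle : opening_angle_at_infinity (disc_image phi) <= PI * alpha
}.

Definition subordinate (h phi : C -> C) : Prop :=
  exists w : C -> C,
    analytic_on_disc w /\
    (forall z : C, unit_disc z -> unit_disc (w z)) /\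
    w (RtoC 0) = RtoC 0 /\
    (forall z : C, unit_disc z -> h z = phi (w z)).

(* Coquelicot's [C_derive] is the complex derivative wherever the function is
   complex differentiable ([C_derive_correct]). *)
Definition dilatation (h g : C -> C) (z : C) : C :=
  (C_derive g z / C_derive h z)%C.

Record qc_harmonic (K : R) (f h g : C -> C) : Prop := {
  qc_analytic_h : analytic_on_disc h;
  qc_analytic_g : analytic_on_disc g;
  qc_decomposition :
    forall z : C, unit_disc z -> f z = (h z + Cconj (g z))%C;
  qc_locally_univalent :
    forall z : C, unit_disc z -> C_derive h z <> RtoC 0;
  qc_sense_preserving :
    forall z : C, unit_disc z -> Cmod (dilatation h g z) < 1;
  qc_quasiconformal :
    forall z : C, unit_disc z -> Cmod (dilatation h g z) <= (K - 1) / (K + 1)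
}.

Definition has_coefficients (h : C -> C) (a : nat -> C) : Prop :=
  forall z : C, unit_disc z -> is_pseries a z (h z).

Record admissible (K alpha : R) (f h g : C -> C) (a b : nat -> C)
    (phi : C -> C) : Prop := {
  adm_harmonic : qc_harmonic K f h g;
  adm_h : has_coefficients h a;
  adm_g : has_coefficients g b;
  adm_g0 : b 0%nat = RtoC 0;
  adm_phi : concave_univalent alpha phi;
  adm_subordinate : subordinate h phi
}.

Definition f_alpha (alpha r : R) : R :=
  1 / (2 * alpha) * (Rpower ((1 + r) / (1 - r)) alpha - 1).

Definition radius_equation (K alpha lambda : R) (m : nat) (r : R) : Prop :=
  f_alpha alpha (r ^ m) + 2 * K * lambda / (K + 1) * f_alpha alpha r
    - 1 / (2 * alpha) = 0.

Definition bohr_inequality (lambda : R) (m : nat) (h : C -> C)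
    (a b : nat -> C) (phi : C -> C) (z : C) : Prop :=
  Cmod (h (z ^ m)%C)
    + lambda * Series (fun n : nat =>
        (Cmod (a (S n)) + Cmod (b (S n))) * Cmod z ^ S n)
  <= Cmod (phi (RtoC 0))
     + dist_to_set (phi (RtoC 0)) (boundary (disc_image phi)).

(* Main.v *)
(** Let [E] be the complement of [phi (D)]. The opening angle at infinity (for [alpha = 2], the
    unboundedness of [E]) shows that for each [p] in [E] the convex set [E] contains a closed cone
    with vertex [p] and angle [(2 - a) PI], where [a > alpha] is arbitrarily close to [alpha]
    ([a = 2] if [alpha = 2]). So [u = (h - p) / (h 0 - p)] omits such a cone with vertex 0, hence
    [u = y (W)] with [W : D -> D], [W 0 = 0] and [y x = ((1 + c x) / (1 - x))^a], [|c| = 1]. For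
    [r <= 1/3] Bohr's theorem, applied to the powers of [W], bounds the majorant series of [u - 1]
    by that of [y - 1], and the latter is largest at [c = 1], where it is
    [((1 + r) / (1 - r))^a - 1 = 2 a f_a(r)]. Choosing [p] almost nearest to [phi 0] and letting
    [a -> alpha] gives [sum_(n>=1) |a_n| r^n <= 2 alpha d f_alpha(r)]. Bohr's theorem for the
    dilatation gives [sum |b_n| r^n <= k sum |a_n| r^n] with [1 + k = 2 K / (K + 1)], and the
    definition of the radius concludes. Equality occurs for [h = phi = ((1 + z) / (1 - z))^alpha],
    [g = k (h - 1)].

    The comparison with [c = 1] rests on [y' = a (1 + c) exp (sum_k w_k x^k / k)] with
    [w_k = 2 + (a - 1) (1 - (-c)^k)]: the gain in [|1 + c| = 2 cos th] outweighs the increase of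
    [|w_k|] for even [k], which is of order [sin^2 th].

    No power series expansion of [W] is needed: its coefficients are means over circles, which do
    not depend on the radius by Goursat's lemma on a logarithmic strip. The same mean value
    property gives the open mapping property of [phi] and the unboundedness of [E]. *)

(* Seen from [p], the point [phi 0] need not lie on the axis of the cone; the deviation is the angle
   [a th], with [c = e^(2 i th)]. Hence a whole family of sector maps has to be compared with the
   symmetric one, through the sums of the moduli of their coefficients. The opening angle and the
   distance are infima, used only through approximations, and one parameter [s -> 0] serves for
   both. For [alpha = 2] the condition on the angle says nothing, since the plane itself is a sector
   of opening [2 PI], and no [a > alpha] is available because the cone has angle [(2 - a) PI]; a ray
   then replaces the cone. The bound [r <= 1/3] enters Bohr's theorem through
   [r + r^2 + ... <= 1/2]. It enters the comparison with [c = 1] through the correction exponent [(a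
   - 1) sin^2 th (6 r^2 + 16 r^4 - 3 r / 2)], which stays below [sin^2 th / 2], so that the factor
   [cos th] absorbs it. *)
Require Import Defs.
From Stdlib Require Import Reals Ranalysis5 Lra Lia ClassicalEpsilon.
From Coquelicot Require Import Coquelicot.

Local Open Scope R_scope.

(** * Complex derivative, exponential and logarithm *)

(* Coquelicot states [is_derive_mult] and [is_derive_comp] for [AbsRing_NormedModule C_AbsRing],
   while [analytic_on_disc] uses [C_NormedModule]; this form is equivalent to both. *)
Definition cder (f : C -> C) (z l : C) : Prop :=
  forall eps : R, 0 < eps -> exists del : R, 0 < del /\
    forall w : C, Cmod (w - z)%C < del ->
      Cmod (f w - f z - l * (w - z))%C <= eps * Cmod (w - z)%C.

Lemma Cmod_sub_sym (x y : C) : Cmod (x - y)%C = Cmod (y - x)%C.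
Proof. rewrite <- Cmod_opp. f_equal. ring. Qed.

Lemma cder_is_derive (f : C -> C) (z l : C) :
  cder f z l <-> @is_derive C_AbsRing C_NormedModule f z l.
Proof.
  split.
  - intros H. split; [apply is_linear_scal_l|].
    intros x Hx eps.
    apply (@is_filter_lim_locally_unique C_AbsRing (AbsRing_NormedModule C_AbsRing)) in Hx. rewrite <- Hx.
    destruct (H eps (cond_pos eps)) as [d [Hd H']].
    exists (mkposreal d Hd). intros y Hy.
    change (Cmod ((f y - f z) - (y - z) * l)%C <= eps * Cmod (y - z)%C).
    replace ((f y - f z) - (y - z) * l)%C with (f y - f z - l * (y - z))%C by ring.
    apply H'. exact Hy.
  - intros [_ H] eps Heps.
    destruct (H z (fun P HP => HP) (mkposreal eps Heps)) as [d Hd].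
    exists d. split; [apply cond_pos|]. intros w Hw.
    specialize (Hd w Hw).
    change (Cmod ((f w - f z) - (w - z) * l)%C <= eps * Cmod (w - z)%C) in Hd.
    replace ((f w - f z) - (w - z) * l)%C with (f w - f z - l * (w - z))%C in Hd by ring.
    exact Hd.
Qed.

Lemma cder_is_derive_ring (f : C -> C) (z l : C) :
  cder f z l <-> @is_derive C_AbsRing (AbsRing_NormedModule C_AbsRing) f z l.
Proof.
  split.
  - intros H. split; [apply is_linear_scal_l|].
    intros x Hx eps.
    apply (@is_filter_lim_locally_unique C_AbsRing (AbsRing_NormedModule C_AbsRing)) in Hx. rewrite <- Hx.
    destruct (H eps (cond_pos eps)) as [d [Hd H']].
    exists (mkposreal d Hd). intros y Hy.
    change (Cmod ((f y - f z) - (y - z) * l)%C <= eps * Cmod (y - z)%C).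
    replace ((f y - f z) - (y - z) * l)%C with (f y - f z - l * (y - z))%C by ring.
    apply H'. exact Hy.
  - intros [_ H] eps Heps.
    destruct (H z (fun P HP => HP) (mkposreal eps Heps)) as [d Hd].
    exists d. split; [apply cond_pos|]. intros w Hw.
    specialize (Hd w Hw).
    change (Cmod ((f w - f z) - (w - z) * l)%C <= eps * Cmod (w - z)%C) in Hd.
    replace ((f w - f z) - (w - z) * l)%C with (f w - f z - l * (w - z))%C in Hd by ring.
    exact Hd.
Qed.

Lemma cder_ext_loc (f g : C -> C) (z l : C) (d : R) :
  0 < d -> (forall w, Cmod (w - z)%C < d -> f w = g w) -> cder f z l -> cder g z l.
Proof.
  intros Hd E H eps He. destruct (H eps He) as [d' [Hd' H']].
  exists (Rmin d d'). split; [now apply Rmin_pos|].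
  intros w Hw. rewrite <- E. rewrite <- (E z).
  - apply H'. eapply Rlt_le_trans; [exact Hw|apply Rmin_r].
  - replace (z - z)%C with (RtoC 0) by ring. rewrite Cmod_0. exact Hd.
  - eapply Rlt_le_trans; [exact Hw|apply Rmin_l].
Qed.

Lemma cder_ext (f g : C -> C) (z l : C) :
  (forall w, f w = g w) -> cder f z l -> cder g z l.
Proof. intros E. apply cder_ext_loc with 1; [lra|intros; apply E]. Qed.

Lemma cder_const (a z : C) : cder (fun _ => a) z 0%C.
Proof.
  intros eps He. exists 1. split; [lra|]. intros w _.
  replace (a - a - 0 * (w - z))%C with (RtoC 0) by ring.
  rewrite Cmod_0. apply Rmult_le_pos; [lra|apply Cmod_ge_0].
Qed.

Lemma cder_id (z : C) : cder (fun w => w) z 1%C.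
Proof.
  intros eps He. exists 1. split; [lra|]. intros w _.
  replace (w - z - 1 * (w - z))%C with (RtoC 0) by ring.
  rewrite Cmod_0. apply Rmult_le_pos; [lra|apply Cmod_ge_0].
Qed.

Lemma cder_plus (f g : C -> C) (z lf lg : C) :
  cder f z lf -> cder g z lg -> cder (fun w => f w + g w)%C z (lf + lg)%C.
Proof.
  rewrite !cder_is_derive. intros Hf Hg. exact (is_derive_plus _ _ _ _ _ Hf Hg).
Qed.

Lemma cder_mult (f g : C -> C) (z lf lg : C) :
  cder f z lf -> cder g z lg ->
  cder (fun w => f w * g w)%C z (lf * g z + f z * lg)%C.
Proof.
  rewrite !cder_is_derive_ring. intros Hf Hg.
  exact (is_derive_mult f g z lf lg Hf Hg Cmult_comm).
Qed.

Lemma cder_scal (f : C -> C) (a z l : C) :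
  cder f z l -> cder (fun w => a * f w)%C z (a * l)%C.
Proof.
  intros H. replace (a * l)%C with (0 * f z + a * l)%C by ring.
  apply (cder_mult (fun _ => a) f); [apply cder_const|exact H].
Qed.

Lemma cder_opp (f : C -> C) (z l : C) :
  cder f z l -> cder (fun w => - f w)%C z (- l)%C.
Proof.
  intros H. apply cder_ext with (fun w => (-1) * f w)%C; [intros; ring|].
  replace (- l)%C with (-1 * l)%C by ring. now apply cder_scal.
Qed.

Lemma cder_minus (f g : C -> C) (z lf lg : C) :
  cder f z lf -> cder g z lg -> cder (fun w => f w - g w)%C z (lf - lg)%C.
Proof. intros Hf Hg. apply (cder_plus f (fun w => - g w)%C); auto using cder_opp. Qed.

Lemma cder_comp (f g : C -> C) (z lf lg : C) :
  cder f (g z) lf -> cder g z lg -> cder (fun w => f (g w)) z (lf * lg)%C.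
Proof.
  rewrite !cder_is_derive_ring. intros Hf Hg. rewrite Cmult_comm.
  exact (@is_derive_comp C_AbsRing (AbsRing_NormedModule C_AbsRing) f g z lf lg Hf Hg).
Qed.

Lemma cder_eq (f : C -> C) (z l l' : C) : cder f z l -> l = l' -> cder f z l'.
Proof. now intros H <-. Qed.

Lemma cder_cont (f : C -> C) (z l : C) :
  cder f z l -> forall eps, 0 < eps -> exists del, 0 < del /\
    forall w, Cmod (w - z)%C < del -> Cmod (f w - f z)%C < eps.
Proof.
  intros H eps He. destruct (H 1 Rlt_0_1) as [d [Hd H']].
  pose proof (Cmod_ge_0 l) as Hl.
  exists (Rmin d (eps / (Cmod l + 2))). split.
  - apply Rmin_pos; [exact Hd|]. apply Rdiv_lt_0_compat; lra.
  - intros w Hw. specialize (H' w (Rlt_le_trans _ _ _ Hw (Rmin_l _ _))).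
    assert (Hw2 : Cmod (w - z)%C < eps / (Cmod l + 2))
      by (eapply Rlt_le_trans; [exact Hw|apply Rmin_r]).
    replace (f w - f z)%C with ((f w - f z - l * (w - z)) + l * (w - z))%C by ring.
    eapply Rle_lt_trans; [apply Cmod_triangle|]. rewrite Cmod_mult.
    apply (Rmult_lt_compat_r (Cmod l + 2)) in Hw2; [|lra].
    unfold Rdiv in Hw2. rewrite Rmult_assoc, Rinv_l in Hw2 by lra.
    pose proof (Cmod_ge_0 (w - z)%C). nra.
Qed.

Lemma cder_inv (z : C) : z <> 0%C -> cder (fun w => / w)%C z (- / (z * z))%C.
Proof.
  intros Hz eps He. pose proof (proj1 (Cmod_gt_0 z) Hz) as Hm.
  set (m := Cmod z) in *.
  (* The first bound keeps [|w| >= m / 2]; the second then controls the remainder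
     [|w - z|^2 / (m^2 |w|)]. *)
  exists (Rmin (m / 2) (eps * (m * m * m) / 2)). split.
  { apply Rmin_pos; [lra|]. assert (0 < m * m * m) by (repeat apply Rmult_lt_0_compat; lra). nra. }
  intros w Hw.
  assert (Hw1 : Cmod (w - z)%C < m / 2) by (eapply Rlt_le_trans; [exact Hw|apply Rmin_l]).
  assert (Hw2 : Cmod (w - z)%C < eps * (m * m * m) / 2) by (eapply Rlt_le_trans; [exact Hw|apply Rmin_r]).
  assert (Hwm : m / 2 <= Cmod w).
  { assert (m <= Cmod w + Cmod (z - w)%C).
    { unfold m. replace z with (w + (z - w))%C at 1 by ring. apply Cmod_triangle. }
    rewrite Cmod_sub_sym in H. lra. }
  assert (Hw0 : w <> 0%C) by (apply Cmod_gt_0; lra).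
  replace (/ w - / z - - / (z * z) * (w - z))%C
    with (((w - z) * (w - z)) * / (z * z * w))%C by (field; auto).
  rewrite !Cmod_mult, Cmod_inv, !Cmod_mult by (repeat apply Cmult_neq_0; auto).
  fold m. pose proof (Cmod_ge_0 (w - z)%C) as H0.
  set (q := Cmod (w - z)%C) in *.
  apply Rmult_le_reg_r with (m * m * Cmod w).
  { repeat apply Rmult_lt_0_compat; lra. }
  rewrite Rmult_assoc, Rinv_l by (apply Rgt_not_eq; repeat apply Rmult_lt_0_compat; lra).
  assert (eps * (m * m * m) / 2 <= eps * (m * m * Cmod w)).
  { assert (m * m * (m / 2) <= m * m * Cmod w) by (apply Rmult_le_compat_l; nra). nra. }
  replace (eps * q * (m * m * Cmod w)) with (q * (eps * (m * m * Cmod w))) by ring.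
  rewrite Rmult_1_r. apply Rmult_le_compat_l; lra.
Qed.

Lemma cder_div (f g : C -> C) (z lf lg : C) :
  cder f z lf -> cder g z lg -> g z <> 0%C ->
  cder (fun w => f w / g w)%C z ((lf * g z - f z * lg) / (g z * g z))%C.
Proof.
  intros Hf Hg H0.
  pose proof (cder_comp _ _ _ _ _ (cder_inv _ H0) Hg) as Hi.
  pose proof (cder_mult _ _ _ _ _ Hf Hi) as H.
  eapply cder_eq; [exact H|]. cbv beta. field. exact H0.
Qed.

Lemma cder_pow (n : nat) (z : C) :
  cder (fun w => w ^ n)%C z (INR n * z ^ (pred n))%C.
Proof.
  induction n as [|n IH].
  - simpl. eapply cder_eq; [apply cder_const|]. ring.
  - change (fun w : C => w ^ S n)%C with (fun w : C => w * w ^ n)%C.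
    eapply cder_eq; [exact (cder_mult _ _ _ _ _ (cder_id z) IH)|].
    rewrite S_INR, RtoC_plus. destruct n; simpl pred; [simpl; ring|].
    simpl. ring.
Qed.

(** * The complex exponential and its injectivity on strips *)

Definition cexp (z : C) : C := (exp (fst z) * cos (snd z), exp (fst z) * sin (snd z)).

Lemma cexp_plus (z w : C) : cexp (z + w)%C = (cexp z * cexp w)%C.
Proof.
  unfold cexp, Cmult, Cplus; simpl. rewrite exp_plus, cos_plus, sin_plus.
  f_equal; ring.
Qed.

Lemma cexp_0 : cexp 0%C = 1%C.
Proof. unfold cexp; simpl. rewrite exp_0, cos_0, sin_0. unfold RtoC. f_equal; ring. Qed.

Lemma Cmod_cexp (z : C) : Cmod (cexp z) = exp (fst z).
Proof.
  unfold Cmod, cexp; cbn [fst snd].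
  replace (_ + _) with (Rsqr (exp (fst z))).
  - apply sqrt_Rsqr. left; apply exp_pos.
  - pose proof (sin2_cos2 (snd z)) as H. unfold Rsqr in *.
    transitivity (exp (fst z) * exp (fst z) * (sin (snd z) * sin (snd z) + cos (snd z) * cos (snd z))).
    + rewrite H; ring.
    + simpl; ring.
Qed.

Lemma cexp_neq_0 (z : C) : cexp z <> 0%C.
Proof. apply Cmod_gt_0. rewrite Cmod_cexp. apply exp_pos. Qed.

Lemma Rabs_Re_le (z : C) : Rabs (fst z) <= Cmod z.
Proof. eapply Rle_trans; [|apply Rmax_Cmod]. apply Rmax_l. Qed.
Lemma Rabs_Im_le (z : C) : Rabs (snd z) <= Cmod z.
Proof. eapply Rle_trans; [|apply Rmax_Cmod]. apply Rmax_r. Qed.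

Lemma Cmod_le_Rabs (x y : R) : Cmod (x, y) <= Rabs x + Rabs y.
Proof.
  replace (x, y) with (RtoC x + (0, y))%C by (unfold Cplus, RtoC; simpl; f_equal; ring).
  eapply Rle_trans; [apply Cmod_triangle|]. rewrite Cmod_R.
  apply Rplus_le_compat_l. unfold Cmod; cbn [fst snd].
  replace (0 ^ 2 + y ^ 2) with (Rsqr y) by (unfold Rsqr; ring).
  rewrite sqrt_Rsqr_abs. lra.
Qed.

Lemma cder_cexp_0 : cder cexp 0%C 1%C.
Proof.
  intros eps He.
  (* The error terms at the end add up to at most [9 e m]; [e <= 1] also keeps [exp x] below 3. *)
  set (e := Rmin (eps / 10) 1).
  assert (He0 : 0 < e) by (apply Rmin_pos; lra).
  assert (He1 : e <= 1) by apply Rmin_r.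
  assert (He2 : 10 * e <= eps) by (pose proof (Rmin_l (eps / 10) 1); unfold e; lra).
  destruct (derivable_pt_lim_exp 0 e He0) as [d1 H1].
  destruct (derivable_pt_lim_sin 0 e He0) as [d2 H2].
  destruct (derivable_pt_lim_cos 0 e He0) as [d3 H3].
  assert (K : forall (f : R -> R) (l : R) (d : posreal),
    (forall h, h <> 0 -> Rabs h < d -> Rabs ((f (0 + h) - f 0) / h - l) < e) ->
    forall h, Rabs h < d -> Rabs (f h - f 0 - l * h) <= e * Rabs h).
  { intros f l d H h Hh. destruct (Req_dec h 0) as [->|Hn].
    - replace (f 0 - f 0 - l * 0) with 0 by ring. rewrite Rabs_R0. lra.
    - specialize (H h Hn Hh). rewrite Rplus_0_l in H.
      replace (f h - f 0 - l * h) with (((f h - f 0) / h - l) * h) by (field; auto).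
      rewrite Rabs_mult. apply Rmult_le_compat_r; [apply Rabs_pos|lra]. }
  pose proof (K _ _ _ H1) as G1. pose proof (K _ _ _ H2) as G2. pose proof (K _ _ _ H3) as G3.
  clear K H1 H2 H3.
  rewrite exp_0 in G1. rewrite sin_0, cos_0 in G2. rewrite cos_0, sin_0 in G3.
  exists (Rmin (Rmin d1 d2) (Rmin d3 e)).
  pose proof (cond_pos d1); pose proof (cond_pos d2); pose proof (cond_pos d3).
  split; [apply Rmin_pos; [apply Rmin_pos; auto|apply Rmin_pos; [auto|exact He0]]|].
  intros [x y] Hw. rewrite cexp_0.
  replace ((x, y) - 0)%C with ((x, y) : C) in * by (unfold Cminus, Cplus, Copp, RtoC; simpl; f_equal; ring).
  assert (Hx : Rabs x <= Cmod (x, y)) by apply (Rabs_Re_le (x, y)).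
  assert (Hy : Rabs y <= Cmod (x, y)) by apply (Rabs_Im_le (x, y)).
  set (m := Cmod (x, y)) in *.
  pose proof (Rmin_l (Rmin d1 d2) (Rmin d3 e)). pose proof (Rmin_r (Rmin d1 d2) (Rmin d3 e)).
  pose proof (Rmin_l d1 d2). pose proof (Rmin_r d1 d2). pose proof (Rmin_l d3 e). pose proof (Rmin_r d3 e).
  assert (F1 : Rabs (exp x - 1 - 1 * x) <= e * Rabs x) by (apply G1; lra).
  assert (F2 : Rabs (sin y - 0 - 1 * y) <= e * Rabs y) by (apply G2; lra).
  assert (F3 : Rabs (cos y - 1 - - 0 * y) <= e * Rabs y) by (apply G3; lra).
  assert (B1 : Rabs (exp x - 1 - 1 * x) <= e * m) by (eapply Rle_trans; [exact F1|apply Rmult_le_compat_l; lra]).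
  assert (B2 : Rabs (sin y - 0 - 1 * y) <= e * m) by (eapply Rle_trans; [exact F2|apply Rmult_le_compat_l; lra]).
  assert (B3 : Rabs (cos y - 1 - - 0 * y) <= e * m) by (eapply Rle_trans; [exact F3|apply Rmult_le_compat_l; lra]).
  clear F1 F2 F3 G1 G2 G3.
  assert (Hm0 : 0 <= m) by apply Cmod_ge_0.
  assert (Hme : m < e) by lra.
  assert (Bx : Rabs (exp x - 1) <= 2 * m).
  { replace (exp x - 1) with ((exp x - 1 - 1 * x) + x) by ring.
    eapply Rle_trans; [apply Rabs_triang|]. nra. }
  assert (Bx' : Rabs (exp x) <= 3).
  { replace (exp x) with ((exp x - 1) + 1) by ring.
    eapply Rle_trans; [apply Rabs_triang|]. rewrite Rabs_R1. lra. }
  replace (cexp (x, y) - 1 - 1 * (x, y))%C with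
    ((exp x - 1 - 1 * x) + exp x * (cos y - 1 - - 0 * y),
     exp x * (sin y - 0 - 1 * y) + (exp x - 1) * y)
    by (unfold cexp, Cminus, Cplus, Copp, Cmult, RtoC; simpl; f_equal; ring).
  eapply Rle_trans; [apply Cmod_le_Rabs|].
  eapply Rle_trans; [apply Rplus_le_compat; apply Rabs_triang|].
  rewrite !Rabs_mult.
  assert (Rabs (exp x) * Rabs (cos y - 1 - - 0 * y) <= 3 * (e * m)) by (apply Rmult_le_compat; auto; apply Rabs_pos).
  assert (Rabs (exp x) * Rabs (sin y - 0 - 1 * y) <= 3 * (e * m)) by (apply Rmult_le_compat; auto; apply Rabs_pos).
  assert (Rabs (exp x - 1) * Rabs y <= 2 * m * e) by (apply Rmult_le_compat; auto; try apply Rabs_pos; lra).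
  nra.
Qed.

Lemma cder_cexp (z : C) : cder cexp z (cexp z).
Proof.
  apply cder_ext with (fun w => cexp z * cexp (w - z))%C.
  { intros w. rewrite <- cexp_plus. f_equal. ring. }
  eapply cder_eq.
  - apply cder_scal. apply (cder_comp cexp (fun w => w - z)%C).
    + replace (z - z)%C with (RtoC 0) by ring. apply cder_cexp_0.
    + eapply cder_eq; [apply cder_minus; [apply cder_id|apply cder_const]|reflexivity].
  - ring.
Qed.

Lemma cos_eq_1_0 (x : R) : -2 * PI < x < 2 * PI -> cos x = 1 -> x = 0.
Proof.
  intros Hx H.
  assert (Hs : sin (x / 2) = 0).
  { replace x with (2 * (x / 2)) in H by field. rewrite cos_2a_sin in H. nra. }
  destruct (Rtotal_order x 0) as [Hn|[H0|Hp]]; [|exact H0|].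
  - assert (0 < sin (- (x / 2))) by (apply sin_gt_0; lra).
    rewrite sin_neg in H0. lra.
  - assert (0 < sin (x / 2)) by (apply sin_gt_0; lra). lra.
Qed.

Lemma cexp_inj (z w : C) :
  Rabs (snd z - snd w) < 2 * PI -> cexp z = cexp w -> z = w.
Proof.
  intros Hd H.
  assert (Hr : fst z = fst w).
  { apply exp_inv. rewrite <- !Cmod_cexp. now rewrite H. }
  assert (Hi : snd z - snd w = 0).
  { apply cos_eq_1_0; [apply Rabs_def2 in Hd; lra|].
    unfold cexp in H. injection H as H1 H2. rewrite Hr in *.
    pose proof (exp_pos (fst w)).
    apply Rmult_eq_reg_l in H1; [|lra]. apply Rmult_eq_reg_l in H2; [|lra].
    rewrite cos_minus, H1, H2. pose proof (sin2_cos2 (snd w)). unfold Rsqr in *. lra. }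
  destruct z, w; simpl in *. f_equal; lra.
Qed.

(** * The principal logarithm on the plane cut along the nonpositive real axis *)

Definition slit (z : C) : Prop := 0 < Cmod z + fst z.

(** The half-angle formula [tan (t / 2) = sin t / (1 + cos t)]: a single expression for the argument
    on the whole slit plane. *)
Definition carg (z : C) : R := 2 * atan (snd z / (Cmod z + fst z)).
Definition clog (z : C) : C := (ln (Cmod z), carg z).

Lemma Cmod_sqr (z : C) : Cmod z * Cmod z = fst z * fst z + snd z * snd z.
Proof. unfold Cmod. rewrite sqrt_sqrt; [ring|nra]. Qed.

Lemma slit_Cmod_pos (z : C) : slit z -> 0 < Cmod z.
Proof.
  unfold slit. intros H. pose proof (Cmod_ge_0 z). pose proof (Rabs_Re_le z).
  pose proof (Rle_abs (fst z)). lra.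
Qed.

Lemma not_slit (z : C) : ~ slit z -> fst z <= 0 /\ snd z = 0.
Proof.
  unfold slit. intros H. pose proof (Cmod_ge_0 z). pose proof (Cmod_sqr z). split.
  - lra.
  - assert (snd z * snd z <= 0) by nra. nra.
Qed.

Lemma carg_bound (z : C) : - PI < carg z < PI.
Proof. unfold carg. pose proof (atan_bound (snd z / (Cmod z + fst z))). lra. Qed.

Lemma cexp_clog (z : C) : slit z -> cexp (clog z) = z.
Proof.
  intros Hs. pose proof (slit_Cmod_pos z Hs) as Hm. unfold slit in Hs.
  unfold cexp, clog, carg; cbn [fst snd]. rewrite exp_ln by exact Hm.
  pose proof (Cmod_sqr z) as Hq. set (m := Cmod z) in *.
  destruct z as [x y]; cbn [fst snd] in *.
  set (T := y / (m + x)).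
  rewrite cos_2a, sin_2a, cos_atan, sin_atan.
  assert (HT : 0 < 1 + T²) by (pose proof (Rle_0_sqr T); lra).
  assert (HTv : 1 + T² = 2 * m / (m + x)).
  { unfold T, Rsqr. apply Rmult_eq_reg_r with ((m + x) * (m + x)); [|nra].
    field_simplify; [|lra|lra]. nra. }
  assert (Hss : sqrt (1 + T²) * sqrt (1 + T²) = 1 + T²) by (apply sqrt_sqrt; lra).
  assert (Hs0 : sqrt (1 + T²) <> 0) by (apply Rgt_not_eq, sqrt_lt_R0; lra).
  f_equal.
  - replace (1 / sqrt (1 + T²) * (1 / sqrt (1 + T²)) - T / sqrt (1 + T²) * (T / sqrt (1 + T²)))
      with ((1 - T * T) / (sqrt (1 + T²) * sqrt (1 + T²))) by (field; auto).
    rewrite Hss, HTv.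
    replace (1 - T * T) with (2 - (1 + T²)) by (unfold Rsqr; ring). rewrite HTv.
    field; lra.
  - replace (2 * (T / sqrt (1 + T²)) * (1 / sqrt (1 + T²)))
      with (2 * T / (sqrt (1 + T²) * sqrt (1 + T²))) by (field; auto).
    rewrite Hss, HTv. unfold T. field; lra.
Qed.

Lemma slit_cexp (v : C) : Rabs (snd v) < PI -> slit (cexp v).
Proof.
  intros H. unfold slit. rewrite Cmod_cexp. unfold cexp; cbn [fst].
  assert (-1 < cos (snd v)).
  { replace (snd v) with (2 * (snd v / 2)) by field. rewrite cos_2a_cos.
    apply Rabs_def2 in H. assert (0 < cos (snd v / 2)) by (apply cos_gt_0; lra). nra. }
  pose proof (exp_pos (fst v)). nra.
Qed.

Lemma clog_cexp (v : C) : Rabs (snd v) < PI -> clog (cexp v) = v.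
Proof.
  intros H. apply cexp_inj.
  - cbn [clog snd]. pose proof (carg_bound (cexp v)). apply Rabs_def2 in H.
    apply Rabs_def1; lra.
  - apply cexp_clog. now apply slit_cexp.
Qed.

Lemma Cmod_dist (z w : C) : Rabs (Cmod w - Cmod z) <= Cmod (w - z)%C.
Proof.
  apply Rabs_le. split.
  - assert (Cmod z <= Cmod w + Cmod (z - w)%C).
    { replace z with (w + (z - w))%C at 1 by ring. apply Cmod_triangle. }
    rewrite Cmod_sub_sym in H. lra.
  - assert (Cmod w <= Cmod z + Cmod (w - z)%C).
    { replace w with (z + (w - z))%C at 1 by ring. apply Cmod_triangle. }
    lra.
Qed.

Lemma continuous_Cmod_R2 (z : C) :
  @continuous (prod_UniformSpace R_UniformSpace R_UniformSpace) R_UniformSpace Cmod z.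
Proof.
  intros P [e He].
  assert (H2 : 0 < e / 2) by (pose proof (cond_pos e); lra).
  exists (mkposreal _ H2). intros w [H1 H3]. apply He.
  change (Rabs (fst w - fst z) < e / 2) in H1. change (Rabs (snd w - snd z) < e / 2) in H3.
  change (Rabs (Cmod w - Cmod z) < e).
  eapply Rle_lt_trans; [apply Cmod_dist|].
  eapply Rle_lt_trans; [apply (Cmod_le_Rabs (fst w - fst z) (snd w - snd z))|]. lra.
Qed.

Lemma clog_cont (z : C) : slit z -> forall eps, 0 < eps -> exists del, 0 < del /\
    forall w, Cmod (w - z)%C < del -> Cmod (clog w - clog z)%C < eps.
Proof.
  intros Hs eps He. pose proof (slit_Cmod_pos z Hs) as Hm.
  assert (C1 : @continuous (prod_UniformSpace R_UniformSpace R_UniformSpace) R_UniformSpace (fun w => ln (Cmod w)) z).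
  { apply (continuous_comp Cmod ln); [apply continuous_Cmod_R2|].
    apply continuity_pt_filterlim. apply derivable_continuous_pt.
    exists (/ Cmod z). apply derivable_pt_lim_ln. exact Hm. }
  assert (C2 : @continuous (prod_UniformSpace R_UniformSpace R_UniformSpace) R_UniformSpace carg z).
  { unfold carg. apply (continuous_mult (K := R_AbsRing)); [apply continuous_const|].
    apply (continuous_comp (fun w : C => snd w / (Cmod w + fst w)) atan).
    2: { apply continuity_pt_filterlim. apply derivable_continuous_pt.
         eexists. apply derivable_pt_lim_atan. }
    apply (continuous_mult (K := R_AbsRing)); [apply continuous_snd|].
    apply (continuous_comp (fun w : C => Cmod w + fst w) Rinv).
    - apply (continuous_plus (V := R_NormedModule)); [apply continuous_Cmod_R2|apply continuous_fst].
    - apply continuity_pt_filterlim. apply continuity_pt_inv; [apply continuity_pt_id|].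
      unfold slit in Hs. lra. }
  assert (P2 : 0 < eps / 2) by lra.
  destruct (C1 _ (locally_ball (ln (Cmod z)) (mkposreal _ P2))) as [d1 H1].
  destruct (C2 _ (locally_ball (carg z) (mkposreal _ P2))) as [d2 H2].
  exists (Rmin d1 d2). split; [apply Rmin_pos; apply cond_pos|].
  intros w Hw.
  pose proof (Rabs_Re_le (w - z)%C) as Hr. pose proof (Rabs_Im_le (w - z)%C) as Hi.
  pose proof (Rmin_l d1 d2). pose proof (Rmin_r d1 d2).
  assert (B1 : ball (M := prod_UniformSpace R_UniformSpace R_UniformSpace) z d1 w).
  { split; unfold ball; simpl; unfold AbsRing_ball, abs, minus, plus, opp; simpl;
    [change (Rabs (fst (w - z)%C) < d1)|change (Rabs (snd (w - z)%C) < d1)]; lra. }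
  assert (B2 : ball (M := prod_UniformSpace R_UniformSpace R_UniformSpace) z d2 w).
  { split; unfold ball; simpl; unfold AbsRing_ball, abs, minus, plus, opp; simpl;
    [change (Rabs (fst (w - z)%C) < d2)|change (Rabs (snd (w - z)%C) < d2)]; lra. }
  specialize (H1 w B1). specialize (H2 w B2).
  change (Rabs (ln (Cmod w) - ln (Cmod z)) < eps / 2) in H1.
  change (Rabs (carg w - carg z) < eps / 2) in H2.
  eapply Rle_lt_trans; [apply Cmod_le_Rabs|].
  change (fst (clog w - clog z)%C) with (ln (Cmod w) - ln (Cmod z)).
  unfold clog; cbn [fst snd Cminus Cplus Copp].
  change (Rabs (ln (Cmod w) - ln (Cmod z)) + Rabs (carg w - carg z) < eps). lra.
Qed.

Lemma slit_open (z : C) : slit z -> exists del, 0 < del /\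
  forall w, Cmod (w - z)%C < del -> slit w.
Proof.
  unfold slit. intros H. exists ((Cmod z + fst z) / 2). split; [lra|].
  intros w Hw.
  assert (Cmod z <= Cmod w + Cmod (z - w)%C).
  { replace z with (w + (z - w))%C at 1 by ring. apply Cmod_triangle. }
  rewrite Cmod_sub_sym in H0. pose proof (Rabs_Re_le (w - z)%C) as Hr.
  change (fst (w - z)%C) with (fst w - fst z) in Hr.
  apply Rabs_le_between in Hr. lra.
Qed.

(** Inverse function argument: continuity makes the increment [D] of the logarithm small, and
    [w - z = z D + o(D)] is solved for [D]. The bound [e <= m / 2] first gives
    [|D| <= 2 |w - z| / m]; the other bound on [e] then turns [o(D)] into [o(w - z)]. *)
Lemma cder_clog (z : C) : slit z -> cder clog z (/ z)%C.
Proof.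
  intros Hs eps He.
  pose proof (slit_Cmod_pos z Hs) as Hm.
  assert (Hz : z <> 0%C) by now apply Cmod_gt_0.
  set (m := Cmod z) in *.
  set (e := Rmin (m / 2) (eps * (m * m) / 4)).
  assert (Hmm : 0 < m * m) by (apply Rmult_lt_0_compat; exact Hm).
  assert (Hem : 0 < eps * (m * m)) by (apply Rmult_lt_0_compat; [exact He|exact Hmm]).
  assert (He0 : 0 < e) by (apply Rmin_pos; lra).
  destruct (cder_cexp (clog z) e He0) as [d1 [Hd1 H1]].
  destruct (clog_cont z Hs d1 Hd1) as [d2 [Hd2 H2]].
  destruct (slit_open z Hs) as [d3 [Hd3 H3]].
  exists (Rmin d2 d3). split; [now apply Rmin_pos|].
  intros w Hw.
  assert (A2 : Cmod (w - z)%C < d2) by (eapply Rlt_le_trans; [exact Hw|apply Rmin_l]).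
  assert (A3 : Cmod (w - z)%C < d3) by (eapply Rlt_le_trans; [exact Hw|apply Rmin_r]).
  specialize (H1 _ (H2 w A2)).
  rewrite !cexp_clog in H1 by auto.
  set (D := (clog w - clog z)%C) in *.
  replace (w - z - z * D)%C with (- (z * (D - / z * (w - z))))%C in H1 by (field; auto).
  rewrite Cmod_opp, Cmod_mult in H1. fold m in H1.
  assert (E1 : e <= m / 2) by apply Rmin_l. assert (E2 : e <= eps * (m * m) / 4) by apply Rmin_r.
  assert (HD : Cmod D <= Cmod (D - / z * (w - z))%C + / m * Cmod (w - z)%C).
  { replace D with ((D - / z * (w - z)) + / z * (w - z))%C at 1 by ring.
    eapply Rle_trans; [apply Cmod_triangle|]. rewrite Cmod_mult, Cmod_inv by auto. fold m. lra. }
  set (X := Cmod (D - / z * (w - z))%C) in *. set (q := Cmod (w - z)%C) in *.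
  pose proof (Cmod_ge_0 D) as HD0.
  assert (HX : m * X <= m / 2 * Cmod D) by nra.
  assert (HDq : m * Cmod D <= 2 * q).
  { apply (Rmult_le_compat_l m) in HD; [|lra].
    replace (m * (X + / m * q)) with (m * X + q) in HD by (field; lra). lra. }
  apply Rmult_le_reg_l with (m * m); [nra|].
  assert (m * (m * X) <= m * (eps * (m * m) / 4 * Cmod D)) by (apply Rmult_le_compat_l; nra).
  assert (eps * (m * m) / 4 * (m * Cmod D) <= eps * (m * m) / 4 * (2 * q)) by (apply Rmult_le_compat_l; nra).
  assert (0 <= q) by apply Cmod_ge_0. assert (0 <= eps * (m * m) * q) by (apply Rmult_le_pos; nra).
  nra.
Qed.

Lemma C_polar (z : C) : exists t : R, -PI < t <= PI /\ z = (RtoC (Cmod z) * (cos t, sin t))%C.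
Proof.
  destruct (Rlt_dec 0 (Cmod z + fst z)) as [H|H].
  - exists (carg z). split; [pose proof (carg_bound z); lra|].
    rewrite <- (cexp_clog z H) at 1. unfold cexp, clog, Cmult, RtoC; cbn [fst snd].
    rewrite exp_ln by now apply slit_Cmod_pos. f_equal; ring.
  - apply not_slit in H as [H1 H2]. exists PI. pose proof PI_RGT_0. split; [lra|].
    rewrite cos_PI, sin_PI. destruct z as [x y]; cbn [fst snd] in *. subst y.
    unfold Cmod; cbn [fst snd]. replace (x ^ 2 + 0 ^ 2) with (Rsqr x) by (unfold Rsqr; ring).
    rewrite sqrt_Rsqr_abs, Rabs_left1 by exact H1.
    unfold Cmult, RtoC; cbn [fst snd]. f_equal; ring.
Qed.

Lemma RtoC_neq_0 (x : R) : x <> 0 -> RtoC x <> 0%C.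
Proof. intros H E. apply H. exact (f_equal fst E). Qed.

Lemma Cminus_eq_0 (x y : C) : (x - y)%C = 0%C -> x = y.
Proof. intros H. replace x with ((x - y) + y)%C by ring. rewrite H. ring. Qed.

(** * Goursat's lemma and means over circles *)

(** [u n] and [u n + A / 2^n] are the endpoints of nested intervals. *)
Lemma nested_limit (u : nat -> R) (A : R) :
  (forall n, u n <= u (S n) <= u n + A * (1 / 2) ^ S n) -> 0 <= A ->
  exists l, forall n, u n <= l <= u n + A * (1 / 2) ^ n.
Proof.
  intros H HA.
  assert (Hd : forall n k, u (n + k)%nat + A * (1 / 2) ^ (n + k) <= u n + A * (1 / 2) ^ n).
  { intros n k. induction k as [|k IH]; [rewrite Nat.add_0_r; lra|].
    rewrite Nat.add_succ_r. eapply Rle_trans; [|exact IH].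
    destruct (H (n + k)%nat). simpl pow in *. lra. }
  assert (Hi : forall n k, u n <= u (n + k)%nat).
  { intros n k. induction k as [|k IH]; [rewrite Nat.add_0_r; lra|].
    rewrite Nat.add_succ_r. destruct (H (n + k)%nat). lra. }
  assert (Hp : forall n, 0 <= A * (1 / 2) ^ n) by (intros; apply Rmult_le_pos; [lra|apply pow_le; lra]).
  assert (Hall : forall n m, u n <= u m + A * (1 / 2) ^ m).
  { intros n m. destruct (Nat.le_ge_cases n m) as [L|L].
    - replace m with (n + (m - n))%nat by lia. pose proof (Hi n (m - n)%nat). pose proof (Hp (n + (m - n))%nat). lra.
    - replace n with (m + (n - m))%nat by lia. pose proof (Hd m (n - m)%nat). pose proof (Hp (m + (n - m))%nat). lra. }
  destruct (completeness (fun x => exists n, x = u n)) as [l [Hl1 Hl2]].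
  - exists (u 0%nat + A * (1 / 2) ^ 0). intros x [n ->]. apply Hall.
  - exists (u 0%nat), 0%nat. reflexivity.
  - exists l. intros n. split.
    + apply Hl1. now exists n.
    + apply Hl2. intros x [m ->]. apply Hall.
Qed.

(* [rectint] is the imaginary part of the integral of [f dz] over the boundary of a rectangle. *)
Definition hint (f : C -> C) (c a b : R) : R := RInt (fun x => snd (f (x, c))) a b.
Definition vint (f : C -> C) (a c d : R) : R := RInt (fun y => fst (f (a, y))) c d.
Definition rectint (f : C -> C) (a b c d : R) : R :=
  hint f c a b - hint f d a b + vint f b c d - vint f a c d.

Definition diff_on (D : C -> Prop) (f : C -> C) : Prop :=
  forall z, D z -> exists l, cder f z l.

Definition closed_rect (a b c d : R) (z : C) : Prop :=
  a <= fst z <= b /\ c <= snd z <= d.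

(** A path that does not increase distances covers horizontal and vertical sides alike. *)
Lemma continuous_line (f : C -> C) (p : R -> C) (t l : _) :
  (forall s s', Cmod (p s - p s')%C <= Rabs (s - s')) -> cder f (p t) l ->
  continuous (fun s => fst (f (p s))) t /\ continuous (fun s => snd (f (p s))) t.
Proof.
  intros Hp H.
  assert (K : forall e : posreal, locally t (fun s => Cmod (f (p s) - f (p t))%C < e)).
  { intros e. destruct (cder_cont _ _ _ H e (cond_pos e)) as [d [Hd Hd']].
    exists (mkposreal d Hd). intros s Hs. apply Hd'.
    eapply Rle_lt_trans; [apply Hp|]. exact Hs. }
  split; intros P [e He]; unfold filtermap; (eapply filter_imp; [|exact (K e)]); intros s Hs; apply He.
  - change (Rabs (fst (f (p s)) - fst (f (p t))) < e).
    eapply Rle_lt_trans; [|exact Hs]. apply (Rabs_Re_le (f (p s) - f (p t))%C).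
  - change (Rabs (snd (f (p s)) - snd (f (p t))) < e).
    eapply Rle_lt_trans; [|exact Hs]. apply (Rabs_Im_le (f (p s) - f (p t))%C).
Qed.

Lemma ex_hint (f : C -> C) (c a b : R) :
  a <= b -> (forall x, a <= x <= b -> exists l, cder f (x, c) l) ->
  ex_RInt (fun x => snd (f (x, c))) a b.
Proof.
  intros Hab H. apply (ex_RInt_continuous (V := R_CompleteNormedModule)). intros z Hz.
  rewrite Rmin_left, Rmax_right in Hz by exact Hab.
  destruct (H z Hz) as [l Hl].
  apply (continuous_line f (fun x => (x, c)) z l); [|exact Hl].
  intros s s'. replace ((s, c) - (s', c))%C with (RtoC (s - s')) by (unfold RtoC, Cminus, Cplus, Copp; simpl; f_equal; ring).
  rewrite Cmod_R. lra.
Qed.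

Lemma ex_vint (f : C -> C) (a c d : R) :
  c <= d -> (forall y, c <= y <= d -> exists l, cder f (a, y) l) ->
  ex_RInt (fun y => fst (f (a, y))) c d.
Proof.
  intros Hab H. apply (ex_RInt_continuous (V := R_CompleteNormedModule)). intros z Hz.
  rewrite Rmin_left, Rmax_right in Hz by exact Hab.
  destruct (H z Hz) as [l Hl].
  apply (continuous_line f (fun y => (a, y)) z l); [|exact Hl].
  intros s s'. eapply Rle_trans; [apply (Cmod_le_Rabs (a - a) (s - s'))|].
  replace (a - a) with 0 by ring. rewrite Rabs_R0. lra.
Qed.

Lemma rectint_split (f : C -> C) (a m b c n d : R) :
  a <= m <= b -> c <= n <= d -> diff_on (closed_rect a b c d) f ->
  rectint f a b c d = rectint f a m c n + rectint f m b c n + rectint f a m n d + rectint f m b n d.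
Proof.
  intros Hm Hn H.
  assert (Eh : forall y, c <= y <= d -> hint f y a b = hint f y a m + hint f y m b).
  { intros y Hy. unfold hint. symmetry. apply (RInt_Chasles (V := R_CompleteNormedModule));
    apply ex_hint; try lra; intros x Hx; apply H; split; simpl; lra. }
  assert (Ev : forall x, a <= x <= b -> vint f x c d = vint f x c n + vint f x n d).
  { intros y Hy. unfold vint. symmetry. apply (RInt_Chasles (V := R_CompleteNormedModule));
    apply ex_vint; try lra; intros x Hx; apply H; split; simpl; lra. }
  unfold rectint. rewrite (Eh c), (Eh d), (Ev a), (Ev b) by lra. ring.
Qed.

(** For two opposite sides of a rectangle: the difference of the integrands is constant up to the
    remainder when the function is affine up to a remainder. *)
Lemma RInt_diff_bound (f g : R -> R) (a b k M : R) :
  a <= b -> ex_RInt f a b -> ex_RInt g a b ->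
  (forall x, a <= x <= b -> Rabs (f x - g x - k) <= M) ->
  Rabs (RInt f a b - RInt g a b - (b - a) * k) <= (b - a) * M.
Proof.
  intros Hab Hf Hg H.
  assert (E : RInt f a b - RInt g a b - (b - a) * k = RInt (fun x => f x - g x - k) a b).
  { rewrite (RInt_minus (V := R_CompleteNormedModule) (fun x => f x - g x) (fun _ => k)).
    - rewrite (RInt_minus (V := R_CompleteNormedModule) f g) by assumption.
      rewrite RInt_const. reflexivity.
    - apply (ex_RInt_minus (V := R_NormedModule)); assumption.
    - apply ex_RInt_const. }
  rewrite E. apply abs_RInt_le_const; auto.
  apply (ex_RInt_minus (V := R_NormedModule) (fun x => f x - g x) (fun _ => k)).
  - apply (ex_RInt_minus (V := R_NormedModule)); assumption.
  - apply ex_RInt_const.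
Qed.

(** An affine function integrates to 0 over the boundary: its contributions [(b - a) Re l (c - d)]
    and [(d - c) Re l (b - a)] from the two pairs of sides cancel, and only the remainder is
    left. *)
Lemma rectint_small (f : C -> C) (a b c d e : R) (z l : C) :
  a <= b -> c <= d -> 0 <= e -> diff_on (closed_rect a b c d) f ->
  closed_rect a b c d z ->
  (forall w, closed_rect a b c d w -> Cmod (f w - f z - l * (w - z))%C <= e * Cmod (w - z)%C) ->
  Rabs (rectint f a b c d) <= 2 * e * ((b - a) + (d - c)) * ((b - a) + (d - c)).
Proof.
  intros Hab Hcd He Hd Hz H. set (s := (b - a) + (d - c)).
  assert (Hs : forall w, closed_rect a b c d w -> Cmod (f w - f z - l * (w - z))%C <= e * s).
  { intros w Hw. eapply Rle_trans; [apply H, Hw|]. apply Rmult_le_compat_l; [exact He|].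
    eapply Rle_trans; [apply (Cmod_le_Rabs (fst w - fst z) (snd w - snd z))|].
    destruct Hw, Hz. apply Rplus_le_compat; apply Rabs_le; lra. }
  assert (P1 : Rabs (hint f c a b - hint f d a b - (b - a) * (fst l * (c - d))) <= (b - a) * (2 * (e * s))).
  { apply RInt_diff_bound; [exact Hab| | |].
    - apply ex_hint; [exact Hab|]. intros x Hx; apply Hd; split; simpl; lra.
    - apply ex_hint; [exact Hab|]. intros x Hx; apply Hd; split; simpl; lra.
    - intros x Hx. pose proof (Hs (x, c)) as Q1. pose proof (Hs (x, d)) as Q2.
      pose proof (Rabs_Im_le (f (x, c) - f z - l * ((x, c) - z))%C) as Q3.
      pose proof (Rabs_Im_le (f (x, d) - f z - l * ((x, d) - z))%C) as Q4.
      replace (snd (f (x, c)) - snd (f (x, d)) - fst l * (c - d))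
        with (snd (f (x, c) - f z - l * ((x, c) - z))%C - snd (f (x, d) - f z - l * ((x, d) - z))%C)
        by (simpl; ring).
      eapply Rle_trans; [apply Rabs_triang|]. rewrite Rabs_Ropp.
      assert (closed_rect a b c d (x, c)) by (split; simpl; lra).
      assert (closed_rect a b c d (x, d)) by (split; simpl; lra).
      specialize (Q1 H0). specialize (Q2 H1). lra. }
  assert (P2 : Rabs (vint f b c d - vint f a c d - (d - c) * (fst l * (b - a))) <= (d - c) * (2 * (e * s))).
  { apply RInt_diff_bound; [exact Hcd| | |].
    - apply ex_vint; [exact Hcd|]. intros x Hx; apply Hd; split; simpl; lra.
    - apply ex_vint; [exact Hcd|]. intros x Hx; apply Hd; split; simpl; lra.
    - intros x Hx. pose proof (Hs (b, x)) as Q1. pose proof (Hs (a, x)) as Q2.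
      pose proof (Rabs_Re_le (f (b, x) - f z - l * ((b, x) - z))%C) as Q3.
      pose proof (Rabs_Re_le (f (a, x) - f z - l * ((a, x) - z))%C) as Q4.
      replace (fst (f (b, x)) - fst (f (a, x)) - fst l * (b - a))
        with (fst (f (b, x) - f z - l * ((b, x) - z))%C - fst (f (a, x) - f z - l * ((a, x) - z))%C)
        by (simpl; ring).
      eapply Rle_trans; [apply Rabs_triang|]. rewrite Rabs_Ropp.
      assert (closed_rect a b c d (b, x)) by (split; simpl; lra).
      assert (closed_rect a b c d (a, x)) by (split; simpl; lra).
      specialize (Q1 H0). specialize (Q2 H1). lra. }
  replace (rectint f a b c d) with
    ((hint f c a b - hint f d a b - (b - a) * (fst l * (c - d))) +
     (vint f b c d - vint f a c d - (d - c) * (fst l * (b - a)))) by (unfold rectint; ring).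
  eapply Rle_trans; [apply Rabs_triang|].
  replace (2 * e * s * s) with ((b - a) * (2 * (e * s)) + (d - c) * (2 * (e * s))) by (unfold s; ring).
  lra.
Qed.

Lemma diff_on_sub (D D' : C -> Prop) (f : C -> C) :
  (forall z, D' z -> D z) -> diff_on D f -> diff_on D' f.
Proof. intros H Hf z Hz. apply Hf, H, Hz. Qed.

(** Quartering: a nonzero integral leaves at least a quarter of its size on one of the four
    quarters. At the common point of the rectangles so chosen, differentiability makes the integral
    smaller than this. *)
Lemma goursat (f : C -> C) (x0 y0 A B : R) :
  0 < A -> 0 < B -> diff_on (closed_rect x0 (x0 + A) y0 (y0 + B)) f ->
  rectint f x0 (x0 + A) y0 (y0 + B) = 0.
Proof.
  intros HA HB Hf.
  set (h := fun n : nat => (1 / 2) ^ n).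
  assert (Hh : forall n, 0 < h n) by (intros; apply pow_lt; lra).
  set (Q := fun (n : nat) (p : R * R) => rectint f (fst p) (fst p + A * h n) (snd p) (snd p + B * h n)).
  destruct (Req_dec (rectint f x0 (x0 + A) y0 (y0 + B)) 0) as [E|Hne]; [exact E|exfalso].
  (* Half of the modulus, so that the whole rectangle satisfies the strict inequality in [bad]. *)
  set (eps := Rabs (rectint f x0 (x0 + A) y0 (y0 + B)) / 2).
  assert (Heps : 0 < eps) by (unfold eps; apply Rabs_pos_lt in Hne; lra).
  set (inside := fun (n : nat) (p : R * R) => x0 <= fst p /\ fst p + A * h n <= x0 + A /\ y0 <= snd p /\ snd p + B * h n <= y0 + B).
  set (bad := fun (n : nat) (p : R * R) => inside n p /\ eps * (h n * h n) < Rabs (Q n p)).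
  assert (step : forall n p, bad n p -> exists q, bad (S n) q /\
     (fst q = fst p \/ fst q = fst p + A * h (S n)) /\ (snd q = snd p \/ snd q = snd p + B * h (S n))).
  { intros n [x y] [Hin Hb]. unfold inside in Hin; cbn [fst snd] in Hin.
    assert (Eh : h n = 2 * h (S n)) by (unfold h; simpl; lra).
    pose proof (Hh (S n)) as Hp.
    assert (Hsp : Q n (x, y) = Q (S n) (x, y) + Q (S n) (x + A * h (S n), y) +
        Q (S n) (x, y + B * h (S n)) + Q (S n) (x + A * h (S n), y + B * h (S n))).
    { unfold Q; cbn [fst snd].
      rewrite (rectint_split f x (x + A * h (S n)) (x + A * h n) y (y + B * h (S n)) (y + B * h n)).
      - replace (x + A * h (S n) + A * h (S n)) with (x + A * h n) by (rewrite Eh; ring).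
        replace (y + B * h (S n) + B * h (S n)) with (y + B * h n) by (rewrite Eh; ring).
        reflexivity.
      - rewrite Eh. nra.
      - rewrite Eh. nra.
      - apply (diff_on_sub _ _ f) with (2 := Hf). intros z [H1 H2]. split; lra. }
    assert (P : 0 < A * h (S n)) by nra. assert (P' : 0 < B * h (S n)) by nra.
    rewrite Eh in Hin.
    assert (Hc : forall q, (fst q = x \/ fst q = x + A * h (S n)) -> (snd q = y \/ snd q = y + B * h (S n)) -> inside (S n) q).
    { intros q H1 H2. unfold inside. destruct H1 as [-> | ->], H2 as [-> | ->]; repeat split; lra. }
    apply NNPP. intros Hno.
    assert (Hs : forall q, (fst q = x \/ fst q = x + A * h (S n)) -> (snd q = y \/ snd q = y + B * h (S n)) -> Rabs (Q (S n) q) <= eps * (h (S n) * h (S n))).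
    { intros q H1 H2. apply Rnot_lt_le. intros Hlt. apply Hno. exists q. cbn [fst snd].
      split; [split; [apply Hc; assumption|exact Hlt]|split; assumption]. }
    pose proof (Hs (x, y) (or_introl eq_refl) (or_introl eq_refl)).
    pose proof (Hs (x + A * h (S n), y) (or_intror eq_refl) (or_introl eq_refl)).
    pose proof (Hs (x, y + B * h (S n)) (or_introl eq_refl) (or_intror eq_refl)).
    pose proof (Hs (x + A * h (S n), y + B * h (S n)) (or_intror eq_refl) (or_intror eq_refl)).
    rewrite Hsp, Eh in Hb.
    pose proof (Rabs_triang (Q (S n) (x, y) + Q (S n) (x + A * h (S n), y) + Q (S n) (x, y + B * h (S n))) (Q (S n) (x + A * h (S n), y + B * h (S n)))).
    pose proof (Rabs_triang (Q (S n) (x, y) + Q (S n) (x + A * h (S n), y)) (Q (S n) (x, y + B * h (S n)))).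
    pose proof (Rabs_triang (Q (S n) (x, y)) (Q (S n) (x + A * h (S n), y))).
    lra. }
  assert (Hch : exists p : nat -> R * R, p 0%nat = (x0, y0) /\ forall n, bad n (p n) /\
     (fst (p (S n)) = fst (p n) \/ fst (p (S n)) = fst (p n) + A * h (S n)) /\
     (snd (p (S n)) = snd (p n) \/ snd (p (S n)) = snd (p n) + B * h (S n))).
  { set (nxt := fun n p => epsilon (inhabits (x0, y0)) (fun q => bad (S n) q /\
     (fst q = fst p \/ fst q = fst p + A * h (S n)) /\ (snd q = snd p \/ snd q = snd p + B * h (S n)))).
    set (p := fix p n := match n with O => (x0, y0) | S k => nxt k (p k) end).
    assert (Hb : forall n, bad n (p n)).
    { induction n as [|n IH].
      - split; unfold inside, Q, h; simpl; rewrite ?Rmult_1_r; [lra|]. unfold eps in *. lra.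
      - change (p (S n)) with (nxt n (p n)). unfold nxt.
        exact (proj1 (epsilon_spec (inhabits (x0, y0)) _ (step n (p n) IH))). }
    exists p. split; [reflexivity|]. intros n. split; [apply Hb|].
    exact (proj2 (epsilon_spec (inhabits (x0, y0)) _ (step n (p n) (Hb n)))). }
  destruct Hch as [p [Hp0 Hp]].
  destruct (nested_limit (fun n => fst (p n)) A) as [xs Hxs].
  { intros n. destruct (Hp n) as [_ [[E|E] _]]; rewrite E; change ((1/2)^S n) with (h (S n)); pose proof (Hh (S n)); nra. }
  { lra. }
  destruct (nested_limit (fun n => snd (p n)) B) as [ys Hys].
  { intros n. destruct (Hp n) as [_ [_ [E|E]]]; rewrite E; change ((1/2)^S n) with (h (S n)); pose proof (Hh (S n)); nra. }
  { lra. }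
  destruct (Hf (xs, ys)) as [l Hl].
  { pose proof (Hxs 0%nat). pose proof (Hys 0%nat). rewrite Hp0 in *. split; simpl in *; lra. }
  (* With this [e] the bound of [rectint_small] at level [N] is exactly [eps / 4^N], against
     [bad N]. *)
  set (e := eps / (2 * ((A + B) * (A + B)))).
  assert (He : 0 < e) by (apply Rdiv_lt_0_compat; nra).
  destruct (Hl e He) as [dl [Hdl Hdl']].
  destruct (pow_lt_1_zero (1 / 2)) with (y := dl / (A + B)) as [N HN].
  { rewrite Rabs_right; lra. }
  { apply Rdiv_lt_0_compat; lra. }
  specialize (HN N (Nat.le_refl _)). change ((1/2)^N) with (h N) in HN.
  rewrite Rabs_right in HN by (left; apply Hh).
  assert (HN' : (A + B) * h N < dl).
  { apply (Rmult_lt_compat_l (A + B)) in HN; [|lra].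
    replace ((A + B) * (dl / (A + B))) with dl in HN by (field; lra). exact HN. }
  destruct (Hp N) as [[Hin Hb] _].
  pose proof (Hxs N) as HxN. pose proof (Hys N) as HyN. cbn beta in HxN, HyN.
  change ((1/2)^N) with (h N) in HxN, HyN. pose proof (Hh N) as HhN.
  assert (HAh : 0 < A * h N) by nra. assert (HBh : 0 < B * h N) by nra.
  assert (Hsm := rectint_small f (fst (p N)) (fst (p N) + A * h N) (snd (p N)) (snd (p N) + B * h N) e (xs, ys) l).
  assert (Rabs (Q N (p N)) <= 2 * e * ((fst (p N) + A * h N - fst (p N)) + (snd (p N) + B * h N - snd (p N))) * ((fst (p N) + A * h N - fst (p N)) + (snd (p N) + B * h N - snd (p N)))).
  { apply Hsm; try lra.
    - apply (diff_on_sub _ _ f) with (2 := Hf). unfold inside in Hin. intros z [H1 H2]. split; lra.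
    - split; simpl; lra.
    - intros w [Hw1 Hw2]. apply Hdl'.
      eapply Rle_lt_trans; [apply (Cmod_le_Rabs (fst w - xs) (snd w - ys))|].
      assert (Rabs (fst w - xs) <= A * h N) by (apply Rabs_le; lra).
      assert (Rabs (snd w - ys) <= B * h N) by (apply Rabs_le; lra).
      lra. }
  replace (fst (p N) + A * h N - fst (p N) + (snd (p N) + B * h N - snd (p N))) with ((A + B) * h N) in H by ring.
  assert (2 * e * ((A + B) * h N) * ((A + B) * h N) = eps * (h N * h N)) by (unfold e; field; lra).
  lra.
Qed.

(** * Means over circles *)

Definition cis (rho t : R) : C := (rho * cos t, rho * sin t).
Definition cmean (F : C -> C) (rho : R) : R := RInt (fun t => fst (F (cis rho t))) 0 (2 * PI) / (2 * PI).
(** The origin is left out so that the quotients [F z / z ^ n] are covered. *)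
Definition punctured (z : C) : Prop := 0 < Cmod z < 1.

Lemma Cmod_cis (rho t : R) : 0 <= rho -> Cmod (cis rho t) = rho.
Proof.
  intros H. unfold Cmod, cis; cbn [fst snd].
  replace (_ + _) with (Rsqr rho * (Rsqr (sin t) + Rsqr (cos t))) by (unfold Rsqr; ring).
  rewrite sin2_cos2, Rmult_1_r. now apply sqrt_Rsqr.
Qed.

(** Under [z = exp w] the annulus becomes a rectangle of height [2 PI]. By periodicity the
    horizontal sides cancel, and the vertical sides carry the two circle means. *)
Lemma cmean_const (F : C -> C) (r1 r2 : R) :
  diff_on punctured F -> 0 < r1 < 1 -> 0 < r2 < 1 -> cmean F r1 = cmean F r2.
Proof.
  intros HF.
  assert (K : forall r1 r2, 0 < r1 < 1 -> 0 < r2 < 1 -> r1 < r2 -> cmean F r1 = cmean F r2).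
  { clear r1 r2. intros r1 r2 H1 H2 H12.
    set (f := fun z => F (cexp z)).
    assert (HL : ln r1 < ln r2) by (apply ln_increasing; lra).
    assert (HL2 : ln r2 < 0) by (rewrite <- ln_1; apply ln_increasing; lra).
    pose proof PI_RGT_0 as Hpi.
    assert (G : rectint f (ln r1) (ln r1 + (ln r2 - ln r1)) 0 (0 + 2 * PI) = 0).
    { apply goursat; [lra|lra|]. intros z [Hz1 Hz2].
      destruct (HF (cexp z)) as [l Hl].
      - unfold punctured. rewrite Cmod_cexp. split; [apply exp_pos|]. rewrite <- exp_0. apply exp_increasing. lra.
      - exists (l * cexp z)%C. apply (cder_comp F cexp); [exact Hl|apply cder_cexp]. }
    replace (ln r1 + (ln r2 - ln r1)) with (ln r2) in G by ring. rewrite Rplus_0_l in G.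
    assert (E : hint f 0 (ln r1) (ln r2) = hint f (2 * PI) (ln r1) (ln r2)).
    { unfold hint. apply RInt_ext. intros x _. unfold f, cexp; cbn [fst snd].
      now rewrite cos_0, sin_0, cos_2PI, sin_2PI. }
    assert (V : forall r, 0 < r -> vint f (ln r) 0 (2 * PI) = RInt (fun t => fst (F (cis r t))) 0 (2 * PI)).
    { intros r Hr. unfold vint. apply RInt_ext. intros t _. unfold f, cexp, cis; cbn [fst snd].
      now rewrite exp_ln. }
    unfold rectint in G. rewrite !V in G by lra. unfold cmean. f_equal. lra. }
  intros H1 H2. destruct (Rtotal_order r1 r2) as [L|[->|L]]; [now apply K|reflexivity|symmetry; now apply K].
Qed.

(** * Taylor coefficients as circle means *)

Lemma diff_const (D : C -> Prop) (a : C) : diff_on D (fun _ => a).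
Proof. intros z _. exists 0%C. apply cder_const. Qed.

Lemma diff_pow (D : C -> Prop) (n : nat) : diff_on D (fun z => z ^ n)%C.
Proof. intros z _. eexists. apply cder_pow. Qed.

Lemma diff_plus (D : C -> Prop) (f g : C -> C) :
  diff_on D f -> diff_on D g -> diff_on D (fun z => f z + g z)%C.
Proof. intros Hf Hg z Hz. destruct (Hf z Hz), (Hg z Hz). eexists. apply cder_plus; eassumption. Qed.

Lemma diff_minus (D : C -> Prop) (f g : C -> C) :
  diff_on D f -> diff_on D g -> diff_on D (fun z => f z - g z)%C.
Proof. intros Hf Hg z Hz. destruct (Hf z Hz), (Hg z Hz). eexists. apply cder_minus; eassumption. Qed.

Lemma diff_mult (D : C -> Prop) (f g : C -> C) :
  diff_on D f -> diff_on D g -> diff_on D (fun z => f z * g z)%C.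
Proof. intros Hf Hg z Hz. destruct (Hf z Hz), (Hg z Hz). eexists. apply cder_mult; eassumption. Qed.

Lemma diff_inv (D : C -> Prop) (f : C -> C) :
  diff_on D f -> (forall z, D z -> f z <> 0%C) -> diff_on D (fun z => / f z)%C.
Proof.
  intros Hf H0 z Hz. destruct (Hf z Hz) as [l Hl]. eexists.
  apply (cder_comp (fun w => / w)%C f); [|exact Hl]. apply cder_inv. now apply H0.
Qed.

Lemma diff_div (D : C -> Prop) (f g : C -> C) :
  diff_on D f -> diff_on D g -> (forall z, D z -> g z <> 0%C) -> diff_on D (fun z => f z / g z)%C.
Proof. intros Hf Hg H0. apply diff_mult; [exact Hf|now apply diff_inv]. Qed.

Lemma punctured_neq_0 (z : C) : punctured z -> z <> 0%C.
Proof. intros [H _]. now apply Cmod_gt_0. Qed.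

Lemma Cpow_neq_0 (z : C) (n : nat) : z <> 0%C -> (z ^ n)%C <> 0%C.
Proof. apply Cpow_nz. Qed.

Lemma diff_div_pow (f : C -> C) (n : nat) :
  diff_on punctured f -> diff_on punctured (fun z => f z / z ^ n)%C.
Proof.
  intros H. apply diff_div; [exact H|apply diff_pow|].
  intros z Hz. apply Cpow_neq_0. now apply punctured_neq_0.
Qed.

Lemma cis_punctured (rho t : R) : 0 < rho < 1 -> punctured (cis rho t).
Proof. intros H. unfold punctured. rewrite Cmod_cis; lra. Qed.

(** A circle is the image of a vertical segment under [exp], so integrability reduces to
    [ex_vint]. *)
Lemma ex_cmean (F : C -> C) (rho : R) :
  diff_on punctured F -> 0 < rho < 1 -> ex_RInt (fun t => fst (F (cis rho t))) 0 (2 * PI).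
Proof.
  intros HF Hr. pose proof PI_RGT_0.
  apply (ex_RInt_ext (fun y => fst ((fun z => F (cexp z)) (ln rho, y)))).
  { intros t _. unfold cexp, cis; cbn [fst snd]. rewrite exp_ln by lra. reflexivity. }
  apply (ex_vint (fun z => F (cexp z)) (ln rho)); [lra|].
  intros y _. destruct (HF (cexp (ln rho, y))) as [l Hl].
  - unfold punctured. rewrite Cmod_cexp. cbn [fst]. rewrite exp_ln; lra.
  - eexists. apply (cder_comp F cexp); [exact Hl|apply cder_cexp].
Qed.

Lemma cmean_ext (F G : C -> C) (rho : R) :
  (forall t, F (cis rho t) = G (cis rho t)) -> cmean F rho = cmean G rho.
Proof. intros E. unfold cmean. f_equal. apply RInt_ext. intros t _. now rewrite E. Qed.

Lemma cmean_plus (F G : C -> C) (rho : R) :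
  diff_on punctured F -> diff_on punctured G -> 0 < rho < 1 ->
  cmean (fun z => F z + G z)%C rho = cmean F rho + cmean G rho.
Proof.
  intros HF HG Hr. unfold cmean.
  rewrite (RInt_ext _ (fun t => plus (fst (F (cis rho t))) (fst (G (cis rho t))))) by reflexivity.
  rewrite (RInt_plus (V := R_CompleteNormedModule)) by now apply ex_cmean.
  change plus with Rplus. field. apply PI_neq0.
Qed.

Lemma cmean_scal (F : C -> C) (x rho : R) :
  diff_on punctured F -> 0 < rho < 1 ->
  cmean (fun z => x * F z)%C rho = x * cmean F rho.
Proof.
  intros HF Hr. unfold cmean.
  rewrite (RInt_ext _ (fun t => scal x (fst (F (cis rho t))))).
  - rewrite (RInt_scal (V := R_CompleteNormedModule)) by now apply ex_cmean.
    change (scal x ?y) with (x * y). field. apply PI_neq0.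
  - intros t _. change (scal x ?y) with (x * y). simpl. ring.
Qed.

Lemma cmean_le (F : C -> C) (M rho : R) :
  diff_on punctured F -> 0 < rho < 1 ->
  (forall t, fst (F (cis rho t)) <= M) -> cmean F rho <= M.
Proof.
  intros HF Hr H. unfold cmean. pose proof PI_RGT_0.
  assert (E : RInt (fun t => fst (F (cis rho t))) 0 (2 * PI) <= RInt (fun _ => M) 0 (2 * PI)).
  { apply RInt_le; [lra|now apply ex_cmean|apply ex_RInt_const|]. intros t _. apply H. }
  rewrite RInt_const in E. change (scal ?x ?y) with (x * y) in E.
  apply Rmult_le_reg_r with (2 * PI); [lra|]. unfold Rdiv. rewrite Rmult_assoc, Rinv_l; lra.
Qed.

Lemma cmean_opp (F : C -> C) (rho : R) :
  diff_on punctured F -> 0 < rho < 1 -> cmean (fun z => - F z)%C rho = - cmean F rho.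
Proof.
  intros HF Hr. replace (- cmean F rho) with (-1 * cmean F rho) by ring.
  rewrite <- cmean_scal by assumption. apply cmean_ext. intros t.
  replace (RtoC (-1)) with (- (1))%C by (unfold Copp, RtoC; simpl; f_equal; ring). ring.
Qed.

Lemma cmean_ge (F : C -> C) (M rho : R) :
  diff_on punctured F -> 0 < rho < 1 ->
  (forall t, M <= fst (F (cis rho t))) -> M <= cmean F rho.
Proof.
  intros HF Hr H. assert (cmean (fun z => - F z)%C rho <= - M).
  { apply cmean_le; [|exact Hr|].
    - intros z Hz. destruct (HF z Hz) as [l Hl]. eexists. apply cder_opp; eassumption.
    - intros t. simpl. specialize (H t). lra. }
  rewrite cmean_opp in H0 by assumption. lra.
Qed.

(** The mean is independent of the radius, hence determined by arbitrarily small circles. *)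
Lemma cmean_lim (F : C -> C) (L : C) (rho : R) :
  diff_on punctured F -> 0 < rho < 1 ->
  (forall e, 0 < e -> exists d, 0 < d /\ forall z, 0 < Cmod z < d -> Cmod (F z - L)%C <= e) ->
  cmean F rho = fst L.
Proof.
  intros HF Hr H. apply cond_eq. intros e He.
  destruct (H (e / 2)) as [d [Hd H']]; [lra|].
  set (r := Rmin (1 / 2) (d / 2)).
  assert (Hr0 : 0 < r) by (apply Rmin_pos; lra).
  assert (Hr1 : r <= 1 / 2) by apply Rmin_l. assert (Hr2 : r <= d / 2) by apply Rmin_r.
  rewrite (cmean_const F rho r) by (auto; lra).
  assert (Hb : forall t, fst L - e / 2 <= fst (F (cis r t)) <= fst L + e / 2).
  { intros t. specialize (H' (cis r t)). rewrite Cmod_cis in H' by lra.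
    pose proof (Rabs_Re_le (F (cis r t) - L)%C) as Hre.
    change (fst (F (cis r t) - L)%C) with (fst (F (cis r t)) - fst L) in Hre.
    specialize (H' ltac:(lra)). apply Rabs_le_between in Hre. lra. }
  apply Rabs_def1.
  - assert (cmean F r <= fst L + e / 2) by (apply cmean_le; [exact HF|lra|intros; apply Hb]). lra.
  - assert (fst L - e / 2 <= cmean F r) by (apply cmean_ge; [exact HF|lra|intros; apply Hb]). lra.
Qed.

(* [cmean] is the real part of the mean, and [Re (i w) = - Im w]. *)
Definition coef (F : C -> C) (n : nat) : C :=
  (cmean (fun z => F z / z ^ n)%C (1 / 2), - cmean (fun z => Ci * (F z / z ^ n))%C (1 / 2)).

(** Every real-linear functional of a coefficient is a circle mean, and on any radius. A suitable
    unimodular [eta] turns this into a formula for the modulus. *)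
Lemma cmean_coef (F : C -> C) (n : nat) (eta : C) (rho : R) :
  diff_on punctured F -> 0 < rho < 1 ->
  cmean (fun z => eta * (F z / z ^ n))%C rho = fst (eta * coef F n)%C.
Proof.
  intros HF Hr. pose proof (diff_div_pow F n HF) as HG.
  set (G := fun z : C => (F z / z ^ n)%C) in *.
  assert (HiG : diff_on punctured (fun z => Ci * G z)%C) by (apply diff_mult; [apply diff_const|exact HG]).
  rewrite (cmean_const _ rho (1 / 2)); [|apply diff_mult; [apply diff_const|exact HG]|exact Hr|lra].
  rewrite (cmean_ext _ (fun z => fst eta * G z + snd eta * (Ci * G z))%C).
  - rewrite cmean_plus; [|apply diff_mult; [apply diff_const|exact HG]|apply diff_mult; [apply diff_const|exact HiG]|lra].
    rewrite !cmean_scal by (auto; lra). unfold coef. cbn [fst snd Cmult]. unfold G. ring.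
  - intros t. unfold G. destruct eta as [a b]. set (w := (_ / _)%C).
    destruct w as [p q]. unfold Cmult, Cplus, RtoC, Ci; simpl. f_equal; ring.
Qed.

Lemma C_eq_by_functionals (a b : C) : (forall eta : C, fst (eta * a)%C = fst (eta * b)%C) -> a = b.
Proof.
  intros H. pose proof (H 1%C) as H1. pose proof (H Ci) as H2.
  destruct a, b; simpl in *. f_equal; lra.
Qed.

Lemma coef_eq (F : C -> C) (n : nat) (a : C) :
  diff_on punctured F ->
  (forall eta, cmean (fun z => eta * (F z / z ^ n))%C (1 / 2) = fst (eta * a)%C) -> coef F n = a.
Proof.
  intros HF H. apply C_eq_by_functionals. intros eta. rewrite <- (cmean_coef F n eta (1 / 2)) by (auto; lra). apply H.
Qed.

Lemma coef_ext (F G : C -> C) (n : nat) :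
  (forall z, punctured z -> F z = G z) -> coef F n = coef G n.
Proof.
  intros E. assert (P : forall t, punctured (cis (1 / 2) t)) by (intros; apply cis_punctured; lra).
  unfold coef. f_equal; [|f_equal]; apply cmean_ext; intros t; now rewrite E.
Qed.

Lemma coef_lim (F : C -> C) (n : nat) (L : C) :
  diff_on punctured F ->
  (forall e, 0 < e -> exists d, 0 < d /\ forall z, 0 < Cmod z < d -> Cmod (F z / z ^ n - L)%C <= e) ->
  coef F n = L.
Proof.
  intros HF H. apply coef_eq; [exact HF|]. intros eta.
  apply cmean_lim; [apply diff_mult; [apply diff_const|now apply diff_div_pow]|lra|].
  intros e He. pose proof (Cmod_ge_0 eta).
  destruct (H (e / (Cmod eta + 1))) as [d [Hd H']]; [apply Rdiv_lt_0_compat; lra|].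
  exists d. split; [exact Hd|]. intros z Hz. specialize (H' z Hz).
  replace (eta * (F z / z ^ n) - eta * L)%C with (eta * (F z / z ^ n - L))%C by ring.
  rewrite Cmod_mult.
  apply (Rmult_le_compat_l (Cmod eta + 1)) in H'; [|lra].
  replace ((Cmod eta + 1) * (e / (Cmod eta + 1))) with e in H' by (field; lra).
  pose proof (Cmod_ge_0 (F z / z ^ n - L)%C). nra.
Qed.

Lemma coef_plus (F G : C -> C) (n : nat) :
  diff_on punctured F -> diff_on punctured G ->
  coef (fun z => F z + G z)%C n = (coef F n + coef G n)%C.
Proof.
  intros HF HG. apply coef_eq; [now apply diff_plus|]. intros eta.
  rewrite (cmean_ext _ (fun z => eta * (F z / z ^ n) + eta * (G z / z ^ n))%C) by (intros; unfold Cdiv; ring).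
  rewrite cmean_plus; [|apply diff_mult; [apply diff_const|now apply diff_div_pow]
    |apply diff_mult; [apply diff_const|now apply diff_div_pow]|lra].
  rewrite !cmean_coef by (auto; lra). simpl. ring.
Qed.

Lemma coef_scal (F : C -> C) (x : C) (n : nat) :
  diff_on punctured F -> coef (fun z => x * F z)%C n = (x * coef F n)%C.
Proof.
  intros HF. apply coef_eq; [apply diff_mult; [apply diff_const|exact HF]|]. intros eta.
  rewrite (cmean_ext _ (fun z => (eta * x) * (F z / z ^ n))%C) by (intros; unfold Cdiv; ring).
  rewrite cmean_coef by (auto; lra). f_equal. ring.
Qed.

Lemma coef_shift (F : C -> C) (k n : nat) :
  coef (fun z => z ^ k * F z)%C (k + n) = coef F n.
Proof.
  assert (E : forall t, (cis (1 / 2) t ^ k * F (cis (1 / 2) t) / cis (1 / 2) t ^ (k + n))%C = (F (cis (1 / 2) t) / cis (1 / 2) t ^ n)%C).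
  { intros t. assert (H : cis (1 / 2) t <> 0%C) by (apply punctured_neq_0, cis_punctured; lra).
    rewrite Cpow_add_r. field. split; now apply Cpow_neq_0. }
  unfold coef. f_equal; [|f_equal]; apply cmean_ext; intros t; now rewrite E.
Qed.

Lemma cis_scal (rho t : R) : cis rho t = (rho * cis 1 t)%C.
Proof. unfold cis, Cmult, RtoC; simpl. f_equal; ring. Qed.

Lemma coef_const (a : C) (n : nat) : coef (fun _ => a) (S n) = 0%C.
Proof.
  apply coef_eq; [apply diff_const|]. intros eta.
  replace (fst (eta * 0)%C) with 0 by (simpl; ring).
  (* the mean of [c / z^(n+1)] scales like [rho^-(n+1)] but does not depend on [rho] *)
  set (H := fun z => (eta * (a / z ^ S n))%C).
  assert (HD : diff_on punctured H).
  { apply diff_mult; [apply diff_const|]. apply (diff_div_pow (fun _ => a)). apply diff_const. }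
  assert (E1 : cmean H (1 / 2) = cmean H (1 / 4)) by (apply cmean_const; [exact HD|lra|lra]).
  assert (E2 : cmean H (1 / 4) = 2 ^ S n * cmean H (1 / 2)).
  { rewrite <- cmean_scal by (auto; lra). unfold cmean. f_equal. apply RInt_ext. intros t _.
    f_equal. unfold H. rewrite (cis_scal (1 / 4)), (cis_scal (1 / 2)), !Cpow_mult_l.
    assert (Hc : cis 1 t <> 0%C) by (apply Cmod_gt_0; rewrite Cmod_cis; lra).
    rewrite RtoC_pow. replace (RtoC (1 / 4)) with (/ 2 * RtoC (1 / 2))%C.
    2: { rewrite <- RtoC_inv by lra. rewrite <- RtoC_mult. f_equal. field. }
    rewrite Cpow_mult_l, Cpow_inv by (apply RtoC_neq_0; lra).
    assert (RtoC (1 / 2) <> 0%C) by (apply RtoC_neq_0; lra).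
    assert (RtoC 2 <> 0%C) by (apply RtoC_neq_0; lra).
    field. repeat split; now apply Cpow_neq_0. }
  assert (2 <= 2 ^ S n).
  { simpl. pose proof (pow_R1_Rle 2 n). lra. }
  nra.
Qed.

(** * Finite sums and coefficients of finite expansions *)

Fixpoint csum (f : nat -> C) (n : nat) : C :=
  match n with O => 0%C | S k => (csum f k + f k)%C end.

Fixpoint rsum (f : nat -> R) (n : nat) : R :=
  match n with O => 0 | S k => rsum f k + f k end.

Lemma Cmod_csum (f : nat -> C) (n : nat) : Cmod (csum f n) <= rsum (fun k => Cmod (f k)) n.
Proof.
  induction n as [|n IH]; simpl; [rewrite Cmod_0; lra|].
  eapply Rle_trans; [apply Cmod_triangle|]. lra.
Qed.

Lemma rsum_le (f g : nat -> R) (n : nat) :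
  (forall k, (k < n)%nat -> f k <= g k) -> rsum f n <= rsum g n.
Proof.
  induction n as [|n IH]; intros H; simpl; [lra|].
  pose proof (H n ltac:(lia)). assert (rsum f n <= rsum g n) by (apply IH; intros; apply H; lia). lra.
Qed.

Lemma rsum_ext (f g : nat -> R) (n : nat) :
  (forall k, (k < n)%nat -> f k = g k) -> rsum f n = rsum g n.
Proof. intros H. apply Rle_antisym; apply rsum_le; intros k Hk; rewrite (H k Hk); lra. Qed.

Lemma csum_ext (f g : nat -> C) (n : nat) :
  (forall k, (k < n)%nat -> f k = g k) -> csum f n = csum g n.
Proof. induction n as [|n IH]; intros H; simpl; [reflexivity|]. rewrite IH, H; auto. Qed.

Lemma rsum_scal (f : nat -> R) (x : R) (n : nat) : rsum (fun k => x * f k) n = x * rsum f n.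
Proof. induction n as [|n IH]; simpl; [ring|]. rewrite IH. ring. Qed.

Lemma csum_scal (f : nat -> C) (x : C) (n : nat) : csum (fun k => x * f k)%C n = (x * csum f n)%C.
Proof. induction n as [|n IH]; simpl; [ring|]. rewrite IH. ring. Qed.

Lemma rsum_plus (f g : nat -> R) (n : nat) : rsum (fun k => f k + g k) n = rsum f n + rsum g n.
Proof. induction n as [|n IH]; simpl; [ring|]. rewrite IH. ring. Qed.

Lemma rsum_ge_0 (f : nat -> R) (n : nat) : (forall k, (k < n)%nat -> 0 <= f k) -> 0 <= rsum f n.
Proof.
  intros H. replace 0 with (rsum (fun _ => 0) n) by (clear; induction n; simpl; lra).
  now apply rsum_le.
Qed.

Lemma diff_csum (D : C -> Prop) (G : nat -> C -> C) (n : nat) :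
  (forall k, diff_on D (G k)) -> diff_on D (fun z => csum (fun k => G k z) n).
Proof.
  intros H. induction n as [|n IH]; simpl; [apply diff_const|]. now apply diff_plus.
Qed.

Lemma coef_csum (G : nat -> C -> C) (n m : nat) :
  (forall k, diff_on punctured (G k)) ->
  coef (fun z => csum (fun k => G k z) m) n = csum (fun k => coef (G k) n) m.
Proof.
  intros H. induction m as [|m IH].
  - simpl. apply coef_eq; [apply diff_const|]. intros eta.
    rewrite (cmean_ext _ (fun _ => 0%C)) by (intros; unfold Cdiv; ring).
    replace (eta * 0)%C with (RtoC 0) by ring. apply (cmean_lim _ 0%C). { apply diff_const. } { lra. }
    intros e He. exists 1. split; [lra|]. intros z _.
    replace (0 - 0)%C with (RtoC 0) by ring. rewrite Cmod_0. lra.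
  - simpl. rewrite coef_plus; [now rewrite IH|now apply diff_csum|apply H].
Qed.

(** A remainder of order [n + 1] at 0 has vanishing coefficient [n], because that coefficient is the
    limit of the remainder divided by [z^n]. A finite expansion near 0 thus suffices, and no series
    has to be integrated term by term. *)
Lemma coef_expand (F : C -> C) (G : nat -> C -> C) (n : nat) (C0 d : R) :
  diff_on punctured F -> (forall k, diff_on punctured (G k)) -> 0 < d ->
  (forall z, 0 < Cmod z < d -> Cmod (F z - csum (fun k => G k z) (S n))%C <= C0 * Cmod z ^ S n) ->
  coef F n = csum (fun k => coef (G k) n) (S n).
Proof.
  intros HF HG Hd H. rewrite <- coef_csum by exact HG.
  set (P := fun z => csum (fun k => G k z) (S n)).
  assert (HP : diff_on punctured P) by now apply diff_csum.
  rewrite (coef_ext F (fun z => P z + (F z - P z))%C) by (intros; ring).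
  rewrite coef_plus; [|exact HP|now apply diff_minus].
  rewrite (coef_lim (fun z => F z - P z)%C n 0%C); [ring|now apply diff_minus|].
  intros e He.
  assert (0 <= C0).
  { assert (Hc : 0 < Cmod (RtoC (d / 2)) < d) by (rewrite Cmod_R, Rabs_right; lra).
    specialize (H _ Hc). pose proof (Cmod_ge_0 (F (RtoC (d / 2)) - csum (fun k => G k (RtoC (d / 2))) (S n))%C).
    apply Rnot_lt_le. intros Hn. assert (0 < Cmod (RtoC (d / 2)) ^ S n) by (apply pow_lt; lra). nra. }
  exists (Rmin d (e / (C0 + 1))). split; [apply Rmin_pos; [lra|apply Rdiv_lt_0_compat; lra]|].
  intros z Hz.
  assert (Hz1 : Cmod z < d) by (eapply Rlt_le_trans; [apply Hz|apply Rmin_l]).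
  assert (Hz2 : Cmod z < e / (C0 + 1)) by (eapply Rlt_le_trans; [apply Hz|apply Rmin_r]).
  specialize (H z (conj (proj1 Hz) Hz1)). fold (P z) in H.
  assert (Hz0 : z <> 0%C) by (apply Cmod_gt_0; lra).
  replace ((F z - P z) / z ^ n - 0)%C with ((F z - P z) / z ^ n)%C by ring.
  rewrite Cmod_div, Cmod_pow by now apply Cpow_neq_0.
  assert (0 < Cmod z ^ n) by (apply pow_lt; lra).
  apply Rmult_le_reg_r with (Cmod z ^ n); [lra|].
  unfold Rdiv. rewrite Rmult_assoc, Rinv_l, Rmult_1_r by lra.
  eapply Rle_trans; [exact H|]. simpl.
  apply (Rmult_lt_compat_l (C0 + 1)) in Hz2; [|lra].
  replace ((C0 + 1) * (e / (C0 + 1))) with e in Hz2 by (field; lra). nra.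
Qed.

Lemma unimodular_align (c : C) : exists eta : C, Cmod eta = 1 /\ (eta * c)%C = RtoC (Cmod c).
Proof.
  destruct (Req_dec (Cmod c) 0) as [E|E].
  - exists 1%C. split; [apply Cmod_1|]. apply Cmod_eq_0 in E. rewrite E, Cmod_0. ring.
  - exists (Cconj c / Cmod c)%C.
    assert (RtoC (Cmod c) <> 0%C) by now apply RtoC_neq_0.
    pose proof (Cmod_ge_0 c). split.
    + rewrite Cmod_div, Cmod_conj, Cmod_R, Rabs_right by (auto; lra). now field.
    + replace (Cconj c / Cmod c * c)%C with (c * Cconj c / Cmod c)%C by (field; auto).
      rewrite <- Cmod2_conj, RtoC_pow. field. auto.
Qed.

(** * Bohr's theorem for bounded functions *)

(** The limit [rho -> 1], made explicit by Bernoulli's inequality at [rho = 1 - s]. *)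
Lemma le_of_radial_limit (x y M : R) (n j : nat) :
  0 <= x -> 0 <= y ->
  (forall rho, 0 < rho < 1 -> x * rho ^ (n + j) + y * rho ^ j <= M) -> x + y <= M.
Proof.
  intros Hx Hy H.
  assert (Bern : forall m s, 0 <= s <= 1 -> 1 - INR m * s <= (1 - s) ^ m).
  { intros m s Hs. induction m as [|m IH]; [simpl; lra|]. rewrite S_INR. simpl pow.
    pose proof (pos_INR m). assert (0 <= (1 - s) ^ m) by (apply pow_le; lra). nra. }
  apply le_epsilon. intros e He.
  set (K := x * INR (n + j) + y * INR j).
  assert (HK : 0 <= K) by (unfold K; pose proof (pos_INR (n + j)); pose proof (pos_INR j); nra).
  set (s := Rmin (1 / 2) (e / (K + 1))).
  assert (Hs : 0 < s) by (apply Rmin_pos; [lra|apply Rdiv_lt_0_compat; lra]).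
  assert (Hs1 : s <= 1 / 2) by apply Rmin_l.
  assert (Hs2 : s * (K + 1) <= e).
  { apply Rle_trans with (e / (K + 1) * (K + 1)); [|right; field; lra].
    apply Rmult_le_compat_r; [lra|apply Rmin_r]. }
  specialize (H (1 - s) ltac:(lra)).
  pose proof (Bern (n + j)%nat s ltac:(lra)). pose proof (Bern j s ltac:(lra)).
  assert (x * (1 - INR (n + j) * s) <= x * (1 - s) ^ (n + j)) by (apply Rmult_le_compat_l; lra).
  assert (y * (1 - INR j * s) <= y * (1 - s) ^ j) by (apply Rmult_le_compat_l; lra).
  unfold K in *. nra.
Qed.

Section BoundedFunction.
Variables (F : C -> C) (B0 C0 d : R) (j : nat).
Hypothesis HF : diff_on punctured F.
Hypothesis HB : forall z, punctured z -> Cmod (F z) <= B0.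
Hypothesis Hd : 0 < d.
Hypothesis HC : forall z, 0 < Cmod z < d -> Cmod (F z) <= C0 * Cmod z ^ j.

(** Cauchy's estimate on the circle of radius [rho], then [rho -> 1]. As [F] vanishes to order [j],
    the coefficient [j] plays the part of the constant term in Bohr's theorem. *)
Lemma bounded_coef_lead : Cmod (coef F j) <= B0.
Proof.
  destruct (unimodular_align (coef F j)) as [eta [He E]].
  apply Rle_trans with (Cmod (coef F j) + 0); [lra|].
  apply (le_of_radial_limit (Cmod (coef F j)) 0 B0 j 0); [apply Cmod_ge_0|lra|].
  intros rho Hr. rewrite Nat.add_0_r, Rmult_0_l, Rplus_0_r.
  assert (P : 0 < rho ^ j) by (apply pow_lt; lra).
  assert (K : fst (eta * coef F j)%C <= B0 / rho ^ j).
  { rewrite <- (cmean_coef F j eta rho HF Hr). apply cmean_le.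
    - apply diff_mult; [apply diff_const|now apply diff_div_pow].
    - exact Hr.
    - intros t. pose proof (cis_punctured rho t Hr) as Hp.
      eapply Rle_trans; [apply Rle_abs|]. eapply Rle_trans; [apply Rabs_Re_le|].
      rewrite Cmod_mult, He, Rmult_1_l, Cmod_div, Cmod_pow by (apply Cpow_neq_0, punctured_neq_0, Hp).
      rewrite Cmod_cis by lra. apply Rmult_le_compat_r; [left; now apply Rinv_0_lt_compat|now apply HB]. }
  rewrite E in K. simpl fst in K.
  apply (Rmult_le_compat_r (rho ^ j)) in K; [|lra].
  unfold Rdiv in K. rewrite Rmult_assoc, Rinv_l in K by lra. lra.
Qed.

(* Caratheodory's inequality: with [c = z / rho] and [G] a rotation of [F / z^j], take the mean of
   [2 (M - Re G) (1 - Re (eta c^-m)) >= 0]; [T1], ..., [T5] are the terms of its expansion. *)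
Lemma bounded_coef_tail (n : nat) :
  Cmod (coef F (S n + j)) <= 2 * (B0 - Cmod (coef F j)).
Proof.
  set (m := S n).
  destruct (unimodular_align (coef F j)) as [e0 [He0 E0]].
  (* With the minus sign, [T3] contributes a negative multiple of [|coef F (m + j)|] to a
     nonnegative mean, which is therefore an upper bound. *)
  destruct (unimodular_align (- (e0 * coef F (m + j)))%C) as [eta [He E]].
  assert (Em : Cmod (coef F (m + j)) = fst (- (eta * (e0 * coef F (m + j))))%C).
  { replace (- (eta * (e0 * coef F (m + j))))%C with (eta * (- (e0 * coef F (m + j))))%C by ring.
    rewrite E. simpl. rewrite Cmod_opp, Cmod_mult, He0. ring. }
  assert (Goal0 : Cmod (coef F (m + j)) + 2 * Cmod (coef F j) <= 2 * B0); [|lra].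
  apply (le_of_radial_limit _ _ _ m j); [apply Cmod_ge_0|pose proof (Cmod_ge_0 (coef F j)); lra|].
  intros rho Hr.
  assert (Pm : 0 < rho ^ m) by (apply pow_lt; lra).
  assert (Pj : 0 < rho ^ j) by (apply pow_lt; lra).
  set (M := B0 / rho ^ j).
  set (G := fun z => (e0 * (F z / z ^ j))%C).
  assert (HG : diff_on punctured G) by (apply diff_mult; [apply diff_const|now apply diff_div_pow]).
  assert (HGF : diff_on punctured (fun z => e0 * F z)%C) by (apply diff_mult; [apply diff_const|exact HF]).
  set (T1 := fun z : C => (RtoC (2 * M))%C).
  set (T2 := fun z : C => (RtoC (-2) * G z)%C).
  set (T3 := fun z : C => (RtoC (rho ^ m) * (eta * e0 * (F z / z ^ (m + j))))%C).
  set (T4 := fun z : C => (Cconj eta / RtoC (rho ^ m) * (G z * z ^ m))%C).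
  set (T5 := fun z : C => (RtoC (-2 * M * rho ^ m) * (eta * (1 / z ^ m)))%C).
  assert (D1 : diff_on punctured T1) by apply diff_const.
  assert (D2 : diff_on punctured T2) by (apply diff_mult; [apply diff_const|exact HG]).
  assert (D3' : diff_on punctured (fun z => eta * e0 * (F z / z ^ (m + j)))%C).
  { apply diff_mult; [apply diff_const|now apply diff_div_pow]. }
  assert (D3 : diff_on punctured T3) by (apply diff_mult; [apply diff_const|exact D3']).
  assert (D4 : diff_on punctured T4).
  { apply diff_mult; [apply diff_const|apply diff_mult; [exact HG|apply diff_pow]]. }
  assert (D5' : diff_on punctured (fun z => eta * (1 / z ^ m))%C).
  { apply diff_mult; [apply diff_const|apply (diff_div_pow (fun _ => 1%C)), diff_const]. }
  assert (D5 : diff_on punctured T5) by (apply diff_mult; [apply diff_const|exact D5']).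
  assert (V1 : cmean T1 rho = 2 * M).
  { apply (cmean_lim T1 (RtoC (2 * M))); [exact D1|exact Hr|]. intros e Hee. exists 1. split; [lra|].
    intros z _. unfold T1. replace (RtoC (2 * M) - RtoC (2 * M))%C with (RtoC 0) by ring. rewrite Cmod_0. lra. }
  assert (V2 : cmean T2 rho = -2 * Cmod (coef F j)).
  { unfold T2. rewrite cmean_scal by assumption. f_equal. unfold G. rewrite cmean_coef, E0 by assumption. reflexivity. }
  assert (V3 : cmean T3 rho = - rho ^ m * Cmod (coef F (m + j))).
  { unfold T3. rewrite cmean_scal by assumption. rewrite cmean_coef by assumption. rewrite Em.
    replace (eta * e0 * coef F (m + j))%C with (eta * (e0 * coef F (m + j)))%C by ring. simpl. ring. }
  (* The zero of order [j] enters here: by [HC] the quotient [G] is bounded near 0, so [G z^m] tends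
     to 0. *)
  assert (V4 : cmean T4 rho = 0).
  { apply (cmean_lim T4 0%C); [exact D4|exact Hr|]. intros e Hee.
    assert (Hrm : RtoC (rho ^ m) <> 0%C) by (apply RtoC_neq_0; lra).
    set (K := / rho ^ m * (Rabs C0 + 1)).
    assert (HK : 0 < K).
    { pose proof (Rabs_pos C0). apply Rmult_lt_0_compat; [now apply Rinv_0_lt_compat|lra]. }
    exists (Rmin (Rmin d 1) (e / K)). split; [apply Rmin_pos; [apply Rmin_pos; lra|now apply Rdiv_lt_0_compat]|].
    intros z Hz.
    pose proof (Rmin_l (Rmin d 1) (e / K)). pose proof (Rmin_r (Rmin d 1) (e / K)).
    pose proof (Rmin_l d 1). pose proof (Rmin_r d 1).
    assert (Hz0 : z <> 0%C) by (apply Cmod_gt_0; lra).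
    assert (HFz := HC z ltac:(lra)).
    assert (Pz : 0 < Cmod z ^ j) by (apply pow_lt; lra).
    assert (HGz : Cmod (G z) <= Rabs C0).
    { unfold G. rewrite Cmod_mult, He0, Rmult_1_l, Cmod_div, Cmod_pow by now apply Cpow_neq_0.
      apply Rmult_le_reg_r with (Cmod z ^ j); [lra|]. unfold Rdiv. rewrite Rmult_assoc, Rinv_l, Rmult_1_r by lra.
      eapply Rle_trans; [exact HFz|]. apply Rmult_le_compat_r; [lra|apply Rle_abs]. }
    replace (T4 z - 0)%C with (T4 z) by ring. unfold T4.
    rewrite Cmod_mult, Cmod_div, Cmod_conj, He, Cmod_R, Rabs_right, Cmod_mult, Cmod_pow by (auto; lra).
    assert (Hzm : Cmod z ^ m <= Cmod z).
    { unfold m. simpl. rewrite <- (Rmult_1_r (Cmod z)) at 3. apply Rmult_le_compat_l; [lra|].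
      rewrite <- (pow1 n). apply pow_incr. lra. }
    assert (Hzm0 : 0 < Cmod z ^ m) by (apply pow_lt; lra).
    assert (Cmod z * K <= e).
    { apply Rle_trans with (e / K * K); [|right; field; lra]. apply Rmult_le_compat_r; lra. }
    unfold Rdiv. rewrite Rmult_1_l.
    apply Rle_trans with (/ rho ^ m * ((Rabs C0 + 1) * Cmod z)).
    - apply Rmult_le_compat_l; [left; now apply Rinv_0_lt_compat|].
      apply Rmult_le_compat; [apply Cmod_ge_0|lra|lra|exact Hzm].
    - unfold K in *. nra. }
  assert (V5 : cmean T5 rho = 0).
  { unfold T5. rewrite cmean_scal by assumption.
    rewrite (cmean_coef (fun _ => 1%C) m eta rho); [|apply diff_const|exact Hr].
    unfold m. rewrite coef_const. simpl. ring. }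
  assert (Hpos : 0 <= cmean (fun z => T1 z + T2 z + T3 z + T4 z + T5 z)%C rho).
  { apply cmean_ge; [repeat apply diff_plus; assumption|exact Hr|].
    intros t. set (z := cis rho t). pose proof (cis_punctured rho t Hr) as Hp. fold z in Hp.
    pose proof (punctured_neq_0 z Hp) as Hz0.
    assert (Hzr : Cmod z = rho) by (apply Cmod_cis; lra).
    set (q := (RtoC (rho ^ m) / z ^ m)%C).
    assert (Hq : Cmod q = 1).
    { unfold q. rewrite Cmod_div, Cmod_pow, Hzr, Cmod_R, Rabs_right by (try apply Cpow_neq_0; auto; lra). field. lra. }
    assert (Hqc : (z ^ m / RtoC (rho ^ m))%C = Cconj q).
    { assert (Hrm : RtoC (rho ^ m) <> 0%C) by (apply RtoC_neq_0; lra).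
      assert (Hzm : (z ^ m)%C <> 0%C) by now apply Cpow_neq_0.
      assert (Q : (q * Cconj q)%C = 1%C).
      { rewrite <- Cmod2_conj, Hq. apply f_equal. ring. }
      assert (Q0 : q <> 0%C) by (apply Cmod_gt_0; lra).
      replace (Cconj q) with ((q * Cconj q) / q)%C by now field.
      rewrite Q. unfold q. field. auto. }
    set (g := G z).
    assert (HgM : Cmod g <= M).
    { unfold g, G, M. rewrite Cmod_mult, He0, Rmult_1_l, Cmod_div, Cmod_pow, Hzr by now apply Cpow_neq_0.
      apply Rmult_le_compat_r; [left; now apply Rinv_0_lt_compat|now apply HB]. }
    assert (S3 : T3 z = (eta * q * g)%C).
    { unfold T3, q, g, G. rewrite Cpow_add_r. field. split; now apply Cpow_neq_0. }
    assert (S4 : T4 z = (Cconj eta * Cconj q * g)%C).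
    { unfold T4. rewrite <- Hqc. unfold g. field. apply RtoC_neq_0; lra. }
    assert (S5 : T5 z = (RtoC (-2 * M) * (eta * q))%C).
    { unfold T5, q. rewrite (RtoC_mult (-2 * M)). field. now apply Cpow_neq_0. }
    rewrite S3, S4, S5. unfold T1, T2. fold g.
    set (p := (eta * q)%C).
    assert (Hpp : Cmod p = 1) by (unfold p; rewrite Cmod_mult, He, Hq; ring).
    replace (Cconj eta * Cconj q)%C with (Cconj p) by (unfold p; apply Cmult_conj).
    pose proof (Rabs_Re_le p) as R1. pose proof (Rabs_Re_le g) as R2.
    rewrite Hpp in R1. apply Rabs_le_between in R1. apply Rabs_le_between in R2.
    destruct p as [p1 p2], g as [g1 g2]. simpl in *.
    (* Since [Re (p g) + Re (conj p g) = 2 Re p Re g], the real parts of the five terms add up to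
       [2 (M - g1) (1 - p1)]. *)
    assert (0 <= (M - g1) * (1 - p1)) by (apply Rmult_le_pos; lra). nra. }
  rewrite !cmean_plus in Hpos by (repeat apply diff_plus; assumption).
  rewrite V1, V2, V3, V4, V5 in Hpos.
  rewrite pow_add.
  assert (Hfin : rho ^ m * Cmod (coef F (m + j)) + 2 * Cmod (coef F j) <= 2 * M) by lra.
  apply (Rmult_le_compat_r (rho ^ j)) in Hfin; [|lra].
  unfold M in Hfin. replace (2 * (B0 / rho ^ j) * rho ^ j) with (2 * B0) in Hfin by (field; lra). nra.
Qed.

(** The origin of the radius [1/3]: there [r / (1 - r)] reaches [1/2], which cancels the factor 2 of
    [bounded_coef_tail]. *)
Lemma rsum_geom_third (r : R) (N : nat) : 0 <= r <= 1 / 3 -> rsum (fun i => r ^ S i) N <= 1 / 2.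
Proof.
  intros Hr. assert (K : (1 - r) * rsum (fun i => r ^ S i) N = r - r ^ S N).
  { induction N as [|N IH]; [simpl; ring|].
    change (rsum (fun i => r ^ S i) (S N)) with (rsum (fun i => r ^ S i) N + r ^ S N).
    rewrite Rmult_plus_distr_l, IH. simpl. ring. }
  assert (0 <= r ^ S N) by (apply pow_le; lra). nra.
Qed.

Lemma bohr_majorant (r : R) (N : nat) : 0 <= r <= 1 / 3 ->
  rsum (fun i => Cmod (coef F (i + j)) * r ^ i) N <= B0.
Proof.
  intros Hr. pose proof bounded_coef_lead as H0. pose proof (Cmod_ge_0 (coef F j)) as H1.
  destruct N as [|N]; [simpl; lra|].
  assert (E : rsum (fun i => Cmod (coef F (i + j)) * r ^ i) (S N) =
     Cmod (coef F j) + rsum (fun i => Cmod (coef F (S i + j)) * r ^ S i) N).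
  { clear. induction N as [|N IH]; [simpl; ring|].
    change (rsum (fun i => Cmod (coef F (i + j)) * r ^ i) (S (S N))) with
      (rsum (fun i => Cmod (coef F (i + j)) * r ^ i) (S N) + Cmod (coef F (S N + j)) * r ^ S N).
    change (rsum (fun i => Cmod (coef F (S i + j)) * r ^ S i) (S N)) with
      (rsum (fun i => Cmod (coef F (S i + j)) * r ^ S i) N + Cmod (coef F (S N + j)) * r ^ S N).
    rewrite IH. ring. }
  rewrite E.
  assert (rsum (fun i => Cmod (coef F (S i + j)) * r ^ S i) N <= rsum (fun i => 2 * (B0 - Cmod (coef F j)) * r ^ S i) N).
  { apply rsum_le. intros k _. apply Rmult_le_compat_r; [apply pow_le; lra|apply bounded_coef_tail]. }
  rewrite rsum_scal in H. pose proof (rsum_geom_third r N Hr). nra.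
Qed.
End BoundedFunction.

(** * Convergence of complex series *)

Lemma sum_n_csum (f : nat -> C) (n : nat) :
  @sum_n (NormedModule.AbelianGroup C_AbsRing C_NormedModule) f n = csum f (S n).
Proof.
  induction n as [|n IH].
  - rewrite sum_O. simpl. ring.
  - rewrite sum_Sn, IH. reflexivity.
Qed.

Lemma pow_n_C (z : C) (n : nat) : @pow_n C_Ring z n = (z ^ n)%C.
Proof. induction n as [|n IH]; simpl; [reflexivity|]. now rewrite IH. Qed.

Definition C_series (f : nat -> C) (l : C) : Prop :=
  forall e, 0 < e -> exists N, forall n, (N <= n)%nat -> Cmod (csum f n - l)%C < e.

Lemma is_pseries_iff (a : nat -> C) (z l : C) :
  @is_pseries C_AbsRing C_NormedModule a z l <-> C_series (fun k => a k * z ^ k)%C l.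
Proof.
  assert (E : forall n, @sum_n (NormedModule.AbelianGroup C_AbsRing C_NormedModule)
     (fun k => scal (@pow_n C_AbsRing z k) (a k)) n = csum (fun k => a k * z ^ k)%C (S n)).
  { intros n. rewrite sum_n_csum. apply csum_ext. intros k _.
    change (@pow_n C_AbsRing z k * a k = a k * z ^ k)%C.
    replace (@pow_n C_AbsRing z k) with (z ^ k)%C by (symmetry; apply pow_n_C). ring. }
  unfold is_pseries, is_series. split.
  - intros H e He.
    destruct (H (fun w => Cmod (w - l)%C < e)) as [N HN].
    { assert (He2 : 0 < e / 2) by lra. exists (mkposreal _ He2). intros y [Hy1 Hy2].
      change (Rabs (fst y - fst l) < e / 2) in Hy1. change (Rabs (snd y - snd l) < e / 2) in Hy2.
      eapply Rle_lt_trans; [apply (Cmod_le_Rabs (fst y - fst l) (snd y - snd l))|]. lra. }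
    (* [sum_n] includes the term of index [n], while [csum] stops before it. *)
    exists (S N). intros n Hn. destruct n as [|n]; [lia|]. rewrite <- E. apply HN. lia.
  - intros H P [e He]. destruct (H e (cond_pos e)) as [N HN]. exists N. intros n Hn.
    rewrite E. apply He. specialize (HN (S n) ltac:(lia)).
    set (w := csum (fun k => (a k * z ^ k)%C) (S n)) in *.
    split; [change (Rabs (fst w - fst l) < e)|change (Rabs (snd w - snd l) < e)];
      (eapply Rle_lt_trans; [|exact HN]); [apply (Rabs_Re_le (w - l)%C)|apply (Rabs_Im_le (w - l)%C)].
Qed.

(** * Complex power series *)

Definition pser (a : nat -> C) (f : C -> C) : Prop :=
  forall z, Cmod z < 1 -> C_series (fun k => a k * z ^ k)%C (f z).

(** Radius of convergence at least 1. It is equivalent to convergence on the disc, by [pser_exists]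
    and [pser_subexponential], and easier to verify than convergence. *)
Definition subexponential (a : nat -> C) : Prop :=
  forall rho, 0 < rho < 1 -> exists M, forall n, Cmod (a n) * rho ^ n <= M.

Lemma C_series_le (f : nat -> C) (l : C) (M : R) (N : nat) :
  C_series f l -> (forall n, (N <= n)%nat -> Cmod (csum f n) <= M) -> Cmod l <= M.
Proof.
  intros H HM. apply le_epsilon. intros e He. destruct (H e He) as [N' HN'].
  specialize (HN' (Nat.max N N') ltac:(lia)). specialize (HM (Nat.max N N') ltac:(lia)).
  replace l with (csum f (Nat.max N N') - (csum f (Nat.max N N') - l))%C by ring.
  unfold Cminus at 1. eapply Rle_trans; [apply Cmod_triangle|]. rewrite Cmod_opp. lra.
Qed.

Lemma C_series_linear (f g : nat -> C) (l m x y : C) :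
  C_series f l -> C_series g m -> C_series (fun k => x * f k + y * g k)%C (x * l + y * m)%C.
Proof.
  intros Hf Hg e He.
  set (K := Cmod x + Cmod y + 1). pose proof (Cmod_ge_0 x). pose proof (Cmod_ge_0 y).
  assert (HK : 0 < e / K) by (apply Rdiv_lt_0_compat; unfold K; lra).
  destruct (Hf _ HK) as [N1 H1]. destruct (Hg _ HK) as [N2 H2].
  exists (Nat.max N1 N2). intros n Hn. specialize (H1 n ltac:(lia)). specialize (H2 n ltac:(lia)).
  assert (E : csum (fun k => x * f k + y * g k)%C n = (x * csum f n + y * csum g n)%C).
  { clear. induction n as [|n IH]; simpl; [ring|]. rewrite IH. ring. }
  rewrite E. replace (x * csum f n + y * csum g n - (x * l + y * m))%C
    with (x * (csum f n - l) + y * (csum g n - m))%C by ring.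
  eapply Rle_lt_trans; [apply Cmod_triangle|]. rewrite !Cmod_mult.
  assert (e = (e / K) * K) by (field; unfold K; lra).
  assert (Cmod x * Cmod (csum f n - l)%C <= Cmod x * (e / K)) by (apply Rmult_le_compat_l; lra).
  assert (Cmod y * Cmod (csum g n - m)%C <= Cmod y * (e / K)) by (apply Rmult_le_compat_l; lra).
  unfold K in *. nra.
Qed.

Lemma C_series_ext (f g : nat -> C) (l : C) :
  (forall k, f k = g k) -> C_series f l -> C_series g l.
Proof.
  intros E H e He. destruct (H e He) as [N HN]. exists N. intros n Hn.
  rewrite (csum_ext g f); [now apply HN|]. intros; symmetry; apply E.
Qed.

Lemma C_series_unique (f : nat -> C) (l m : C) : C_series f l -> C_series f m -> l = m.
Proof.
  intros Hl Hm. assert (H := C_series_linear f f l m 1 (-1) Hl Hm).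
  assert (Z : (1 * l + -1 * m)%C = 0%C).
  { apply Cmod_eq_0. apply Rle_antisym; [|apply Cmod_ge_0]. apply (C_series_le _ _ _ 0%nat H). intros n _.
    replace (csum _ n) with (RtoC 0); [rewrite Cmod_0; lra|].
    clear. induction n as [|n IH]; [reflexivity|]. simpl. rewrite <- IH. ring. }
  replace l with (1 * l + -1 * m + m)%C by ring. rewrite Z. ring.
Qed.

Lemma rsum_geom (q : R) (n : nat) : 0 <= q < 1 -> rsum (fun k => q ^ k) n <= / (1 - q).
Proof.
  intros Hq. assert (E : (1 - q) * rsum (fun k => q ^ k) n = 1 - q ^ n).
  { induction n as [|n IH]; [simpl; ring|]. simpl rsum. rewrite Rmult_plus_distr_l, IH. simpl. ring. }
  assert (0 <= q ^ n) by (apply pow_le; lra).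
  apply Rmult_le_reg_l with (1 - q); [lra|]. rewrite E, Rinv_r; lra.
Qed.

Lemma csum_add (f : nat -> C) (n k : nat) :
  csum f (n + k) = (csum f n + csum (fun i => f (n + i)%nat) k)%C.
Proof.
  induction k as [|k IH]; [rewrite Nat.add_0_r; simpl; ring|].
  rewrite Nat.add_succ_r. simpl. rewrite IH. ring.
Qed.

Lemma C_series_exists (f : nat -> C) (M q : R) :
  0 <= q < 1 -> (forall k, Cmod (f k) <= M * q ^ k) -> exists l, C_series f l.
Proof.
  intros Hq H.
  assert (Hg : ex_series (fun k => M * q ^ k)).
  { apply (ex_series_scal M (fun k => q ^ k)). eexists. apply is_series_geom. rewrite Rabs_right; lra. }
  assert (K : forall p : C -> R, (forall w, Rabs (p w) <= Cmod w) -> ex_series (fun k => p (f k))).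
  { intros p Hp. apply (ex_series_le (V := R_CompleteNormedModule) _ (fun k => M * q ^ k)); [|exact Hg].
    intros n. eapply Rle_trans; [apply Hp|apply H]. }
  destruct (K fst Rabs_Re_le) as [x Hx]. destruct (K snd Rabs_Im_le) as [y Hy].
  exists (x, y). intros e He.
  assert (He2 : 0 < e / 2) by lra.
  destruct (Hx _ (locally_ball x (mkposreal _ He2))) as [N1 H1].
  destruct (Hy _ (locally_ball y (mkposreal _ He2))) as [N2 H2].
  exists (S (Nat.max N1 N2)). intros [|n] Hn; [lia|].
  specialize (H1 n ltac:(lia)). specialize (H2 n ltac:(lia)).
  change (Rabs (sum_n (fun k => fst (f k)) n - x) < e / 2) in H1.
  change (Rabs (sum_n (fun k => snd (f k)) n - y) < e / 2) in H2.
  assert (E : forall m, csum f (S m) = (sum_n (fun k => fst (f k)) m, sum_n (fun k => snd (f k)) m)).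
  { clear. induction m as [|m IH].
    - rewrite !sum_O. simpl. destruct (f 0%nat). unfold Cplus, RtoC; simpl. f_equal; ring.
    - rewrite !sum_Sn. change (csum f (S (S m))) with (csum f (S m) + f (S m))%C. rewrite IH. reflexivity. }
  rewrite E. eapply Rle_lt_trans; [apply (Cmod_le_Rabs (_ - x) (_ - y))|].
  replace e with (e / 2 + e / 2) by field. apply Rplus_lt_compat; [exact H1|exact H2].
Qed.

Lemma pser_exists (a : nat -> C) : subexponential a -> exists f, pser a f.
Proof.
  intros H.
  assert (K : forall z, exists l, Cmod z < 1 -> C_series (fun k => a k * z ^ k)%C l).
  { intros z. destruct (Rlt_dec (Cmod z) 1) as [Hz|Hz]; [|exists 0%C; intros; contradiction].
    pose proof (Cmod_ge_0 z).
    set (rho := (1 + Cmod z) / 2). destruct (H rho) as [M HM]; [unfold rho; lra|].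
    destruct (C_series_exists (fun k => a k * z ^ k)%C M (Cmod z / rho)) as [l Hl].
    - split; [apply Rdiv_le_0_compat; unfold rho; lra|].
      apply Rmult_lt_reg_r with rho; [unfold rho; lra|]. unfold Rdiv. rewrite Rmult_assoc, Rinv_l; unfold rho; lra.
    - intros k. rewrite Cmod_mult, Cmod_pow.
      assert (Hr : 0 < rho) by (unfold rho; lra).
      replace (Cmod z ^ k) with (rho ^ k * (Cmod z / rho) ^ k).
      + rewrite <- Rmult_assoc. apply Rmult_le_compat_r; [|apply HM]. apply pow_le.
        apply Rdiv_le_0_compat; lra.
      + rewrite <- Rpow_mult_distr. f_equal. field. lra.
    - exists l. auto. }
  apply choice in K. exact K.
Qed.

Lemma pser_subexponential (a : nat -> C) (f : C -> C) : pser a f -> subexponential a.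
Proof.
  intros H rho Hr. destruct (H (RtoC rho)) with (e := 1) as [N HN].
  { rewrite Cmod_R, Rabs_right; lra. } { lra. }
  assert (K : forall n, (N <= n)%nat -> Cmod (a n) * rho ^ n <= 2).
  { intros n Hn. pose proof (HN n Hn) as H1. pose proof (HN (S n) ltac:(lia)) as H2. simpl in H2.
    set (s := csum _ n) in *.
    replace (Cmod (a n) * rho ^ n) with (Cmod (a n * RtoC rho ^ n)%C).
    - replace (a n * RtoC rho ^ n)%C with ((s + a n * RtoC rho ^ n - f (RtoC rho)) - (s - f (RtoC rho)))%C by ring.
      unfold Cminus at 1. eapply Rle_trans; [apply Cmod_triangle|]. rewrite Cmod_opp. lra.
    - rewrite Cmod_mult, Cmod_pow, Cmod_R, Rabs_right; lra. }
  exists (2 + rsum (fun k => Cmod (a k) * rho ^ k) N). intros n.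
  assert (P : forall k, 0 <= Cmod (a k) * rho ^ k).
  { intros k. apply Rmult_le_pos; [apply Cmod_ge_0|apply pow_le; lra]. }
  assert (Q : forall m k, (k < m)%nat -> Cmod (a k) * rho ^ k <= rsum (fun k => Cmod (a k) * rho ^ k) m).
  { clear - P. induction m as [|m IH]; intros k Hk; [lia|]. simpl.
    destruct (Nat.eq_dec k m) as [->|Hne].
    - assert (0 <= rsum (fun k => Cmod (a k) * rho ^ k) m) by (apply rsum_ge_0; intros; apply P). lra.
    - pose proof (IH k ltac:(lia)). pose proof (P m). lra. }
  destruct (Nat.lt_ge_cases n N) as [L|L].
  - pose proof (Q N n L). lra.
  - pose proof (K n L). assert (0 <= rsum (fun k => Cmod (a k) * rho ^ k) N) by (apply rsum_ge_0; intros; apply P). lra.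
Qed.

(** As [|a_k| / 2^k <= M] and [|2 z| <= 1/2], the tail is dominated by a geometric series of ratio
    [1/2]; its sum is the factor 2 in the constant. Replacing the first [n] terms by 0 makes the
    tail itself a series. *)
Lemma pser_taylor (a : nat -> C) (f : C -> C) (n : nat) :
  pser a f -> exists C0, 0 <= C0 /\ forall z, Cmod z <= 1 / 4 ->
    Cmod (f z - csum (fun k => a k * z ^ k)%C n)%C <= C0 * Cmod z ^ n.
Proof.
  intros H. destruct (pser_subexponential a f H (1 / 2)) as [M HM]; [lra|].
  assert (HM0 : 0 <= M).
  { eapply Rle_trans; [|apply (HM 0%nat)]. apply Rmult_le_pos; [apply Cmod_ge_0|simpl; lra]. }
  exists (2 * M * 2 ^ n). split; [apply Rmult_le_pos; [lra|apply pow_le; lra]|].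
  intros z Hz. pose proof (Cmod_ge_0 z).
  assert (Hs : C_series (fun k => a k * z ^ k)%C (f z)) by (apply H; lra).
  apply C_series_le with (f := fun k => if Nat.ltb k n then RtoC 0 else (a k * z ^ k)%C) (N := n).
  - intros e He. destruct (Hs e He) as [N HN]. exists (Nat.max N n). intros m Hm.
    specialize (HN m ltac:(lia)). replace m with (n + (m - n))%nat in * by lia.
    rewrite csum_add in *.
    rewrite (csum_ext (fun k => if Nat.ltb k n then RtoC 0 else _) (fun _ => RtoC 0)).
    2: { intros k Hk. apply Nat.ltb_lt in Hk. now rewrite Hk. }
    rewrite (csum_ext (fun i => if Nat.ltb (n + i) n then RtoC 0 else _) (fun i => (a (n + i)%nat * z ^ (n + i))%C)).
    2: { intros k Hk. destruct (Nat.ltb_ge (n + k) n) as [_ E]. rewrite E by lia. reflexivity. }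
    replace (csum (fun _ => RtoC 0) n) with (RtoC 0) by (clear; induction n as [|n IH]; simpl; [reflexivity|rewrite <- IH; ring]).
    eapply Rle_lt_trans; [|exact HN]. right. f_equal. ring.
  - intros m Hm. replace m with (n + (m - n))%nat by lia. rewrite csum_add.
    rewrite (csum_ext (fun k => if Nat.ltb k n then RtoC 0 else _) (fun _ => RtoC 0)).
    2: { intros k Hk. apply Nat.ltb_lt in Hk. now rewrite Hk. }
    rewrite (csum_ext (fun i => if Nat.ltb (n + i) n then RtoC 0 else _) (fun i => (a (n + i)%nat * z ^ (n + i))%C)).
    2: { intros k Hk. destruct (Nat.ltb_ge (n + k) n) as [_ E]. rewrite E by lia. reflexivity. }
    replace (csum (fun _ => RtoC 0) n) with (RtoC 0) by (clear; induction n as [|n IH]; simpl; [reflexivity|rewrite <- IH; ring]).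
    rewrite Cplus_0_l. eapply Rle_trans; [apply Cmod_csum|].
    apply Rle_trans with (rsum (fun i => (M * 2 ^ n * Cmod z ^ n) * (1 / 2) ^ i) (m - n)).
    + apply rsum_le. intros k _. rewrite Cmod_mult, Cmod_pow.
      pose proof (HM (n + k)%nat) as Hb.
      replace (Cmod z ^ (n + k)) with ((1 / 2) ^ (n + k) * (2 ^ n * Cmod z ^ n * (2 * Cmod z) ^ k)).
      2: { rewrite !pow_add, Rpow_mult_distr.
           replace (1 / 2) with (/ 2) by field. rewrite !pow_inv. field. split; apply pow_nonzero; lra. }
      rewrite <- Rmult_assoc.
      apply Rle_trans with (M * (2 ^ n * Cmod z ^ n * (2 * Cmod z) ^ k)).
      * apply Rmult_le_compat_r; [|exact Hb]. repeat apply Rmult_le_pos; try apply pow_le; lra.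
      * assert ((2 * Cmod z) ^ k <= (1 / 2) ^ k) by (apply pow_incr; lra).
        replace (M * 2 ^ n * Cmod z ^ n * (1 / 2) ^ k) with (M * (2 ^ n * Cmod z ^ n * (1 / 2) ^ k)) by ring.
        apply Rmult_le_compat_l; [lra|]. apply Rmult_le_compat_l; [|exact H1].
        apply Rmult_le_pos; apply pow_le; lra.
    + rewrite rsum_scal. pose proof (rsum_geom (1 / 2) (m - n) ltac:(lra)).
      replace (2 * M * 2 ^ n * Cmod z ^ n) with (M * 2 ^ n * Cmod z ^ n * 2) by ring.
      apply Rmult_le_compat_l; [repeat apply Rmult_le_pos; try apply pow_le; lra|].
      eapply Rle_trans; [exact H1|]. right. field.
Qed.

(** Each of the [k] powers [s^i] with [i < k] is at least [s^k]. *)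
Lemma INR_pow_bound (s : R) (k : nat) : 0 < s < 1 -> INR k * s ^ k <= / (1 - s).
Proof.
  intros Hs. apply Rle_trans with (rsum (fun i => s ^ i) k); [|apply rsum_geom; lra].
  induction k as [|k IH]; [simpl; lra|]. rewrite S_INR.
  change (rsum (fun i => s ^ i) (S k)) with (rsum (fun i => s ^ i) k + s ^ k).
  assert (P : 0 < s ^ k) by (apply pow_lt; lra). pose proof (pos_INR k). simpl.
  assert (INR k * (s * s ^ k) <= INR k * s ^ k) by (apply Rmult_le_compat_l; nra). nra.
Qed.

(** First and second order Taylor bounds for [z^k]. The factors [rho] and [rho * rho] on the left
    avoid the exponents [k - 1] and [k - 2], so that a single induction proves both. *)
Lemma pow_diff_bounds (z z0 : C) (rho : R) (k : nat) :
  0 < rho -> Cmod z <= rho -> Cmod z0 <= rho ->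
  rho * Cmod (z ^ k - z0 ^ k)%C <= INR k * rho ^ k * Cmod (z - z0)%C /\
  rho * rho * Cmod (z ^ k - z0 ^ k - INR k * z0 ^ pred k * (z - z0))%C
    <= INR k * INR k * rho ^ k * (Cmod (z - z0)%C * Cmod (z - z0)%C).
Proof.
  intros Hr Hz Hz0. set (dl := Cmod (z - z0)%C). pose proof (Cmod_ge_0 (z - z0)%C) as Hdl. fold dl in Hdl.
  induction k as [|k [IH1 IH2]].
  - simpl. split.
    + replace (1 - 1)%C with (RtoC 0) by ring. rewrite Cmod_0. lra.
    + replace (1 - 1 - 0 * 1 * (z - z0))%C with (RtoC 0) by ring. rewrite Cmod_0. lra.
  - assert (Hzk : Cmod (z ^ k)%C <= rho ^ k).
    { rewrite Cmod_pow. apply pow_incr. split; [apply Cmod_ge_0|exact Hz]. }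
    assert (Pk : 0 < rho ^ k) by now apply pow_lt.
    pose proof (pos_INR k) as Hk. rewrite S_INR.
    split.
    + replace (z ^ S k - z0 ^ S k)%C with (z0 * (z ^ k - z0 ^ k) + (z - z0) * z ^ k)%C by (simpl; ring).
      apply Rle_trans with (rho * (rho * Cmod (z ^ k - z0 ^ k)%C + dl * rho ^ k)).
      * apply Rmult_le_compat_l; [lra|]. eapply Rle_trans; [apply Cmod_triangle|]. rewrite !Cmod_mult. fold dl.
        apply Rplus_le_compat; apply Rmult_le_compat; try apply Cmod_ge_0; lra.
      * simpl pow. nra.
    + replace (z ^ S k - z0 ^ S k - RtoC (INR k + 1) * z0 ^ pred (S k) * (z - z0))%C
        with (z0 * (z ^ k - z0 ^ k - INR k * z0 ^ pred k * (z - z0)) + (z - z0) * (z ^ k - z0 ^ k))%C.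
      2: { rewrite RtoC_plus. destruct k; simpl; ring. }
      set (X := Cmod (z ^ k - z0 ^ k - INR k * z0 ^ pred k * (z - z0))%C) in *.
      set (Y := Cmod (z ^ k - z0 ^ k)%C) in *.
      apply Rle_trans with (rho * rho * (rho * X + dl * Y)).
      * apply Rmult_le_compat_l; [nra|]. eapply Rle_trans; [apply Cmod_triangle|]. rewrite !Cmod_mult. fold dl X Y.
        apply Rplus_le_compat_r. apply Rmult_le_compat_r; [apply Cmod_ge_0|exact Hz0].
      * apply (Rmult_le_compat_l rho) in IH2; [|lra].
        apply (Rmult_le_compat_l (rho * dl)) in IH1; [|nra].
        assert (0 <= rho * rho ^ k * (dl * dl)) by (repeat apply Rmult_le_pos; lra).
        simpl pow.
        replace (rho * rho * (rho * X + dl * Y)) with (rho * (rho * rho * X) + rho * dl * (rho * Y)) by ring.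
        nra.
Qed.

Lemma pser_deriv (a : nat -> C) (f : C -> C) :
  pser a f -> exists g, pser (fun k => INR (S k) * a (S k))%C g /\
    forall z, Cmod z < 1 -> cder f z (g z).
Proof.
  intros H.
  assert (Ha : subexponential a) by exact (pser_subexponential a f H).
  assert (Hb : subexponential (fun k => INR (S k) * a (S k))%C).
  { intros rho Hr. set (s := (1 + rho) / 2). destruct (Ha s) as [M HM]; [unfold s; lra|].
    set (q := rho / s). assert (Hs : 0 < s) by (unfold s; lra).
    assert (Hq : 0 < q < 1).
    { unfold q. split; [apply Rdiv_lt_0_compat; lra|]. apply Rmult_lt_reg_r with s; [lra|].
      unfold Rdiv. rewrite Rmult_assoc, Rinv_l; unfold s; lra. }
    exists (M * / (1 - q) * / rho). intros n. rewrite Cmod_mult, Cmod_R, Rabs_right by (apply Rle_ge, pos_INR).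
    pose proof (HM (S n)) as H1. pose proof (INR_pow_bound q (S n) Hq) as H2.
    assert (0 < s ^ S n) by (apply pow_lt; lra). assert (0 < q ^ S n) by (apply pow_lt; lra).
    apply Rmult_le_reg_r with rho; [lra|].
    replace (INR (S n) * Cmod (a (S n)) * rho ^ n * rho) with ((Cmod (a (S n)) * s ^ S n) * (INR (S n) * q ^ S n)).
    - replace (M * / (1 - q) * / rho * rho) with (M * / (1 - q)) by (field; lra).
      apply Rmult_le_compat; auto.
      + apply Rmult_le_pos; [apply Cmod_ge_0|lra].
      + apply Rmult_le_pos; [apply pos_INR|lra].
    - replace (Cmod (a (S n)) * s ^ S n * (INR (S n) * q ^ S n)) with (INR (S n) * Cmod (a (S n)) * (s ^ S n * q ^ S n)) by ring.
      rewrite <- Rpow_mult_distr. replace (s * q) with rho by (unfold q; field; lra). simpl. ring. }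
  destruct (pser_exists _ Hb) as [g Hg]. exists g. split; [exact Hg|].
  intros z0 Hz0. pose proof (Cmod_ge_0 z0) as Hz00.
  (* For [x = (1 - |z0|) / 5] one has [(1 - x)^4 >= 1 - 4 x > 1 - 5 x = |z0|]. *)
  set (s := 1 - (1 - Cmod z0) / 5). assert (Hs : 0 < s < 1) by (unfold s; lra).
  (* Four factors [s^k] are spent on the term of index [k]: one bounds [a k], two absorb [k * k],
     and the last leaves a convergent geometric series. *)
  set (rho := s * s * s * s).
  assert (Hrho : Cmod z0 < rho).
  { unfold rho. set (x := (1 - Cmod z0) / 5) in *. unfold s. replace (Cmod z0) with (1 - 5 * x) by (unfold x; field).
    assert (0 < x <= 1 / 5) by (unfold x; lra). nra. }
  assert (Hr0 : 0 < rho) by lra.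
  destruct (Ha s Hs) as [M HM].
  set (K := M * (/ (1 - s) * / (1 - s)) * / (1 - s)).
  assert (HM0 : 0 <= M).
  { eapply Rle_trans; [|apply (HM 0%nat)]. apply Rmult_le_pos; [apply Cmod_ge_0|simpl; lra]. }
  assert (Hi : 0 < / (1 - s)) by (apply Rinv_0_lt_compat; lra).
  assert (HK0 : 0 <= K) by (unfold K; repeat apply Rmult_le_pos; lra).
  assert (Main : forall z, Cmod z <= rho -> Cmod z < 1 ->
    rho * rho * Cmod (f z - f z0 - g z0 * (z - z0))%C <= K * (Cmod (z - z0)%C * Cmod (z - z0)%C)).
  { intros z Hz Hz1. set (dl := Cmod (z - z0)%C).
    assert (S1 := C_series_linear _ _ _ _ 1 (-1) (H z Hz1) (H z0 Hz0)).
    assert (S2 : C_series (fun k => a k * (INR k * z0 ^ pred k))%C (g z0)).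
    { intros e He. destruct (Hg z0 Hz0 e He) as [N HN]. exists (S N). intros [|n] Hn; [lia|].
      specialize (HN n ltac:(lia)). eapply Rle_lt_trans; [|exact HN]. right. f_equal. f_equal.
      clear. induction n as [|n IH]; [simpl; ring|].
      change (csum (fun k => a k * (INR k * z0 ^ pred k))%C (S (S n))) with
        (csum (fun k => a k * (INR k * z0 ^ pred k))%C (S n) + a (S n) * (INR (S n) * z0 ^ n))%C.
      rewrite IH.
      change (csum (fun k => INR (S k) * a (S k) * z0 ^ k)%C (S n)) with
        (csum (fun k => INR (S k) * a (S k) * z0 ^ k)%C n + INR (S n) * a (S n) * z0 ^ n)%C. ring. }
    assert (S3 := C_series_linear _ _ _ _ 1 (- (z - z0))%C S1 S2). cbv beta in S3.
    assert (S4 := C_series_linear _ _ _ _ (RtoC (rho * rho)) 0%C S3 S1). cbv beta in S4.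
    replace (rho * rho * Cmod (f z - f z0 - g z0 * (z - z0))%C) with
      (Cmod (RtoC (rho * rho) * (1 * (1 * f z + -1 * f z0) + - (z - z0) * g z0) + 0 * (1 * f z + -1 * f z0))%C).
    2: { replace (_ + 0 * _)%C with (RtoC (rho * rho) * (f z - f z0 - g z0 * (z - z0)))%C by ring.
         rewrite Cmod_mult, Cmod_R, Rabs_right; [reflexivity|nra]. }
    apply (C_series_le _ _ _ 0%nat S4). intros n _.
    eapply Rle_trans; [apply Cmod_csum|].
    apply Rle_trans with (rsum (fun k => (M * (/ (1 - s) * / (1 - s)) * (dl * dl)) * s ^ k) n).
    - apply rsum_le. intros k _.
      replace (RtoC (rho * rho) * (1 * (1 * (a k * z ^ k) + -1 * (a k * z0 ^ k)) +
         - (z - z0) * (a k * (INR k * z0 ^ pred k))) + 0 * (1 * (a k * z ^ k) + -1 * (a k * z0 ^ k)))%C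
        with (a k * (RtoC (rho * rho) * (z ^ k - z0 ^ k - INR k * z0 ^ pred k * (z - z0))))%C by ring.
      rewrite !Cmod_mult, Cmod_R, Rabs_right by nra.
      destruct (pow_diff_bounds z z0 rho k Hr0 Hz ltac:(lra)) as [_ Hp]. fold dl in Hp.
      apply Rle_trans with (Cmod (a k) * (INR k * INR k * rho ^ k * (dl * dl))).
      { apply Rmult_le_compat_l; [apply Cmod_ge_0|]. exact Hp. }
      assert (E : rho ^ k = s ^ k * s ^ k * s ^ k * s ^ k) by (unfold rho; rewrite !Rpow_mult_distr; reflexivity).
      rewrite E. pose proof (INR_pow_bound s k Hs) as Hb2. pose proof (HM k) as Hb1.
      assert (Ps : 0 < s ^ k) by (apply pow_lt; lra). pose proof (pos_INR k).
      assert (Hdl : 0 <= dl * dl) by nra.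
      replace (Cmod (a k) * (INR k * INR k * (s ^ k * s ^ k * s ^ k * s ^ k) * (dl * dl)))
        with ((Cmod (a k) * s ^ k) * ((INR k * s ^ k) * (INR k * s ^ k)) * (dl * dl) * s ^ k) by ring.
      assert (0 <= INR k * s ^ k) by (apply Rmult_le_pos; lra).
      assert (0 <= Cmod (a k) * s ^ k) by (apply Rmult_le_pos; [apply Cmod_ge_0|lra]).
      apply Rmult_le_compat_r; [lra|]. apply Rmult_le_compat_r; [exact Hdl|].
      apply Rmult_le_compat; auto; [nra|]. apply Rmult_le_compat; auto.
    - rewrite rsum_scal. pose proof (rsum_geom s n ltac:(lra)).
      replace (K * (dl * dl)) with (M * (/ (1 - s) * / (1 - s)) * (dl * dl) * / (1 - s)) by (unfold K; ring).
      apply Rmult_le_compat_l; [|exact H0]. repeat apply Rmult_le_pos; try lra; apply Cmod_ge_0. }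
  intros eps He.
  exists (Rmin (rho - Cmod z0) (eps * (rho * rho) / (K + 1))). split.
  - apply Rmin_pos; [lra|]. apply Rdiv_lt_0_compat; [|lra]. apply Rmult_lt_0_compat; [lra|nra].
  - intros w Hw.
    assert (H1 : Cmod (w - z0)%C < rho - Cmod z0) by (eapply Rlt_le_trans; [exact Hw|apply Rmin_l]).
    assert (H2 : Cmod (w - z0)%C < eps * (rho * rho) / (K + 1)) by (eapply Rlt_le_trans; [exact Hw|apply Rmin_r]).
    assert (Hw2 : Cmod w <= rho).
    { replace w with (z0 + (w - z0))%C by ring. eapply Rle_trans; [apply Cmod_triangle|]. lra. }
    assert (Hr1 : rho < 1).
    { unfold rho. assert (s * s < 1) by nra. nra. }
    pose proof (Main w Hw2 ltac:(lra)) as HMn.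
    pose proof (Cmod_ge_0 (w - z0)%C) as Hd. set (dl := Cmod (w - z0)%C) in *.
    apply Rmult_le_reg_l with (rho * rho); [nra|].
    eapply Rle_trans; [exact HMn|].
    apply (Rmult_lt_compat_r (K + 1)) in H2; [|lra].
    replace (eps * (rho * rho) / (K + 1) * (K + 1)) with (eps * (rho * rho)) in H2 by (field; lra).
    assert (K * dl <= eps * (rho * rho)) by nra.
    replace (rho * rho * (eps * dl)) with (eps * (rho * rho) * dl) by ring.
    rewrite <- Rmult_assoc. apply Rmult_le_compat_r; assumption.
Qed.

Lemma pser_diff (a : nat -> C) (f : C -> C) : pser a f -> diff_on (fun z => Cmod z < 1) f.
Proof.
  intros H z Hz. destruct (pser_deriv a f H) as [g [_ Hg]]. exists (g z). now apply Hg.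
Qed.

Lemma punctured_disc (z : C) : punctured z -> Cmod z < 1.
Proof. intros [_ H]; exact H. Qed.

Lemma csum_single (f : nat -> C) (n : nat) :
  (forall k, (k < n)%nat -> f k = 0%C) -> csum f (S n) = f n.
Proof.
  intros H. simpl. replace (csum f n) with (RtoC 0); [ring|].
  rewrite (csum_ext f (fun _ => RtoC 0)) by exact H.
  clear. induction n as [|n IH]; simpl; [reflexivity|]. rewrite <- IH. ring.
Qed.

Lemma coef_pow (a : C) (k n : nat) : (k <= n)%nat ->
  coef (fun z => a * z ^ k)%C n = if Nat.eqb k n then a else 0%C.
Proof.
  intros Hk. rewrite (coef_ext _ (fun z => z ^ k * (fun _ => a) z)%C) by (intros; ring).
  replace n with (k + (n - k))%nat at 1 by lia. rewrite coef_shift.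
  destruct (Nat.eqb_spec k n) as [->|Hne].
  - rewrite Nat.sub_diag. apply coef_lim; [apply diff_const|]. intros e He. exists 1. split; [lra|].
    intros z _. replace (a / z ^ 0 - a)%C with (RtoC 0); [rewrite Cmod_0; lra|].
    simpl. field.
  - replace (n - k)%nat with (S (n - k - 1)) by lia. apply coef_const.
Qed.

Lemma coef_pser (a : nat -> C) (f : C -> C) (n : nat) : pser a f -> coef f n = a n.
Proof.
  intros H. destruct (pser_taylor a f (S n) H) as [C0 [_ HC]].
  rewrite (coef_expand f (fun k z => a k * z ^ k)%C n C0 (1 / 4)).
  - rewrite csum_single.
    + rewrite coef_pow by lia. now rewrite Nat.eqb_refl.
    + intros k Hk. rewrite coef_pow by lia. destruct (Nat.eqb_spec k n); [lia|reflexivity].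
  - apply (diff_on_sub _ _ f punctured_disc). exact (pser_diff a f H).
  - intros k. apply diff_mult; [apply diff_const|apply diff_pow].
  - lra.
  - intros z Hz. apply HC. lra.
Qed.

(** * Maps of the disc onto sectors *)

Lemma pser_lin (a b : nat -> C) (f g : C -> C) (x y : C) :
  pser a f -> pser b g -> pser (fun k => x * a k + y * b k)%C (fun z => x * f z + y * g z)%C.
Proof.
  intros Hf Hg z Hz. eapply C_series_ext; [|apply (C_series_linear _ _ _ _ x y (Hf z Hz) (Hg z Hz))].
  intros k. cbv beta. ring.
Qed.

Definition shift_coef (a : nat -> C) (n : nat) : C :=
  match n with O => RtoC 0 | S k => a k end.

Lemma pser_shift (a : nat -> C) (f : C -> C) :
  pser a f -> pser (shift_coef a) (fun z => z * f z)%C.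
Proof.
  intros H z Hz e He.
  assert (He' : 0 < e / 2) by lra.
  destruct (H z Hz (e / 2) He') as [N HN]. exists (S N). intros [|n] Hn; [lia|].
  specialize (HN n ltac:(lia)).
  assert (E : csum (fun k => shift_coef a k * z ^ k)%C (S n) = (z * csum (fun k => a k * z ^ k)%C n)%C).
  { clear. induction n as [|n IH]; [simpl; ring|].
    change (csum (fun k => shift_coef a k * z ^ k)%C (S (S n))) with
      (csum (fun k => shift_coef a k * z ^ k)%C (S n) + a n * z ^ (S n))%C.
    rewrite IH. simpl. ring. }
  rewrite E. replace (z * csum (fun k => a k * z ^ k) n - z * f z)%C with (z * (csum (fun k => a k * z ^ k) n - f z))%C by ring.
  rewrite Cmod_mult. pose proof (Cmod_ge_0 z). pose proof (Cmod_ge_0 (csum (fun k => a k * z ^ k)%C n - f z)%C). nra.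
Qed.

Lemma pser_ext (a b : nat -> C) (f g : C -> C) :
  (forall k, a k = b k) -> (forall z, Cmod z < 1 -> f z = g z) -> pser a f -> pser b g.
Proof.
  intros E E' H z Hz. rewrite <- E' by exact Hz. eapply C_series_ext; [|apply (H z Hz)].
  intros k. cbv beta. now rewrite E.
Qed.

Lemma pser_zero (a : nat -> C) (f : C -> C) :
  pser a f -> (forall k, a k = 0%C) -> forall z, Cmod z < 1 -> f z = 0%C.
Proof.
  intros H E z Hz. apply Cmod_eq_0, Rle_antisym; [|apply Cmod_ge_0].
  apply (C_series_le _ _ 0 0%nat (H z Hz)). intros n _.
  replace (csum _ n) with (RtoC 0); [rewrite Cmod_0; lra|].
  induction n as [|n IH]; [reflexivity|]. simpl. rewrite <- IH, E. ring.
Qed.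

Lemma pser_at_0 (a : nat -> C) (f : C -> C) : pser a f -> f 0%C = a 0%nat.
Proof.
  intros H. apply (C_series_unique (fun k => a k * 0 ^ k)%C).
  - apply H. rewrite Cmod_0. lra.
  - intros e He. exists 1%nat. intros n Hn. destruct n as [|n]; [lia|].
    replace (csum (fun k => a k * 0 ^ k)%C (S n)) with (a 0%nat).
    + replace (a 0%nat - a 0%nat)%C with (RtoC 0) by ring. rewrite Cmod_0. exact He.
    + clear. induction n as [|n IH]; [simpl; ring|].
      change (csum (fun k => a k * 0 ^ k)%C (S (S n))) with
        (csum (fun k => a k * 0 ^ k)%C (S n) + a (S n) * 0 ^ (S n))%C. rewrite <- IH. simpl. ring.
Qed.

(** Along the segment from 0 to [z] the real and imaginary parts are real functions with zero
    derivative. *)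
Lemma cder_zero_const (f : C -> C) :
  (forall z, Cmod z < 1 -> cder f z 0%C) -> forall z, Cmod z < 1 -> f z = f 0%C.
Proof.
  intros H z Hz. pose proof (Cmod_ge_0 z) as Hz0.
  assert (K : forall p : C -> R, (forall w, Rabs (p w) <= Cmod w) -> (forall u v, p (u - v)%C = p u - p v) -> p (f z) = p (f 0%C)).
  { intros p Hp Hm.
    assert (E : (fun t : R => p (f (t * z)%C)) 0 = (fun t : R => p (f (t * z)%C)) 1).
    { assert (Hd0 : forall t : R, 0 <= t <= 1 -> is_derive (fun t : R => p (f (t * z)%C)) t 0);
        [|exact (eq_is_derive (V := R_NormedModule) _ 0 1 Hd0 Rlt_0_1)].
      intros t Ht. apply is_derive_Reals. intros e He.
      assert (Htz : Cmod (t * z)%C < 1).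
      { rewrite Cmod_mult, Cmod_R, Rabs_right by lra. nra. }
      destruct (H _ Htz e He) as [d [Hd H']].
      assert (Hd2 : 0 < d / (Cmod z + 1)) by (apply Rdiv_lt_0_compat; lra).
      exists (mkposreal _ Hd2). intros h Hh0 Hh. simpl in Hh.
      rewrite Rminus_0_r, <- Hm. unfold Rdiv. rewrite Rabs_mult, Rabs_inv.
      assert (Eh : (RtoC (t + h) * z - RtoC t * z)%C = (RtoC h * z)%C) by (rewrite RtoC_plus; ring).
      assert (Hha : 0 < Rabs h) by now apply Rabs_pos_lt.
      assert (Hlt : Cmod (RtoC h * z)%C < d).
      { rewrite Cmod_mult, Cmod_R. apply (Rmult_lt_compat_r (Cmod z + 1)) in Hh; [|lra].
        replace (d / (Cmod z + 1) * (Cmod z + 1)) with d in Hh by (field; lra). nra. }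
      specialize (H' (RtoC (t + h) * z)%C). rewrite Eh in H'. specialize (H' Hlt).
      replace (f (RtoC (t + h) * z)%C - f (RtoC t * z)%C - 0 * (RtoC h * z))%C with (f (RtoC (t + h) * z)%C - f (RtoC t * z)%C)%C in H' by ring.
      apply Rle_lt_trans with (e * Cmod z).
      - apply Rmult_le_reg_r with (Rabs h); [exact Hha|]. rewrite Rmult_assoc, Rinv_l, Rmult_1_r by lra.
        eapply Rle_trans; [apply Hp|]. eapply Rle_trans; [exact H'|]. rewrite Cmod_mult, Cmod_R. nra.
      - nra. }
    cbv beta in E. replace (RtoC 1 * z)%C with z in E by ring. replace (RtoC 0 * z)%C with (RtoC 0) in E by ring. now symmetry. }
  assert (E1 := K fst Rabs_Re_le (fun u v => eq_refl)).
  assert (E2 := K snd Rabs_Im_le (fun u v => eq_refl)).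
  destruct (f z), (f 0%C). simpl in *. now subst.
Qed.

Lemma cis_pow (t : R) (k : nat) : (cis 1 t ^ k)%C = cis 1 (INR k * t).
Proof.
  induction k as [|k IH].
  - simpl. unfold cis. rewrite Rmult_0_l, cos_0, sin_0. unfold RtoC. f_equal; ring.
  - rewrite S_INR. replace ((INR k + 1) * t) with (t + INR k * t) by ring.
    simpl. rewrite IH. unfold cis, Cmult; simpl. rewrite cos_plus, sin_plus. f_equal; ring.
Qed.

(* The conformal map of the disc onto the half-plane [Re (e^(-i th) w) > 0] that sends 0 to 1. *)
Definition half_plane_map (th : R) (x : C) : C := ((1 + cis 1 (2 * th) * x) / (1 - x))%C.
(** The rotation by [- th] moves the half-plane to [Re w > 0], where [clog] is analytic. Adding
    [i th] back selects the branch that vanishes at [x = 0]. *)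
Definition half_plane_log (th : R) (x : C) : C :=
  (clog (half_plane_map th x * cis 1 (- th)) + (0, th))%C.
Definition sector_map (a th : R) (x : C) : C := cexp (a * half_plane_log th x)%C.

Lemma one_minus_neq_0 (x : C) : Cmod x < 1 -> (1 - x)%C <> 0%C.
Proof.
  intros H E. replace x with (RtoC 1) in H. { rewrite Cmod_1 in H. lra. }
  replace (RtoC 1) with ((1 - x) + x)%C by ring. rewrite E. ring.
Qed.

Lemma one_plus_cis_neq_0 (t : R) (x : C) : Cmod x < 1 -> (1 + cis 1 t * x)%C <> 0%C.
Proof.
  intros H. replace (1 + cis 1 t * x)%C with (1 - (- (cis 1 t * x)))%C by ring.
  apply one_minus_neq_0. rewrite Cmod_opp, Cmod_mult, Cmod_cis; lra.
Qed.

Lemma half_plane_pos (th : R) (x : C) : - (PI / 2) < th < PI / 2 -> Cmod x < 1 ->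
  0 < fst (half_plane_map th x * cis 1 (- th))%C.
Proof.
  intros Hth Hx. assert (Hc : 0 < cos th) by (apply cos_gt_0; lra).
  pose proof (one_minus_neq_0 x Hx) as H1. unfold half_plane_map.
  set (d := (1 - x)%C) in *.
  assert (Hd : 0 < Cmod d ^ 2) by (apply pow_lt; now apply Cmod_gt_0).
  replace ((1 + cis 1 (2 * th) * x) / d * cis 1 (- th))%C
    with ((1 + cis 1 (2 * th) * x) * cis 1 (- th) * Cconj d * RtoC (/ (Cmod d ^ 2)))%C.
  2: { rewrite RtoC_inv by lra. rewrite Cmod2_conj.
       assert (Cconj d <> 0%C) by (apply Cmod_gt_0; rewrite Cmod_conj; now apply Cmod_gt_0).
       field. auto. }
  assert (E : fst ((1 + cis 1 (2 * th) * x) * cis 1 (- th) * Cconj d)%C = cos th * (1 - Cmod x * Cmod x)).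
  { rewrite Cmod_sqr. unfold d. destruct x as [p q].
    unfold Cminus; unfold cis, Cconj, Cmult, Cplus, Copp, RtoC; cbn [fst snd].
    rewrite cos_neg, sin_neg, cos_2a, sin_2a.
    pose proof (sin2_cos2 th) as Hs. unfold Rsqr in Hs.
    set (S := sin th) in *. set (K := cos th) in *.
    apply Rminus_diag_uniq.
    transitivity ((S * S + K * K - 1) * (K * p - S * q - K * (p * p + q * q))); [ring|rewrite Hs; ring]. }
  assert (R1 : forall (u : C) (r : R), fst (u * RtoC r)%C = r * fst u) by (intros; simpl; ring).
  rewrite R1.
  rewrite E. pose proof (Cmod_ge_0 x).
  apply Rmult_lt_0_compat; [now apply Rinv_0_lt_compat|]. apply Rmult_lt_0_compat; [exact Hc|nra].
Qed.

Lemma pos_slit (w : C) : 0 < fst w -> slit w.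
Proof. unfold slit. pose proof (Cmod_ge_0 w). lra. Qed.

Lemma cis_cexp (t : R) : cis 1 t = cexp (0, t).
Proof. unfold cis, cexp; cbn [fst snd]. rewrite exp_0. reflexivity. Qed.

Lemma cexp_half_plane_log (th : R) (x : C) : - (PI / 2) < th < PI / 2 -> Cmod x < 1 ->
  cexp (half_plane_log th x) = half_plane_map th x.
Proof.
  intros Hth Hx. unfold half_plane_log. rewrite cexp_plus, cexp_clog by now apply pos_slit, half_plane_pos.
  rewrite cis_cexp, <- Cmult_assoc, <- cexp_plus.
  replace ((0, (- th)%R) + (0, th))%C with (RtoC 0) by (unfold Cplus, RtoC; simpl; f_equal; ring).
  rewrite cexp_0. ring.
Qed.

Lemma cis_double_plus_1 (th : R) : (1 + cis 1 (2 * th))%C = (RtoC (2 * cos th) * cis 1 th)%C.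
Proof.
  unfold cis, Cmult, Cplus, RtoC; cbn [fst snd]. rewrite cos_2a_cos, sin_2a. f_equal; ring.
Qed.

Lemma cder_half_plane_log (th : R) (x : C) : - (PI / 2) < th < PI / 2 -> Cmod x < 1 ->
  cder (half_plane_log th) x ((1 + cis 1 (2 * th)) / ((1 - x) * (1 + cis 1 (2 * th) * x)))%C.
Proof.
  intros Hth Hx. set (c := cis 1 (2 * th)).
  pose proof (one_minus_neq_0 x Hx) as H1. pose proof (one_plus_cis_neq_0 (2 * th) x Hx) as H2. fold c in H2.
  assert (Hm : cder (half_plane_map th) x ((1 + c) / ((1 - x) * (1 - x)))%C).
  { eapply cder_eq.
    - apply (cder_div (fun x => 1 + c * x)%C (fun x => 1 - x)%C).
      + apply cder_plus; [apply cder_const|apply cder_scal, cder_id].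
      + apply cder_minus; [apply cder_const|apply cder_id].
      + exact H1.
    - field. exact H1. }
  assert (Hs : slit (half_plane_map th x * cis 1 (- th))%C) by now apply pos_slit, half_plane_pos.
  assert (Hcn : cis 1 (- th) <> 0%C) by (apply Cmod_gt_0; rewrite Cmod_cis; lra).
  unfold half_plane_log. eapply cder_eq.
  - apply cder_plus; [|apply cder_const].
    apply (cder_comp clog (fun x => half_plane_map th x * cis 1 (- th))%C).
    + apply cder_clog. exact Hs.
    + apply cder_mult; [exact Hm|apply cder_const].
  - unfold half_plane_map. fold c. field. auto.
Qed.

Lemma half_plane_log_0 (th : R) : - (PI / 2) < th < PI / 2 -> half_plane_log th 0%C = 0%C.
Proof.
  intros Hth. unfold half_plane_log, half_plane_map.
  replace ((1 + cis 1 (2 * th) * 0) / (1 - 0) * cis 1 (- th))%C with (cis 1 (- th)) by field.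
  pose proof PI_RGT_0.
  rewrite cis_cexp, clog_cexp by (simpl; apply Rabs_def1; lra).
  unfold Cplus, RtoC; simpl. f_equal; ring.
Qed.

(* For [b = a - 1] this is the derivative of [sector_map a th] divided by [a (1 + e^(2 i th))]. *)
Definition sector_der (b th : R) (x : C) : C :=
  (cexp (b * half_plane_log th x) / ((1 - x) * (1 - x)))%C.

Lemma cder_sector_map (a th : R) (x : C) : - (PI / 2) < th < PI / 2 -> Cmod x < 1 ->
  cder (sector_map a th) x (a * (1 + cis 1 (2 * th)) * sector_der (a - 1) th x)%C.
Proof.
  intros Hth Hx. pose proof (one_minus_neq_0 x Hx) as H1. pose proof (one_plus_cis_neq_0 (2 * th) x Hx) as H2.
  unfold sector_map. eapply cder_eq.
  - apply (cder_comp cexp (fun x => a * half_plane_log th x)%C); [apply cder_cexp|].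
    apply cder_scal. now apply cder_half_plane_log.
  - unfold sector_der.
    replace (a * half_plane_log th x)%C with (RtoC (a - 1) * half_plane_log th x + half_plane_log th x)%C
      by (rewrite RtoC_minus; ring).
    rewrite cexp_plus, cexp_half_plane_log by assumption. unfold half_plane_map. field. auto.
Qed.

Lemma cder_sector_der (b th : R) (x : C) : - (PI / 2) < th < PI / 2 -> Cmod x < 1 ->
  cder (sector_der b th) x (sector_der b th x *
    (b * (1 + cis 1 (2 * th)) / ((1 - x) * (1 + cis 1 (2 * th) * x)) + 2 / (1 - x)))%C.
Proof.
  intros Hth Hx. pose proof (one_minus_neq_0 x Hx) as H1. pose proof (one_plus_cis_neq_0 (2 * th) x Hx) as H2.
  unfold sector_der. eapply cder_eq.
  - apply (cder_div (fun x => cexp (b * half_plane_log th x)) (fun x => (1 - x) * (1 - x))%C).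
    + apply (cder_comp cexp (fun x => b * half_plane_log th x)%C); [apply cder_cexp|].
      apply cder_scal. now apply cder_half_plane_log.
    + apply cder_mult; (apply cder_minus; [apply cder_const|apply cder_id]).
    + now apply Cmult_neq_0.
  - cbv beta. field. auto.
Qed.

Lemma sector_der_neq_0 (b th : R) (x : C) : Cmod x < 1 -> sector_der b th x <> 0%C.
Proof.
  intros Hx. pose proof (one_minus_neq_0 x Hx). unfold sector_der, Cdiv. apply Cmult_neq_0; [apply cexp_neq_0|].
  apply Cmod_gt_0. rewrite Cmod_inv by now apply Cmult_neq_0.
  apply Rinv_0_lt_compat, Cmod_gt_0. now apply Cmult_neq_0.
Qed.

(* The recursion [n e_n = sum_(k<n) sder_weight_(n-k) e_k] for the coefficients of [sector_der] comes from
   its logarithmic derivative; the second and third components carry the convolutions of [e]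
   with the constant 1 and with the powers of [-c]. *)
Fixpoint sder_state (b : R) (c : C) (n : nat) : C * C * C :=
  match n with
  | O => (RtoC 1, RtoC 0, RtoC 0)
  | S k => let '(e, u, v) := sder_state b c k in
      let u' := (u + e)%C in let v' := (- c * (v + e))%C in
      ((((2 + b) * u' - b * v') / INR (S k))%C, u', v')
  end.
Definition sder_coef (b : R) (c : C) (n : nat) : C := fst (fst (sder_state b c n)).
Definition sder_u (b : R) (c : C) (n : nat) : C := snd (fst (sder_state b c n)).
Definition sder_v (b : R) (c : C) (n : nat) : C := snd (sder_state b c n).

Lemma sder_step (b : R) (c : C) (n : nat) :
  sder_u b c (S n) = (sder_u b c n + sder_coef b c n)%C /\
  sder_v b c (S n) = (- c * (sder_v b c n + sder_coef b c n))%C /\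
  (INR (S n) * sder_coef b c (S n) = (2 + b) * sder_u b c (S n) - b * sder_v b c (S n))%C.
Proof.
  unfold sder_u, sder_v, sder_coef. simpl sder_state.
  destruct (sder_state b c n) as [[e u] v]. cbn [fst snd].
  repeat split. change (match n with O => 1 | S _ => INR n + 1 end) with (INR (S n)).
  assert (RtoC (INR (S n)) <> 0%C) by (apply RtoC_neq_0, not_0_INR; lia).
  field. auto.
Qed.

(** For [k >= 1], the coefficient of [x^(k-1)] in the logarithmic derivative of [sector_der], by the
    partial fractions [(1 + c) / ((1 - x) (1 + c x)) = 1 / (1 - x) + c / (1 + c x)]. *)
Definition sder_weight (b : R) (c : C) (k : nat) : C := (2 + b * (1 - (- c) ^ k))%C.

Lemma sder_conv (b : R) (c : C) (n : nat) :
  (INR n * sder_coef b c n)%C = csum (fun k => sder_weight b c (n - k) * sder_coef b c k)%C n.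
Proof.
  assert (Hu : forall n, sder_u b c n = csum (sder_coef b c) n).
  { clear. induction n as [|n IH]; [reflexivity|]. destruct (sder_step b c n) as [-> _]. rewrite IH. reflexivity. }
  assert (Hv : forall n, sder_v b c n = csum (fun k => (- c) ^ (n - k) * sder_coef b c k)%C n).
  { clear. induction n as [|n IH]; [reflexivity|]. destruct (sder_step b c n) as [_ [-> _]].
    change (csum (fun k => (- c) ^ (S n - k) * sder_coef b c k)%C (S n)) with
      (csum (fun k => (- c) ^ (S n - k) * sder_coef b c k)%C n + (- c) ^ (S n - n) * sder_coef b c n)%C.
    rewrite (csum_ext _ (fun k => - c * ((- c) ^ (n - k) * sder_coef b c k))%C).
    - rewrite csum_scal, IH. replace (S n - n)%nat with 1%nat by lia. simpl Cpow. ring.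
    - intros k Hk. replace (S n - k)%nat with (S (n - k)) by lia. simpl Cpow. ring. }
  destruct n as [|n]; [simpl; ring|].
  destruct (sder_step b c n) as [_ [_ ->]]. rewrite Hu, Hv.
  rewrite (csum_ext (fun k => sder_weight b c (S n - k) * sder_coef b c k)%C
    (fun k => (2 + b) * sder_coef b c k + (- b) * ((- c) ^ (S n - k) * sder_coef b c k))%C) by (intros; unfold sder_weight; ring).
  assert (G : forall (f g : nat -> C) x y m, csum (fun k => x * f k + y * g k)%C m = (x * csum f m + y * csum g m)%C).
  { clear. intros f g x y. induction m as [|m IH]; simpl; [ring|]. rewrite IH. ring. }
  rewrite G. ring.
Qed.

Lemma Cmod_sder_weight_le (b : R) (c : C) (k : nat) : 0 <= b -> Cmod c = 1 -> Cmod (sder_weight b c k) <= 2 + 2 * b.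
Proof.
  intros Hb Hc. unfold sder_weight.
  assert (Hp : Cmod ((- c) ^ k)%C = 1) by (rewrite Cmod_pow, Cmod_opp, Hc; apply pow1).
  replace (2 + b * (1 - (- c) ^ k))%C with (RtoC (2 + b) + - (RtoC b * (- c) ^ k))%C by (rewrite RtoC_plus; ring).
  eapply Rle_trans; [apply Cmod_triangle|].
  rewrite Cmod_opp, Cmod_mult, Hp, !Cmod_R, !Rabs_right; lra.
Qed.

Lemma sder_rec_le (b : R) (c : C) (n : nat) :
  INR n * Cmod (sder_coef b c n) <= rsum (fun k => Cmod (sder_weight b c (n - k)) * Cmod (sder_coef b c k)) n.
Proof.
  rewrite <- (Rabs_right (INR n)) at 1 by apply Rle_ge, pos_INR.
  rewrite <- Cmod_R, <- Cmod_mult, sder_conv.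
  eapply Rle_trans; [apply Cmod_csum|]. apply rsum_le. intros k _. rewrite Cmod_mult. lra.
Qed.

(** All weights have modulus at most 4, so [n |e_n| <= 4 sum_(k<n) |e_k|], and the sum of cubes
    [1 + 8 + ... + n^3 = n^2 (n + 1)^2 / 4] closes the induction. *)
Lemma sder_coef_bound (b : R) (c : C) (n : nat) : 0 <= b <= 1 -> Cmod c = 1 ->
  Cmod (sder_coef b c n) <= INR (S n) * INR (S n) * INR (S n).
Proof.
  intros Hb Hc.
  assert (K : forall n, rsum (fun k => Cmod (sder_coef b c k)) n <= INR n * INR (S n) * (INR n * INR (S n)) / 4 /\
     Cmod (sder_coef b c n) <= INR (S n) * INR (S n) * INR (S n)).
  { clear n. induction n as [|n [IH1 IH2]].
    - split; [simpl; lra|]. unfold sder_coef; simpl. rewrite Cmod_1. lra.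
    - assert (Hs : rsum (fun k => Cmod (sder_coef b c k)) (S n) <= INR (S n) * INR (S (S n)) * (INR (S n) * INR (S (S n))) / 4).
      { change (rsum (fun k => Cmod (sder_coef b c k)) (S n)) with
          (rsum (fun k => Cmod (sder_coef b c k)) n + Cmod (sder_coef b c n)).
        rewrite !S_INR in *. pose proof (pos_INR n). nra. }
      split; [exact Hs|].
      pose proof (sder_rec_le b c (S n)) as Hr.
      assert (Hr2 : rsum (fun k => Cmod (sder_weight b c (S n - k)) * Cmod (sder_coef b c k)) (S n) <=
         4 * rsum (fun k => Cmod (sder_coef b c k)) (S n)).
      { rewrite <- rsum_scal. apply rsum_le. intros k _. apply Rmult_le_compat_r; [apply Cmod_ge_0|].
        pose proof (Cmod_sder_weight_le b c (S n - k) ltac:(lra) Hc). lra. }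
      assert (Hn : 0 < INR (S n)) by (apply lt_0_INR; lia).
      apply Rmult_le_reg_l with (INR (S n)); [exact Hn|].
      rewrite (S_INR (S n)) in *. nra. }
  apply K.
Qed.

Lemma root_below_1 (rho : R) : 0 < rho < 1 -> exists t, 0 < t < 1 /\ rho <= t * t * t.
Proof.
  intros H. exists (1 - (1 - rho) / 3). split; [lra|].
  set (x := (1 - rho) / 3). assert (0 < x < 1 / 3) by (unfold x; lra).
  replace rho with (1 - 3 * x) by (unfold x; field). nra.
Qed.

(** With [rho <= t^3] each of the three factors [n + 1] has its own power of [t] to absorb it. *)
Lemma subexponential_cubic (a : nat -> C) (M : R) :
  (forall n, Cmod (a n) <= M * (INR (S n) * INR (S n) * INR (S n))) -> subexponential a.
Proof.
  intros H rho Hr. destruct (root_below_1 rho Hr) as [t [Ht Hrt]].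
  assert (HM : 0 <= M).
  { specialize (H 0%nat). simpl in H. pose proof (Cmod_ge_0 (a 0%nat)). lra. }
  set (q := / (1 - t)). assert (Hq : 0 < q) by (apply Rinv_0_lt_compat; lra).
  exists (M * (q * q * q) / (t * t * t)). intros n.
  assert (P3 : 0 < t * t * t) by (repeat apply Rmult_lt_0_compat; lra).
  apply Rmult_le_reg_r with (t * t * t); [exact P3|].
  replace (M * (q * q * q) / (t * t * t) * (t * t * t)) with (M * (q * q * q)) by (field; lra).
  assert (Hp : rho ^ n <= (t * t * t) ^ n) by (apply pow_incr; lra).
  apply Rle_trans with (M * (INR (S n) * INR (S n) * INR (S n)) * (t * t * t) ^ n * (t * t * t)).
  - apply Rmult_le_compat_r; [lra|]. apply Rmult_le_compat; [apply Cmod_ge_0|apply pow_le; lra|apply H|exact Hp].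
  - replace (M * (INR (S n) * INR (S n) * INR (S n)) * (t * t * t) ^ n * (t * t * t)) with
      (M * ((INR (S n) * t ^ S n) * (INR (S n) * t ^ S n) * (INR (S n) * t ^ S n))).
    2: { rewrite !Rpow_mult_distr. simpl. ring. }
    apply Rmult_le_compat_l; [exact HM|].
    pose proof (INR_pow_bound t (S n) Ht) as Hb. fold q in Hb.
    assert (0 <= INR (S n) * t ^ S n) by (apply Rmult_le_pos; [apply pos_INR|apply pow_le; lra]).
    repeat apply Rmult_le_compat; auto; apply Rmult_le_pos; auto.
Qed.

(** Elimination of the two convolutions. This is the coefficient form of the differential equation
    [(1 - x) (1 + c x) E' = (2 + b (1 + c) + 2 c x) E]. *)
Lemma sder_three_term (b : R) (c : C) (n : nat) :
  (INR (S (S n)) * sder_coef b c (S (S n)) + (c - 1) * (INR (S n) * sder_coef b c (S n))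
    - c * (INR n * sder_coef b c n)
   = (2 + b * (1 + c)) * sder_coef b c (S n) + 2 * c * sder_coef b c n)%C.
Proof.
  destruct (sder_step b c n) as [U1 [V1 E1]]. destruct (sder_step b c (S n)) as [U2 [V2 E2]].
  rewrite E2, U2, V2, E1, U1, V1.
  destruct n as [|n].
  - unfold sder_u, sder_v; simpl. ring.
  - destruct (sder_step b c n) as [U0 [V0 E0]]. rewrite E0. ring.
Qed.

(** The sum [E] of the series exists by the cubic bound and satisfies the same first order linear
    equation as [sector_der]; so their quotient has zero derivative, and it is 1 at the origin. *)
Lemma pser_sector_der (b th : R) : 0 <= b <= 1 -> - (PI / 2) < th < PI / 2 ->
  pser (sder_coef b (cis 1 (2 * th))) (sector_der b th).
Proof.
  intros Hb Hth. set (c := cis 1 (2 * th)).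
  assert (Hc : Cmod c = 1) by (apply Cmod_cis; lra).
  destruct (pser_exists (sder_coef b c)) as [E HE].
  { apply subexponential_cubic with 1. intros n. rewrite Rmult_1_l. now apply sder_coef_bound. }
  destruct (pser_deriv _ _ HE) as [E' [HE' HD]].
  assert (ODE : forall x, Cmod x < 1 -> ((1 - x) * (1 + c * x) * E' x = (2 + b * (1 + c) + 2 * c * x) * E x)%C).
  { intros x Hx.
    pose proof (pser_shift _ _ HE') as S1. pose proof (pser_shift _ _ S1) as S2. pose proof (pser_shift _ _ HE) as S3.
    pose proof (pser_lin _ _ _ _ 1 (c - 1)%C HE' S1) as L1.
    pose proof (pser_lin _ _ _ _ 1 (- c)%C L1 S2) as L2.
    pose proof (pser_lin _ _ _ _ (- (2 + b * (1 + c)))%C (- (2 * c))%C HE S3) as L3.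
    pose proof (pser_lin _ _ _ _ 1 1 L2 L3) as L4.
    pose proof (fun Hz => pser_zero _ _ L4 Hz x Hx) as Z. cbv beta in Z.
    apply Cminus_eq_0.
    replace ((1 - x) * (1 + c * x) * E' x - (2 + b * (1 + c) + 2 * c * x) * E x)%C with
      (1 * (1 * (1 * E' x + (c - 1) * (x * E' x)) + - c * (x * (x * E' x))) +
       1 * (- (2 + b * (1 + c)) * E x + - (2 * c) * (x * E x)))%C by ring.
    apply Z. intros [|[|k]]; cbn [shift_coef].
    - destruct (sder_step b c 0) as [U1 [V1 E1]]. rewrite E1, U1, V1. unfold sder_u, sder_v, sder_coef; simpl. ring.
    - pose proof (sder_three_term b c 0) as T.
      replace (INR 2 * sder_coef b c 2)%C with
        ((2 + b * (1 + c)) * sder_coef b c 1 + 2 * c * sder_coef b c 0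
         - (c - 1) * (INR 1 * sder_coef b c 1) + c * (INR 0 * sder_coef b c 0))%C by (rewrite <- T; ring).
      change (INR 0) with 0. ring.
    - pose proof (sder_three_term b c (S k)) as T.
      replace (INR (S (S (S k))) * sder_coef b c (S (S (S k))))%C with
        ((2 + b * (1 + c)) * sder_coef b c (S (S k)) + 2 * c * sder_coef b c (S k)
         - (c - 1) * (INR (S (S k)) * sder_coef b c (S (S k))) + c * (INR (S k) * sder_coef b c (S k)))%C by (rewrite <- T; ring).
      ring. }
  apply (pser_ext _ _ E _ (fun k => eq_refl)); [|exact HE].
  intros z Hz.
  assert (Q : (E z / sector_der b th z)%C = (E 0 / sector_der b th 0)%C).
  { apply (cder_zero_const (fun x => E x / sector_der b th x)%C); [|exact Hz].
    intros x Hx. pose proof (one_minus_neq_0 x Hx) as H1. pose proof (one_plus_cis_neq_0 (2 * th) x Hx) as H2. fold c in H2.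
    pose proof (sector_der_neq_0 b th x Hx) as H3.
    eapply cder_eq.
    - apply cder_div; [apply HD, Hx|apply cder_sector_der; assumption|exact H3].
    - cbv beta. fold c.
      assert (EE : E' x = ((2 + b * (1 + c) + 2 * c * x) * E x / ((1 - x) * (1 + c * x)))%C).
      { rewrite <- ODE by exact Hx. field. auto. }
      rewrite EE. field. auto. }
  pose proof (sector_der_neq_0 b th z Hz) as H3.
  assert (Q0 : (E 0 / sector_der b th 0)%C = 1%C).
  { rewrite (pser_at_0 _ _ HE). unfold sector_der. rewrite half_plane_log_0 by exact Hth.
    replace (b * 0)%C with (RtoC 0) by ring. rewrite cexp_0. unfold sder_coef; simpl. field. }
  rewrite Q0 in Q. replace (E z) with (E z / sector_der b th z * sector_der b th z)%C by (field; exact H3).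
  rewrite Q. ring.
Qed.

(** Termwise integral of [a (1 + c)] times [sector_der] for [b = a - 1], with constant term 1. *)
Definition sector_coef (a : R) (c : C) (n : nat) : C :=
  match n with
  | O => RtoC 1
  | S k => (a * (1 + c) * sder_coef (a - 1) c k / INR (S k))%C
  end.

Lemma pser_sector_map (a th : R) : 1 <= a <= 2 -> - (PI / 2) < th < PI / 2 ->
  pser (sector_coef a (cis 1 (2 * th))) (sector_map a th).
Proof.
  intros Ha Hth. set (c := cis 1 (2 * th)).
  assert (Hc : Cmod c = 1) by (apply Cmod_cis; lra).
  assert (HN : forall n, RtoC (INR (S n)) <> 0%C) by (intros; apply RtoC_neq_0, not_0_INR; lia).
  destruct (pser_exists (sector_coef a c)) as [Y HY].
  { apply subexponential_cubic with 4. intros [|n].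
    - simpl. rewrite Cmod_1. lra.
    - unfold sector_coef. rewrite Cmod_div by apply HN. rewrite !Cmod_mult, !Cmod_R, Rabs_right by lra.
      rewrite (Rabs_right (INR (S n))) by (apply Rle_ge, pos_INR).
      assert (H2 : Cmod (1 + c)%C <= 2).
      { eapply Rle_trans; [apply Cmod_triangle|]. rewrite Cmod_1, Hc. lra. }
      pose proof (sder_coef_bound (a - 1) c n ltac:(lra) Hc) as HB.
      assert (Hn : 1 <= INR (S n)) by (rewrite S_INR; pose proof (pos_INR n); lra).
      apply Rmult_le_reg_r with (INR (S n)); [lra|]. unfold Rdiv. rewrite Rmult_assoc, Rinv_l, Rmult_1_r by lra.
      pose proof (Cmod_ge_0 (1 + c)%C). pose proof (Cmod_ge_0 (sder_coef (a - 1) c n)).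
      apply Rle_trans with (4 * (INR (S n) * INR (S n) * INR (S n))).
      + apply Rmult_le_compat; auto; [nra|nra].
      + rewrite (S_INR (S n)). set (m := INR (S n)) in *.
        assert (0 <= m * m * m) by (repeat apply Rmult_le_pos; lra).
        assert (m * m * m <= (m + 1) * (m + 1) * (m + 1)) by nra. nra. }
  destruct (pser_deriv _ _ HY) as [Y' [HY' HD]].
  apply (pser_ext _ _ Y _ (fun k => eq_refl)); [|exact HY].
  assert (HE := pser_sector_der (a - 1) th ltac:(lra) Hth). fold c in HE.
  assert (EY : forall x, Cmod x < 1 -> Y' x = (a * (1 + c) * sector_der (a - 1) th x)%C).
  { intros x Hx. apply (C_series_unique _ _ _ (HY' x Hx)).
    pose proof (pser_lin _ _ _ _ (a * (1 + c))%C 0%C HE HE x Hx) as L. cbv beta in L.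
    eapply C_series_ext; [|replace (a * (1 + c) * sector_der (a - 1) th x)%C with
      (a * (1 + c) * sector_der (a - 1) th x + 0 * sector_der (a - 1) th x)%C by ring; exact L].
    intros k. cbv beta. unfold sector_coef. field. apply HN. }
  intros z Hz.
  assert (Q : (Y z - sector_map a th z)%C = (Y 0 - sector_map a th 0)%C).
  { apply (cder_zero_const (fun x => Y x - sector_map a th x)%C); [|exact Hz].
    intros x Hx. eapply cder_eq; [apply cder_minus; [apply HD, Hx|now apply cder_sector_map]|].
    fold c. rewrite EY by exact Hx. ring. }
  assert (Q0 : (Y 0 - sector_map a th 0)%C = 0%C).
  { rewrite (pser_at_0 _ _ HY). unfold sector_map. rewrite half_plane_log_0 by exact Hth.
    replace (a * 0)%C with (RtoC 0) by ring. rewrite cexp_0. simpl. ring. }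
  rewrite Q0 in Q. replace (Y z) with ((Y z - sector_map a th z) + sector_map a th z)%C by ring.
  rewrite Q. ring.
Qed.

(** * The majorant series of a sector map *)

Lemma rsum_triangle (F : nat -> nat -> R) (N : nat) :
  rsum (fun n => rsum (fun k => F n k) (S n)) N
  = rsum (fun k => rsum (fun i => F (k + i)%nat k) (N - k)) N.
Proof.
  induction N as [|N IH]; [reflexivity|].
  change (rsum (fun n => rsum (fun k => F n k) (S n)) (S N)) with
    (rsum (fun n => rsum (fun k => F n k) (S n)) N + (rsum (fun k => F N k) N + F N N)).
  rewrite IH.
  change (rsum (fun k => rsum (fun i => F (k + i)%nat k) (S N - k)) (S N)) with
    (rsum (fun k => rsum (fun i => F (k + i)%nat k) (S N - k)) N + rsum (fun i => F (N + i)%nat N) (S N - N)).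
  replace (S N - N)%nat with 1%nat by lia.
  rewrite (rsum_ext (fun k => rsum (fun i => F (k + i)%nat k) (S N - k))
     (fun k => rsum (fun i => F (k + i)%nat k) (N - k) + F N k)).
  - rewrite (rsum_plus _ (fun k => F N k)).
    change (rsum (fun i => F (N + i)%nat N) 1) with (0 + F (N + 0)%nat N). rewrite Nat.add_0_r. ring.
  - intros k Hk. replace (S N - k)%nat with (S (N - k)) by lia. simpl.
    f_equal. f_equal. lia.
Qed.

Lemma rsum_mono (f : nat -> R) (n m : nat) :
  (forall k, 0 <= f k) -> (n <= m)%nat -> rsum f n <= rsum f m.
Proof.
  intros H L. induction L as [|m L IH]; [lra|]. simpl. pose proof (H m). lra.
Qed.

Lemma sin_mult_bound (x : R) (k : nat) : Rabs (sin (INR k * x)) <= INR k * Rabs (sin x).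
Proof.
  induction k as [|k IH]; [simpl; rewrite Rmult_0_l, sin_0, Rabs_R0; lra|].
  rewrite S_INR. replace ((INR k + 1) * x) with (INR k * x + x) by ring. rewrite sin_plus.
  eapply Rle_trans; [apply Rabs_triang|]. rewrite !Rabs_mult.
  pose proof (COS_bound x) as [C1 C2]. pose proof (COS_bound (INR k * x)) as [C3 C4].
  assert (Rabs (cos x) <= 1) by (apply Rabs_le; lra).
  assert (Rabs (cos (INR k * x)) <= 1) by (apply Rabs_le; lra).
  pose proof (Rabs_pos (sin x)). pose proof (Rabs_pos (sin (INR k * x))). nra.
Qed.

Lemma Cmod_le_sqr (z : C) (M : R) : 0 <= M -> fst z * fst z + snd z * snd z <= M * M -> Cmod z <= M.
Proof.
  intros HM H. apply Rsqr_incr_0_var; [|exact HM]. unfold Rsqr. rewrite Cmod_sqr. exact H.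
Qed.

(** With [k = 2 j] and [S = sin^2 (k th)] the square of the modulus is
    [4 + 8 b S + 4 b^2 S <= (2 + 3 b S)^2], and [S <= k^2 sin^2 th = 4 j^2 sin^2 th] gives the
    constant 12. *)
Lemma sder_weight_even_bound (b th : R) (j : nat) : 0 <= b <= 1 ->
  Cmod (sder_weight b (cis 1 (2 * th)) (2 * j)) <= 2 + 12 * b * (INR j * INR j) * (sin th * sin th).
Proof.
  intros Hb. set (k := (2 * j)%nat).
  assert (Ek : ((- cis 1 (2 * th)) ^ k)%C = cis 1 (2 * (INR k * th))).
  { unfold k. rewrite Cpow_mult_r. replace ((- cis 1 (2 * th)) ^ 2)%C with (cis 1 (2 * th) ^ 2)%C by (simpl; ring).
    rewrite <- Cpow_mult_r, cis_pow. f_equal. ring. }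
  unfold sder_weight. rewrite Ek. set (x := INR k * th).
  pose proof (sin_mult_bound th k) as Hs. fold x in Hs.
  set (S := sin x * sin x).
  assert (HS0 : 0 <= S) by (unfold S; nra).
  assert (HS1 : S <= 1) by (unfold S; pose proof (SIN_bound x); nra).
  assert (HSk : S <= 4 * (INR j * INR j) * (sin th * sin th)).
  { assert (S <= (INR k * Rabs (sin th)) * (INR k * Rabs (sin th))).
    { unfold S. rewrite <- (Rabs_right (sin x * sin x)) by nra. rewrite Rabs_mult.
      pose proof (Rabs_pos (sin x)). apply Rmult_le_compat; auto. }
    assert (Rabs (sin th) * Rabs (sin th) = sin th * sin th) by (rewrite <- Rabs_mult; apply Rabs_right; nra).
    unfold k in *. rewrite mult_INR in H. simpl (INR 2) in H. nra. }
  apply Rle_trans with (2 + 3 * b * S).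
  2: { assert (b * S <= b * (4 * (INR j * INR j) * (sin th * sin th))) by (apply Rmult_le_compat_l; lra). lra. }
  apply Cmod_le_sqr; [nra|].
  unfold cis, Cminus, Cmult, Cplus, Copp, RtoC; cbn [fst snd].
  rewrite cos_2a_sin, sin_2a.
  pose proof (sin2_cos2 x) as Hsc. unfold Rsqr in Hsc.
  assert (HC : cos x * cos x = 1 - S) by (unfold S; lra).
  replace (2 + (b * (1 + - (1 * (1 - 2 * sin x * sin x))) - 0 * (0 + - (1 * (2 * sin x * cos x))))) with (2 + 2 * b * S) by (unfold S; ring).
  match goal with |- _ + ?q * ?q <= _ => replace (q * q) with (4 * (b * b) * S * (1 - S)) end.
  2: { rewrite <- HC. unfold S. ring. }
  assert (b * b <= b) by nra. nra.
Qed.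

(** With [S = sin^2 th] the square of the modulus is [(2 + 2 b)^2 - 4 b (2 + b) S]. For [b = 1] this
    is [16 - 12 S], whose square root has slope [-3/2] at [S = 0]. *)
Lemma sder_weight_1_bound (b th : R) : 0 <= b <= 1 ->
  Cmod (sder_weight b (cis 1 (2 * th)) 1) <= 2 + 2 * b - 3 / 2 * b * (sin th * sin th).
Proof.
  intros Hb. pose proof (sin2_cos2 th) as Hsc. unfold Rsqr in Hsc.
  set (S := sin th * sin th) in *.
  assert (HS0 : 0 <= S) by (unfold S; nra).
  assert (HS1 : S <= 1) by nra.
  apply Cmod_le_sqr; [nra|].
  unfold sder_weight, cis, Cminus, Cmult, Cplus, Copp, RtoC, Cpow; cbn [fst snd].
  rewrite cos_2a_cos, sin_2a.
  match goal with |- ?p * ?p + ?q * ?q <= _ =>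
    replace (p * p) with ((2 + 2 * b * (1 - S)) * (2 + 2 * b * (1 - S)));
    [replace (q * q) with (4 * (b * b) * S * (1 - S))|] end.
  - assert (0 <= (b - b * b) * S) by (apply Rmult_le_pos; [nra|exact HS0]).
    assert (0 <= b * b * (S * S)) by (apply Rmult_le_pos; apply Rle_0_sqr). nra.
  - replace (1 - S) with (cos th * cos th) by lra. unfold S, Cmult; simpl. ring.
  - replace (1 - S) with (cos th * cos th) by lra. unfold Cmult; simpl. ring.
Qed.

(* For even [k], [|sder_weight_k|] exceeds its value at [th = 0] by [O(sin^2 th)]; the last summand of the
   bound shows how much of this is absorbed by [sder_weight_1], which is smaller than its value at [th = 0]. *)
Lemma sder_weight_sum_bound (b th x : R) (J : nat) : 0 <= b <= 1 -> 0 <= x <= 1 / 3 ->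
  rsum (fun i => Cmod (sder_weight b (cis 1 (2 * th)) (S i)) * x ^ i) (2 * (J + 2))
  <= (2 + b) / (1 - x) + b / (1 + x) + b * (sin th * sin th) * (12 * x + 64 * x ^ 3 - 3 / 2).
Proof.
  intros Hb Hx. set (sg := sin th * sin th). set (c := cis 1 (2 * th)).
  assert (Hc : Cmod c = 1) by (apply Cmod_cis; lra).
  assert (Hsg : 0 <= sg) by apply Rle_0_sqr.
  assert (Hbs : 0 <= b * sg) by nra.
  set (f := fun i => Cmod (sder_weight b c (S i)) * x ^ i).
  (* The last term is a reserve that pays for the even weights still to come. The coefficient 64 is
     48, from the weight of index 4, plus the initial reserve 16. The step needs
     [16 (J + 3)^2 x^2 <= 4 (J + 2)^2], which for [x <= 1/3] is [2 (J + 3) <= 3 (J + 2)]. *)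
  assert (K : rsum f (2 * (J + 2)) <=
     (2 + b) * (1 - x ^ (2 * (J + 2))) / (1 - x) + b * (1 - x ^ (2 * (J + 2))) / (1 + x)
     + b * sg * (12 * x + 64 * x ^ 3 - 3 / 2 - 4 * (INR (J + 2) * INR (J + 2)) * x ^ (2 * J + 3))).
  { induction J as [|J IH].
    - change (rsum f (2 * (0 + 2))) with (0 + f 0%nat + f 1%nat + f 2%nat + f 3%nat).
      assert (F0 : f 0%nat <= 2 + 2 * b - 3 / 2 * b * sg).
      { unfold f. simpl pow. rewrite Rmult_1_r. now apply sder_weight_1_bound. }
      assert (F1 : f 1%nat <= (2 + 12 * b * sg) * x).
      { unfold f. rewrite pow_1. apply Rmult_le_compat_r; [lra|].
        pose proof (sder_weight_even_bound b th 1 Hb) as H. simpl in H. fold c sg in H. simpl in *. lra. }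
      assert (F2 : f 2%nat <= (2 + 2 * b) * x ^ 2).
      { unfold f. apply Rmult_le_compat_r; [nra|]. apply Cmod_sder_weight_le; [lra|exact Hc]. }
      assert (F3 : f 3%nat <= (2 + 48 * b * sg) * x ^ 3).
      { unfold f. apply Rmult_le_compat_r; [apply pow_le; lra|].
        pose proof (sder_weight_even_bound b th 2 Hb) as H. simpl Nat.mul in H. simpl INR in H. fold c sg in H. lra. }
      change (2 * (0 + 2))%nat with 4%nat. change (2 * 0 + 3)%nat with 3%nat. change (INR (0 + 2)) with (1 + 1).
      assert (E : (2 + b) * (1 - x ^ 4) / (1 - x) + b * (1 - x ^ 4) / (1 + x) = 2 + 2 * b + 2 * x + (2 + 2 * b) * x ^ 2 + 2 * x ^ 3).
      { field. lra. }
      rewrite E. nra.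
    - replace (2 * (S J + 2))%nat with (S (S (2 * (J + 2)))) by lia.
      change (rsum f (S (S (2 * (J + 2))))) with (rsum f (2 * (J + 2)) + f (2 * (J + 2))%nat + f (S (2 * (J + 2)))).
      assert (F2 : f (2 * (J + 2))%nat <= (2 + 2 * b) * x ^ (2 * (J + 2))).
      { unfold f. apply Rmult_le_compat_r; [apply pow_le; lra|]. apply Cmod_sder_weight_le; [lra|exact Hc]. }
      assert (F3 : f (S (2 * (J + 2))) <= (2 + 12 * b * (INR (J + 3) * INR (J + 3)) * sg) * x ^ (S (2 * (J + 2)))).
      { unfold f. apply Rmult_le_compat_r; [apply pow_le; lra|].
        pose proof (sder_weight_even_bound b th (J + 3) Hb) as H. fold c sg in H.
        replace (S (S (2 * (J + 2)))) with (2 * (J + 3))%nat by lia. exact H. }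
      replace (2 * (J + 2))%nat with (S (2 * J + 3)) in * by lia.
      replace (2 * S J + 3)%nat with (S (S (2 * J + 3))) by lia. replace (S J + 2)%nat with (J + 3)%nat by lia.
      set (y := x ^ (2 * J + 3)) in *.
      assert (Hy : 0 <= y) by (apply pow_le; lra).
      change (x ^ S (S (S (2 * J + 3)))) with (x * (x * (x * y))).
      change (x ^ S (S (2 * J + 3))) with (x * (x * y)) in *. change (x ^ S (2 * J + 3)) with (x * y) in *.
      assert (Hm : 4 * (INR (J + 3) * INR (J + 3)) * (x * x) <= INR (J + 2) * INR (J + 2)).
      { replace (INR (J + 3)) with (INR J + 3) by (rewrite plus_INR; simpl; ring).
        replace (INR (J + 2)) with (INR J + 2) by (rewrite plus_INR; simpl; ring).
        pose proof (pos_INR J). assert (x * x <= 1 / 9) by nra.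
        assert (4 * ((INR J + 3) * (INR J + 3)) * (x * x) <= 4 * ((INR J + 3) * (INR J + 3)) * (1 / 9)) by (apply Rmult_le_compat_l; nra).
        nra. }
      assert (Hm2 : b * sg * (16 * (INR (J + 3) * INR (J + 3)) * (x * (x * y))) <= b * sg * (4 * (INR (J + 2) * INR (J + 2)) * y)).
      { apply Rmult_le_compat_l; [exact Hbs|].
        replace (16 * (INR (J + 3) * INR (J + 3)) * (x * (x * y))) with (4 * (4 * (INR (J + 3) * INR (J + 3)) * (x * x)) * y) by ring.
        apply Rmult_le_compat_r; [exact Hy|]. lra. }
      assert (E : (2 + b) * (1 - x * (x * (x * y))) / (1 - x) + b * (1 - x * (x * (x * y))) / (1 + x)
        = (2 + b) * (1 - x * y) / (1 - x) + b * (1 - x * y) / (1 + x) + (2 + 2 * b) * (x * y) + 2 * (x * (x * y))).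
      { field. lra. }
      rewrite E. lra. }
  eapply Rle_trans; [exact K|].
  assert (P1 : 0 <= x ^ (2 * (J + 2))) by (apply pow_le; lra).
  assert (P2 : 0 <= x ^ (2 * J + 3)) by (apply pow_le; lra).
  assert (I1 : 0 < / (1 - x)) by (apply Rinv_0_lt_compat; lra).
  assert (I2 : 0 < / (1 + x)) by (apply Rinv_0_lt_compat; lra).
  unfold Rdiv.
  assert (A1 : (2 + b) * (1 - x ^ (2 * (J + 2))) * / (1 - x) <= (2 + b) * / (1 - x)) by (apply Rmult_le_compat_r; nra).
  assert (A2 : b * (1 - x ^ (2 * (J + 2))) * / (1 + x) <= b * / (1 + x)) by (apply Rmult_le_compat_r; nra).
  assert (A3 : b * sg * (12 * x + 64 * x ^ 3 - 3 / 2 - 4 * (INR (J + 2) * INR (J + 2)) * x ^ (2 * J + 3)) <= b * sg * (12 * x + 64 * x ^ 3 - 3 / 2)).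
  { apply Rmult_le_compat_l; [exact Hbs|]. pose proof (pos_INR (J + 2)).
    assert (0 <= INR (J + 2) * INR (J + 2) * x ^ (2 * J + 3)) by (apply Rmult_le_pos; nra). lra. }
  unfold Rdiv in A3. lra.
Qed.

Lemma rsum_deriv (e : nat -> R) (N : nat) (x : R) :
  derivable_pt_lim (fun x => rsum (fun n => e n * x ^ n) (S N)) x
    (rsum (fun n => INR (S n) * e (S n) * x ^ n) N).
Proof.
  induction N as [|N IH].
  - simpl. apply derivable_pt_lim_ext with (fun _ => e 0%nat).
    + intros; ring.
    + apply derivable_pt_lim_const.
  - apply derivable_pt_lim_ext with (fun x => rsum (fun n => e n * x ^ n) (S N) + e (S N) * x ^ S N).
    { intros; reflexivity. }
    change (rsum (fun n => INR (S n) * e (S n) * x ^ n) (S N)) with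
      (rsum (fun n => INR (S n) * e (S n) * x ^ n) N + INR (S N) * e (S N) * x ^ N).
    apply derivable_pt_lim_plus; [exact IH|].
    replace (INR (S N) * e (S N) * x ^ N) with (e (S N) * (INR (S N) * x ^ pred (S N))) by (simpl pred; ring).
    apply (derivable_pt_lim_scal (fun x => x ^ S N)). apply derivable_pt_lim_pow.
Qed.

Lemma decreasing_from_0 (f f' : R -> R) (r : R) : 0 <= r ->
  (forall x, 0 <= x <= r -> derivable_pt_lim f x (f' x)) ->
  (forall x, 0 <= x <= r -> f' x <= 0) -> f r <= f 0.
Proof.
  intros Hr Hd Hs. destruct (Req_dec r 0) as [->|Hn]; [lra|].
  destruct (MVT_cor2 f f' 0 r) as [c [E Hc]]; [lra|exact Hd|].
  specialize (Hs c ltac:(lra)). nra.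
Qed.

(** The antiderivative, vanishing at 0, of the bound in [sder_weight_sum_bound]. For [sg = 0] its
    exponential is [(1 + x)^b / (1 - x)^(b+2)], the value of [sector_der b 0] at [x]. *)
Definition sder_log (b sg x : R) : R :=
  b * ln (1 + x) - (b + 2) * ln (1 - x) + b * sg * (6 * x ^ 2 + 16 * x ^ 4 - 3 / 2 * x).

Lemma sder_log_deriv (b sg x : R) : 0 <= x <= 1 / 3 ->
  derivable_pt_lim (sder_log b sg) x
    ((2 + b) / (1 - x) + b / (1 + x) + b * sg * (12 * x + 64 * x ^ 3 - 3 / 2)).
Proof.
  intros Hx. apply is_derive_Reals. unfold sder_log. auto_derive; [lra|]. field. lra.
Qed.

(** Gronwall's inequality for the partial sums [Sf]: after exchanging the summations the recursion
    reads [S' <= L' Sf], where [L'] is the derivative of [sder_log]. Hence [Sf exp (- sder_log)]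
    decreases from its value 1 at the origin. *)
Lemma sder_majorant (b th x : R) (N : nat) : 0 <= b <= 1 -> 0 <= x <= 1 / 3 ->
  rsum (fun n => Cmod (sder_coef b (cis 1 (2 * th)) n) * x ^ n) N <= exp (sder_log b (sin th * sin th) x).
Proof.
  intros Hb Hx. set (c := cis 1 (2 * th)). set (sg := sin th * sin th).
  set (e := fun n => Cmod (sder_coef b c n)).
  assert (He : forall n, 0 <= e n) by (intros; apply Cmod_ge_0).
  assert (HeN : forall m y, 0 <= y -> 0 <= rsum (fun n => e n * y ^ n) m).
  { intros m y Hy. apply rsum_ge_0. intros k _. apply Rmult_le_pos; [apply He|now apply pow_le]. }
  destruct N as [|N]; [simpl; left; apply exp_pos|].
  set (Sf := fun x => rsum (fun n => e n * x ^ n) (S N)).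
  set (S' := fun x => rsum (fun n => INR (S n) * e (S n) * x ^ n) N).
  set (L' := fun x => (2 + b) / (1 - x) + b / (1 + x) + b * sg * (12 * x + 64 * x ^ 3 - 3 / 2)).
  assert (HS : forall y, 0 <= y <= 1 / 3 -> S' y <= L' y * Sf y).
  { intros y Hy. unfold S'.
    apply Rle_trans with (rsum (fun n => rsum (fun k => Cmod (sder_weight b c (S n - k)) * e k * y ^ n) (S n)) N).
    - apply rsum_le. intros n _. pose proof (sder_rec_le b c (S n)) as Hr. fold (e (S n)) in Hr.
      apply Rle_trans with (y ^ n * rsum (fun k => Cmod (sder_weight b c (S n - k)) * e k) (S n)).
      + rewrite Rmult_comm. apply Rmult_le_compat_l; [apply pow_le; lra|exact Hr].
      + rewrite <- rsum_scal. right. apply rsum_ext. intros. ring.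
    - rewrite (rsum_triangle (fun n k => Cmod (sder_weight b c (S n - k)) * e k * y ^ n)).
      apply Rle_trans with (rsum (fun k => L' y * (e k * y ^ k)) N).
      + apply rsum_le. intros k Hk.
        rewrite (rsum_ext _ (fun i => (e k * y ^ k) * (Cmod (sder_weight b c (S i)) * y ^ i))).
        * rewrite rsum_scal, Rmult_comm. apply Rmult_le_compat_r.
          { apply Rmult_le_pos; [apply He|apply pow_le; lra]. }
          eapply Rle_trans; [|apply (sder_weight_sum_bound b th y N Hb Hy)].
          apply rsum_mono; [|lia]. intros i. apply Rmult_le_pos; [apply Cmod_ge_0|apply pow_le; lra].
        * intros i _. rewrite pow_add. replace (S (k + i) - k)%nat with (S i) by lia. ring.
      + rewrite rsum_scal. apply Rmult_le_compat_l.
        * eapply Rle_trans; [|apply (sder_weight_sum_bound b th y 0 Hb Hy)].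
          apply rsum_ge_0. intros i _. apply Rmult_le_pos; [apply Cmod_ge_0|apply pow_le; lra].
        * unfold Sf. apply rsum_mono; [|lia]. intros k. apply Rmult_le_pos; [apply He|apply pow_le; lra]. }
  assert (D : Sf x * exp (- sder_log b sg x) <= Sf 0 * exp (- sder_log b sg 0)).
  { apply (decreasing_from_0 (fun x => Sf x * exp (- sder_log b sg x))
      (fun x => S' x * exp (- sder_log b sg x) + Sf x * (exp (- sder_log b sg x) * (- L' x)))); [lra| |].
    - intros y Hy. apply (derivable_pt_lim_mult Sf (fun x => exp (- sder_log b sg x))).
      + apply rsum_deriv.
      + apply (derivable_pt_lim_comp (fun x => - sder_log b sg x) exp).
        * apply (derivable_pt_lim_opp (sder_log b sg)). apply sder_log_deriv. lra.
        * apply derivable_pt_lim_exp.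
    - intros y Hy. specialize (HS y ltac:(lra)). pose proof (exp_pos (- sder_log b sg y)).
      replace (S' y * exp (- sder_log b sg y) + Sf y * (exp (- sder_log b sg y) * - L' y))
        with (exp (- sder_log b sg y) * (S' y - L' y * Sf y)) by ring. nra. }
  assert (E0 : sder_log b sg 0 = 0).
  { unfold sder_log. rewrite Rplus_0_r, Rminus_0_r, ln_1. ring. }
  assert (S0 : Sf 0 = 1).
  { unfold Sf. clear. induction N as [|N IH].
    - simpl. unfold e, sder_coef. simpl. rewrite Cmod_1. ring.
    - change (rsum (fun n => e n * 0 ^ n) (S (S N))) with (rsum (fun n => e n * 0 ^ n) (S N) + e (S N) * 0 ^ (S N)).
      rewrite IH. simpl. ring. }
  rewrite E0, S0, Ropp_0, exp_0 in D.
  change (Sf x <= exp (sder_log b sg x)).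
  rewrite exp_Ropp in D. pose proof (exp_pos (sder_log b sg x)) as Hp.
  apply (Rmult_le_compat_r (exp (sder_log b sg x))) in D; [|lra].
  rewrite Rmult_assoc, Rinv_l, Rmult_1_r in D by lra. lra.
Qed.

(** For [y = 1/2], the worst case, the square of the left side is [(1 - s) e^s] with [s = sin^2 th],
    and [1 - s <= e^(-s)]. *)
Lemma cos_exp_le_1 (th y : R) : 0 <= cos th -> y <= 1 / 2 -> cos th * exp (sin th * sin th * y) <= 1.
Proof.
  intros Hc Hy. set (sg := sin th * sin th). pose proof (sin2_cos2 th) as Hs. unfold Rsqr in Hs.
  assert (Hsg : 0 <= sg) by apply Rle_0_sqr.
  assert (E1 : exp (sg * y) <= exp (sg / 2)).
  { destruct (Rle_lt_or_eq_dec (sg * y) (sg / 2)) as [L|E]; [nra|left; now apply exp_increasing|rewrite E; lra]. }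
  assert (E2 : exp (sg / 2) * exp (sg / 2) = exp sg) by (rewrite <- exp_plus; f_equal; field).
  assert (E3 : (1 - sg) * exp sg <= 1).
  { pose proof (exp_ineq1_le (- sg)) as H. pose proof (exp_pos sg).
    assert (exp (- sg) * exp sg = 1) by (rewrite <- exp_plus, Rplus_opp_l; apply exp_0). nra. }
  pose proof (exp_pos (sg / 2)) as P.
  apply Rle_trans with (cos th * exp (sg / 2)); [apply Rmult_le_compat_l; assumption|].
  apply Rsqr_incr_0_var; [|lra]. unfold Rsqr.
  replace (cos th * exp (sg / 2) * (cos th * exp (sg / 2))) with ((cos th * cos th) * (exp (sg / 2) * exp (sg / 2))) by ring.
  rewrite E2. replace (cos th * cos th) with (1 - sg) by (unfold sg; lra). lra.
Qed.

(** The derivatives in [r] are compared: the factor [|1 + c| = 2 cos th] of the coefficients meets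
    the excess exponent of [sder_majorant] in [cos_exp_le_1]. *)
Lemma sector_majorant (a th r : R) (N : nat) : 1 <= a <= 2 -> - (PI / 2) < th < PI / 2 -> 0 <= r <= 1 / 3 ->
  rsum (fun j => Cmod (sector_coef a (cis 1 (2 * th)) (S j)) * r ^ S j) N
  <= exp (a * (ln (1 + r) - ln (1 - r))) - 1.
Proof.
  intros Ha Hth Hr. set (c := cis 1 (2 * th)). set (sg := sin th * sin th).
  assert (Hcos : 0 < cos th) by (apply cos_gt_0; lra).
  set (e := fun n => match n with O => 0 | S _ => Cmod (sector_coef a c n) end).
  set (T := fun x => rsum (fun n => e n * x ^ n) (S N)).
  assert (ET : forall x, T x = rsum (fun j => Cmod (sector_coef a c (S j)) * x ^ S j) N).
  { intros x. unfold T. clear. induction N as [|N IH]; [simpl; ring|].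
    change (rsum (fun n => e n * x ^ n) (S (S N))) with (rsum (fun n => e n * x ^ n) (S N) + e (S N) * x ^ S N).
    rewrite IH. reflexivity. }
  rewrite <- ET.
  assert (D : T r - exp (a * (ln (1 + r) - ln (1 - r))) <= T 0 - exp (a * (ln (1 + 0) - ln (1 - 0)))).
  { apply (decreasing_from_0 (fun x => T x - exp (a * (ln (1 + x) - ln (1 - x))))
      (fun x => rsum (fun n => INR (S n) * e (S n) * x ^ n) N
         - 2 * a * exp ((a - 1) * ln (1 + x) - (a - 1 + 2) * ln (1 - x)))); [lra| |].
    - intros x Hx. apply (derivable_pt_lim_minus T (fun x => exp (a * (ln (1 + x) - ln (1 - x))))).
      + apply rsum_deriv.
      + apply is_derive_Reals. auto_derive; [lra|].
        replace (a * (ln (1 + x) + - ln (1 + - x))) with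
          (((a - 1) * ln (1 + x) - (a - 1 + 2) * ln (1 - x)) + (ln (1 + x) + ln (1 - x)))
          by (unfold Rminus; ring).
        rewrite exp_plus, (exp_plus (ln (1 + x))), !exp_ln by lra. field. lra.
    - intros x Hx.
      assert (E : rsum (fun n => INR (S n) * e (S n) * x ^ n) N =
        rsum (fun n => (a * (2 * cos th)) * (Cmod (sder_coef (a - 1) c n) * x ^ n)) N).
      { apply rsum_ext. intros n _. unfold e, sector_coef.
        assert (HN : INR (S n) <> 0) by (apply not_0_INR; lia).
        rewrite Cmod_div by now apply RtoC_neq_0.
        rewrite !Cmod_mult. unfold c. rewrite cis_double_plus_1, Cmod_mult, Cmod_cis, !Cmod_R by lra.
        rewrite !Rabs_right by (try apply Rle_ge, pos_INR; lra). field. exact HN. }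
      rewrite E, rsum_scal.
      pose proof (sder_majorant (a - 1) th x N ltac:(lra) ltac:(lra)) as HM. fold c in HM.
      unfold sder_log in HM.
      set (M0 := (a - 1) * ln (1 + x) - (a - 1 + 2) * ln (1 - x)) in *.
      rewrite exp_plus in HM.
      set (y := (a - 1) * (6 * x ^ 2 + 16 * x ^ 4 - 3 / 2 * x)).
      assert (Hy : y <= 1 / 2).
      { unfold y. assert (x * x <= 1 / 9) by nra.
        assert (6 * x ^ 2 + 16 * x ^ 4 - 3 / 2 * x <= 1 / 2).
        { replace (x ^ 4) with ((x * x) * (x * x)) by ring. replace (x ^ 2) with (x * x) by ring. nra. }
        nra. }
      pose proof (cos_exp_le_1 th y ltac:(lra) Hy) as Hce.
      replace ((a - 1) * (sin th * sin th) * (6 * x ^ 2 + 16 * x ^ 4 - 3 / 2 * x)) with (sin th * sin th * y) in HM by (unfold y; ring).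
      set (X := rsum (fun n => Cmod (sder_coef (a - 1) c n) * x ^ n) N) in *. pose proof (exp_pos M0) as HM0.
      assert (cos th * X <= cos th * (exp M0 * exp (sin th * sin th * y))) by (apply Rmult_le_compat_l; [lra|exact HM]).
      assert (exp M0 * (cos th * exp (sin th * sin th * y)) <= exp M0 * 1) by (apply Rmult_le_compat_l; lra).
      assert (a * (cos th * X) <= a * exp M0) by (apply Rmult_le_compat_l; lra). lra. }
  assert (T0 : T 0 = 0).
  { rewrite ET. rewrite (rsum_ext _ (fun _ => 0)) by (intros; simpl; ring).
    clear. induction N as [|N IH]; [reflexivity|]. simpl. lra. }
  rewrite T0, Rplus_0_r, Rminus_0_r, ln_1 in D.
  replace (a * (0 - 0)) with 0 in D by ring. rewrite exp_0 in D. lra.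
Qed.

(** * Subordination *)

Lemma csum_first (f : nat -> C) (n : nat) : csum f (S n) = (f 0%nat + csum (fun k => f (S k)) n)%C.
Proof.
  induction n as [|n IH]; [simpl; ring|].
  change (csum f (S (S n))) with (csum f (S n) + f (S n))%C. rewrite IH. simpl. ring.
Qed.

Lemma diff_Cpow (D : C -> Prop) (W : C -> C) (k : nat) : diff_on D W -> diff_on D (fun z => W z ^ k)%C.
Proof.
  intros H z Hz. destruct (H z Hz) as [l Hl]. eexists.
  apply (cder_comp (fun w => w ^ k)%C W); [apply cder_pow|exact Hl].
Qed.

(** A local substitute for Schwarz's lemma: it shows that [W^k] vanishes to order [k] at 0. *)
Lemma lipschitz_at_0 (W : C -> C) (l : C) :
  cder W 0%C l -> W 0%C = 0%C -> exists d K, 0 < d /\ 0 < K /\ forall z, Cmod z < d -> Cmod (W z) <= K * Cmod z.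
Proof.
  intros H H0. destruct (H 1 Rlt_0_1) as [d [Hd H']]. pose proof (Cmod_ge_0 l).
  exists d, (Cmod l + 1). split; [exact Hd|]. split; [lra|]. intros z Hz.
  specialize (H' z). rewrite H0 in H'. replace (z - 0)%C with z in H' by ring. specialize (H' Hz).
  replace (W z) with ((W z - 0 - l * z) + l * z)%C by ring.
  eapply Rle_trans; [apply Cmod_triangle|]. rewrite Cmod_mult. lra.
Qed.

(** Each [W^k] is bounded by 1 and vanishes to order [k], so Bohr's theorem bounds its majorant
    series by [r^k]. Exchanging the summations over [n] and [k] does the rest. *)
Lemma subordinate_majorant (A Y : nat -> C) (u y W : C -> C) (r : R) (N : nat) :
  pser A u -> pser Y y -> diff_on (fun z => Cmod z < 1) W ->
  (forall z, Cmod z < 1 -> Cmod (W z) < 1) -> W 0%C = 0%C ->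
  (forall z, Cmod z < 1 -> u z = y (W z)) -> 0 <= r <= 1 / 3 ->
  rsum (fun j => Cmod (A (S j)) * r ^ S j) N <= rsum (fun j => Cmod (Y (S j)) * r ^ S j) N.
Proof.
  intros HA HY HW HW1 HW0 HuW Hr.
  assert (HWp : diff_on punctured W) by exact (diff_on_sub _ _ W punctured_disc HW).
  destruct (HW 0%C) as [l Hl]; [rewrite Cmod_0; lra|].
  destruct (lipschitz_at_0 W l Hl HW0) as [d [K [Hd [HK HL]]]].
  assert (HC : forall n, A (S n) = csum (fun k => Y (S k) * coef (fun z => W z ^ S k) (S n))%C (S n)).
  { intros n. rewrite <- (coef_pser A u (S n) HA).
    destruct (pser_taylor Y y (S (S n)) HY) as [C0 [HC0 HT]].
    (* The last bound keeps [|W z| <= 1/4], where [pser_taylor] applies to [y]. *)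
    set (d' := Rmin (Rmin d 1) (1 / (4 * K))).
    assert (Hd' : 0 < d') by (unfold d'; repeat apply Rmin_pos; try lra; apply Rdiv_lt_0_compat; lra).
    rewrite (coef_expand u (fun k z => Y k * W z ^ k)%C (S n) (C0 * K ^ S (S n)) d').
    - rewrite csum_first.
      rewrite (coef_ext _ (fun _ => Y 0%nat)) by (intros; simpl; ring).
      rewrite coef_const, Cplus_0_l. apply csum_ext. intros k _.
      apply coef_scal. now apply diff_Cpow.
    - apply (diff_on_sub _ _ u punctured_disc). exact (pser_diff A u HA).
    - intros k. apply diff_mult; [apply diff_const|now apply diff_Cpow].
    - exact Hd'.
    - intros z Hz.
      assert (H1 : Cmod z < d) by (eapply Rlt_le_trans; [apply Hz|]; unfold d'; eapply Rle_trans; [apply Rmin_l|apply Rmin_l]).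
      assert (H2 : Cmod z < 1) by (eapply Rlt_le_trans; [apply Hz|]; unfold d'; eapply Rle_trans; [apply Rmin_l|apply Rmin_r]).
      assert (H3 : Cmod z < 1 / (4 * K)) by (eapply Rlt_le_trans; [apply Hz|apply Rmin_r]).
      specialize (HL z H1). rewrite HuW by exact H2.
      assert (H4 : Cmod (W z) <= 1 / 4).
      { eapply Rle_trans; [exact HL|]. apply Rlt_le. apply (Rmult_lt_compat_l K) in H3; [|exact HK].
        replace (K * (1 / (4 * K))) with (1 / 4) in H3 by (field; lra). exact H3. }
      eapply Rle_trans; [apply HT, H4|]. rewrite Rmult_assoc. apply Rmult_le_compat_l; [exact HC0|].
      rewrite <- Rpow_mult_distr. apply pow_incr. split; [apply Cmod_ge_0|exact HL]. }
  apply Rle_trans with (rsum (fun n => rsum (fun k => Cmod (Y (S k)) * Cmod (coef (fun z => W z ^ S k)%C (S n)) * r ^ S n) (S n)) N).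
  - apply rsum_le. intros n _. rewrite HC.
    apply Rle_trans with (r ^ S n * rsum (fun k => Cmod (Y (S k)) * Cmod (coef (fun z => W z ^ S k)%C (S n))) (S n)).
    + rewrite Rmult_comm. apply Rmult_le_compat_l; [apply pow_le; lra|].
      eapply Rle_trans; [apply Cmod_csum|]. right. apply rsum_ext. intros. apply Cmod_mult.
    + rewrite <- rsum_scal. right. apply rsum_ext. intros. ring.
  - rewrite (rsum_triangle (fun n k => Cmod (Y (S k)) * Cmod (coef (fun z => W z ^ S k)%C (S n)) * r ^ S n)).
    apply rsum_le. intros k _.
    rewrite (rsum_ext _ (fun i => (Cmod (Y (S k)) * r ^ S k) * (Cmod (coef (fun z => W z ^ S k)%C (i + S k)) * r ^ i))).
    2: { intros i _. replace (S (k + i)) with (i + S k)%nat by lia. rewrite pow_add. ring. }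
    rewrite rsum_scal. rewrite <- (Rmult_1_r (Cmod (Y (S k)) * r ^ S k)) at 2.
    apply Rmult_le_compat_l; [apply Rmult_le_pos; [apply Cmod_ge_0|apply pow_le; lra]|].
    apply (bohr_majorant (fun z => W z ^ S k)%C 1 (K ^ S k) d (S k)); auto.
    + now apply diff_Cpow.
    + intros z Hz. rewrite Cmod_pow. rewrite <- (pow1 (S k)). apply pow_incr.
      split; [apply Cmod_ge_0|]. left. apply HW1. now apply punctured_disc.
    + intros z Hz. rewrite Cmod_pow, <- Rpow_mult_distr. apply pow_incr.
      split; [apply Cmod_ge_0|]. apply HL, Hz.
Qed.

(** The convolution formula for [b n] needs only the Taylor expansion of [f] and the boundedness of
    [w]; the coefficients of [w] are circle means. *)
Lemma dilatation_majorant (a b : nat -> C) (f g w : C -> C) (k r : R) (N : nat) :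
  pser a f -> pser b g -> diff_on (fun z => Cmod z < 1) w ->
  (forall z, Cmod z < 1 -> Cmod (w z) <= k) ->
  (forall z, Cmod z < 1 -> g z = (w z * f z)%C) -> 0 <= r <= 1 / 3 ->
  rsum (fun n => Cmod (b n) * r ^ n) N <= k * rsum (fun n => Cmod (a n) * r ^ n) N.
Proof.
  intros Ha Hb Hw Hk Hg Hr.
  assert (Hwp : diff_on punctured w) by exact (diff_on_sub _ _ w punctured_disc Hw).
  assert (Hk0 : 0 <= k).
  { eapply Rle_trans; [apply Cmod_ge_0|apply (Hk 0%C)]. rewrite Cmod_0. lra. }
  assert (HC : forall n, b n = csum (fun i => a i * coef w (n - i))%C (S n)).
  { intros n. rewrite <- (coef_pser b g n Hb).
    destruct (pser_taylor a f (S n) Ha) as [C0 [HC0 HT]].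
    rewrite (coef_expand g (fun i z => a i * (z ^ i * w z))%C n (k * C0) (1 / 4)).
    - apply csum_ext. intros i Hi. rewrite coef_scal by (apply diff_mult; [apply diff_pow|exact Hwp]).
      replace n with (i + (n - i))%nat at 1 by lia. now rewrite coef_shift.
    - apply (diff_on_sub _ _ g punctured_disc). exact (pser_diff b g Hb).
    - intros i. apply diff_mult; [apply diff_const|apply diff_mult; [apply diff_pow|exact Hwp]].
    - lra.
    - intros z Hz. rewrite Hg by lra.
      replace (csum (fun i => a i * (z ^ i * w z))%C (S n)) with (w z * csum (fun i => a i * z ^ i)%C (S n))%C.
      2: { rewrite <- csum_scal. apply csum_ext. intros; ring. }
      replace (w z * f z - w z * csum (fun i => a i * z ^ i) (S n))%C with (w z * (f z - csum (fun i => a i * z ^ i) (S n)))%C by ring.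
      rewrite Cmod_mult, Rmult_assoc. apply Rmult_le_compat; try apply Cmod_ge_0; [apply Hk; lra|apply HT; lra]. }
  apply Rle_trans with (rsum (fun n => rsum (fun i => Cmod (a i) * Cmod (coef w (n - i)) * r ^ n) (S n)) N).
  - apply rsum_le. intros n _. rewrite HC.
    apply Rle_trans with (r ^ n * rsum (fun i => Cmod (a i) * Cmod (coef w (n - i))) (S n)).
    + rewrite Rmult_comm. apply Rmult_le_compat_l; [apply pow_le; lra|].
      eapply Rle_trans; [apply Cmod_csum|]. right. apply rsum_ext. intros. apply Cmod_mult.
    + rewrite <- rsum_scal. right. apply rsum_ext. intros. ring.
  - rewrite (rsum_triangle (fun n i => Cmod (a i) * Cmod (coef w (n - i)) * r ^ n)).
    rewrite <- rsum_scal. apply rsum_le. intros i _.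
    rewrite (rsum_ext _ (fun j => (Cmod (a i) * r ^ i) * (Cmod (coef w (j + 0)) * r ^ j))).
    2: { intros j _. replace (i + j - i)%nat with (j + 0)%nat by lia. rewrite pow_add. ring. }
    rewrite rsum_scal, Rmult_comm. apply Rmult_le_compat_r; [apply Rmult_le_pos; [apply Cmod_ge_0|apply pow_le; lra]|].
    apply (bohr_majorant w k k 1 0); auto.
    + intros z Hz. apply Hk. now apply punctured_disc.
    + lra.
    + intros z Hz. simpl. rewrite Rmult_1_r. apply Hk, Hz.
Qed.

(** * Functions omitting a cone *)

Lemma cis_add (s t : R) : cis 1 (s + t) = (cis 1 s * cis 1 t)%C.
Proof. unfold cis, Cmult; simpl. rewrite cos_plus, sin_plus. f_equal; ring. Qed.

Lemma cis_0 : cis 1 0 = 1%C.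
Proof. unfold cis. rewrite cos_0, sin_0. unfold RtoC. f_equal; ring. Qed.

Lemma cis_PI : cis 1 PI = (-1)%C.
Proof. unfold cis. rewrite cos_PI, sin_PI. unfold RtoC, Copp; simpl. f_equal; ring. Qed.

Lemma cis_minus_2PI (t : R) : cis 1 (t - 2 * PI) = cis 1 t.
Proof.
  unfold cis. rewrite cos_minus, sin_minus, cos_2PI, sin_2PI. f_equal; ring.
Qed.

Lemma C_polar_cis (z : C) : exists t : R, -PI < t <= PI /\ z = (RtoC (Cmod z) * cis 1 t)%C.
Proof.
  destruct (C_polar z) as [t [Ht E]]. exists t. split; [exact Ht|]. rewrite E at 1.
  unfold cis. now rewrite !Rmult_1_l.
Qed.

Lemma clog_polar (v : C) : slit v -> v = (RtoC (Cmod v) * cis 1 (carg v))%C.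
Proof.
  intros H. rewrite <- (cexp_clog v H) at 1. unfold cexp, clog, cis, Cmult, RtoC; cbn [fst snd].
  rewrite exp_ln by now apply slit_Cmod_pos. f_equal; ring.
Qed.

(* The omitted set is the closed sector with vertex 0, axis direction [t2 + PI] and half-angle
   [(2 - a) PI / 2], so that [u^(1/a)] has values in the half-plane [Re (e^(-i t2 / a) w) > 0]. *)
Lemma sector_omitting_majorant (A : nat -> C) (u : C -> C) (a t2 r : R) (N : nat) :
  pser A u -> u 0%C = 1%C -> 1 <= a <= 2 -> - PI < t2 <= PI ->
  (forall z s dt, Cmod z < 1 -> 0 <= s -> Rabs dt <= (2 - a) * PI / 2 -> u z <> (RtoC s * cis 1 (t2 + PI + dt))%C) ->
  0 <= r <= 1 / 3 ->
  rsum (fun j => Cmod (A (S j)) * r ^ S j) N <= exp (a * (ln (1 + r) - ln (1 - r))) - 1.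
Proof.
  intros HA Hu0 Ha Ht2 Hom Hr. pose proof PI_RGT_0 as Hpi.
  set (dl := (2 - a) * PI / 2) in *.
  assert (Hdl : 0 <= dl) by (unfold dl; assert (0 <= (2 - a) * PI) by (apply Rmult_le_pos; lra); lra).
  assert (Edl : a * PI / 2 = PI - dl) by (unfold dl; field).
  (* The value [u 0 = 1] is not in the omitted cone; otherwise the direction 0, or [2 PI], would lie
     in its angular range. This bounds [th] away from the right angles. *)
  assert (Ht2b : - (PI - dl) < t2 < PI - dl).
  { assert (H00 : Cmod 0%C < 1) by (rewrite Cmod_0; lra). split.
    - apply Rnot_le_lt. intros Hle. apply (Hom 0%C 1 (- t2 - PI) H00); [lra|apply Rabs_le; lra|].
      replace (t2 + PI + (- t2 - PI)) with 0 by ring. rewrite cis_0, Hu0. ring.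
    - apply Rnot_le_lt. intros Hle. apply (Hom 0%C 1 (PI - t2) H00); [lra|apply Rabs_le; lra|].
      replace (t2 + PI + (PI - t2)) with (2 * PI) by ring.
      rewrite <- cis_minus_2PI. replace (2 * PI - 2 * PI) with 0 by ring. rewrite cis_0, Hu0. ring. }
  set (th := t2 / a). set (c := cis 1 (2 * th)).
  assert (Hth : - (PI / 2) < th < PI / 2).
  { unfold th. split; apply Rmult_lt_reg_r with a; try lra; unfold Rdiv at 1;
      [replace (t2 / a * a) with t2 by (field; lra)|replace (t2 * / a * a) with t2 by (field; lra)]; lra. }
  assert (Hcos : 0 < cos th) by (apply cos_gt_0; lra).
  set (v := fun z => (u z * cis 1 (- t2))%C).
  assert (Huv : forall z, u z = (v z * cis 1 t2)%C).
  { intros z. unfold v. rewrite <- Cmult_assoc, <- cis_add. replace (- t2 + t2) with 0 by ring. rewrite cis_0. ring. }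
  assert (Hslit : forall z, Cmod z < 1 -> slit (v z)).
  { intros z Hz. apply NNPP. intros Hn. apply not_slit in Hn as [H1 H2].
    apply (Hom z (- fst (v z)) 0 Hz); [lra|rewrite Rabs_R0; exact Hdl|].
    rewrite Rplus_0_r, Huv, cis_add, cis_PI.
    replace (v z) with (RtoC (fst (v z))) at 1 by (destruct (v z); simpl in *; subst; reflexivity).
    rewrite RtoC_opp. ring. }
  assert (Harg : forall z, Cmod z < 1 -> - (PI - dl) < carg (v z) < PI - dl).
  { intros z Hz. pose proof (carg_bound (v z)) as Hb. pose proof (clog_polar (v z) (Hslit z Hz)) as Hp.
    split; apply Rnot_le_lt; intros Hle.
    - apply (Hom z (Cmod (v z)) (carg (v z) + PI) Hz); [apply Cmod_ge_0|apply Rabs_le; lra|].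
      rewrite Huv, Hp at 1. rewrite <- Cmult_assoc, <- cis_add. f_equal.
      rewrite <- (cis_minus_2PI (t2 + PI + (carg (v z) + PI))). f_equal. ring.
    - apply (Hom z (Cmod (v z)) (carg (v z) - PI) Hz); [apply Cmod_ge_0|apply Rabs_le; lra|].
      rewrite Huv, Hp at 1. rewrite <- Cmult_assoc, <- cis_add. f_equal. f_equal. ring. }
  set (La := fun z => (/ RtoC a * clog (v z))%C).
  assert (Ha0 : RtoC a <> 0%C) by (apply RtoC_neq_0; lra).
  assert (HLa : forall z, Cmod z < 1 -> - (PI / 2) < snd (La z) < PI / 2).
  { intros z Hz. specialize (Harg z Hz). unfold La. rewrite <- RtoC_inv by lra.
    replace (snd (RtoC (/ a) * clog (v z))%C) with (carg (v z) / a) by (simpl; field; lra).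
    rewrite <- Edl in Harg.
    split; apply Rmult_lt_reg_r with a; try lra;
      [replace (carg (v z) / a * a) with (carg (v z)) by (field; lra)|replace (carg (v z) / a * a) with (carg (v z)) by (field; lra)]; lra. }
  set (g := fun z => cexp (La z)).
  assert (Hg : forall z, Cmod z < 1 -> 0 < fst (g z)).
  { intros z Hz. specialize (HLa z Hz). unfold g, cexp; cbn [fst]. apply Rmult_lt_0_compat; [apply exp_pos|].
    apply cos_gt_0; lra. }
  set (psi := fun z => (g z * cis 1 th)%C).
  (* After a rotation by [- th] the points 1 and [- c] become [e^(- i th)] and [- e^(i th)], mirror
     images in the imaginary axis, and [g z] lies on the side of the former. *)
  assert (HWd : forall z, Cmod z < 1 -> Cmod (psi z - 1)%C < Cmod (psi z + c)%C).
  { intros z Hz. specialize (Hg z Hz).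
    replace (psi z - 1)%C with ((g z - cis 1 (- th)) * cis 1 th)%C.
    2: { unfold psi. replace ((g z - cis 1 (- th)) * cis 1 th)%C with (g z * cis 1 th - cis 1 (- th) * cis 1 th)%C by ring.
         rewrite <- cis_add. replace (- th + th) with 0 by ring. now rewrite cis_0. }
    replace (psi z + c)%C with ((g z + cis 1 th) * cis 1 th)%C.
    2: { unfold psi, c. replace (2 * th) with (th + th) by ring. rewrite cis_add. ring. }
    rewrite !Cmod_mult, (Cmod_cis 1 th), !Rmult_1_r by lra.
    apply Rsqr_incrst_0; try apply Cmod_ge_0. unfold Rsqr. rewrite !Cmod_sqr.
    unfold cis; destruct (g z) as [g1 g2]; cbn [fst snd] in *. simpl.
    rewrite cos_neg, sin_neg. pose proof (sin2_cos2 th) as Hsc. unfold Rsqr in Hsc. nra. }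
  assert (Hc1 : (1 + c)%C <> 0%C).
  { unfold c. rewrite cis_double_plus_1. apply Cmult_neq_0; [apply RtoC_neq_0; lra|].
    apply Cmod_gt_0. rewrite Cmod_cis; lra. }
  assert (Hd0 : forall z, Cmod z < 1 -> (psi z + c)%C <> 0%C).
  { intros z Hz. apply Cmod_gt_0. eapply Rle_lt_trans; [apply Cmod_ge_0|apply HWd, Hz]. }
  (* The inverse of the Moebius map [half_plane_map th], applied to [psi]. *)
  set (W := fun z => ((psi z - 1) / (psi z + c))%C).
  assert (HW1 : forall z, Cmod z < 1 -> Cmod (W z) < 1).
  { intros z Hz. unfold W. rewrite Cmod_div by now apply Hd0.
    pose proof (HWd z Hz) as H. pose proof (Cmod_ge_0 (psi z - 1)%C).
    apply Rmult_lt_reg_r with (Cmod (psi z + c)%C); [lra|]. unfold Rdiv. rewrite Rmult_assoc, Rinv_l; lra. }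
  assert (Hmap : forall z, Cmod z < 1 -> half_plane_map th (W z) = psi z).
  { intros z Hz. unfold half_plane_map. fold c. pose proof (Hd0 z Hz).
    replace (1 + c * W z)%C with (psi z * (1 + c) / (psi z + c))%C by (unfold W; field; auto).
    replace (1 - W z)%C with ((1 + c) / (psi z + c))%C by (unfold W; field; auto).
    field. auto. }
  apply Rle_trans with (rsum (fun j => Cmod (sector_coef a c (S j)) * r ^ S j) N); [|now apply sector_majorant].
  apply (subordinate_majorant A (sector_coef a c) u (sector_map a th) W); auto.
  - now apply pser_sector_map.
  - assert (Hu : diff_on (fun z => Cmod z < 1) u) by exact (pser_diff A u HA).
    assert (Hv : diff_on (fun z => Cmod z < 1) v) by (apply diff_mult; [exact Hu|apply diff_const]).
    assert (Hpsi : diff_on (fun z => Cmod z < 1) psi).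
    { apply diff_mult; [|apply diff_const]. intros z Hz. destruct (Hv z Hz) as [l Hl]. eexists.
      apply (cder_comp cexp La); [apply cder_cexp|]. unfold La. apply cder_scal.
      apply (cder_comp clog v); [|exact Hl]. apply cder_clog. now apply Hslit. }
    apply diff_div; [apply diff_minus; [exact Hpsi|apply diff_const]|apply diff_plus; [exact Hpsi|apply diff_const]|exact Hd0].
  - assert (H00 : Cmod 0%C < 1) by (rewrite Cmod_0; lra).
    assert (E : psi 0%C = 1%C).
    { unfold psi, g, La, v. rewrite Hu0. replace (1 * cis 1 (- t2))%C with (cis 1 (- t2)) by ring.
      rewrite (cis_cexp (- t2)), clog_cexp by (simpl; apply Rabs_def1; lra).
      rewrite cis_cexp, <- cexp_plus. rewrite <- cexp_0. f_equal. rewrite <- RtoC_inv by lra.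
      unfold th, Cmult, Cplus, RtoC; simpl. f_equal; field; lra. }
    unfold W. rewrite E. replace (1 - 1)%C with (RtoC 0) by ring. unfold Cdiv. ring.
  - intros z Hz. unfold sector_map, half_plane_log. rewrite Hmap by exact Hz.
    replace (psi z * cis 1 (- th))%C with (g z).
    2: { unfold psi. rewrite <- Cmult_assoc, <- cis_add. replace (th + - th) with 0 by ring. rewrite cis_0. ring. }
    unfold g at 1. pose proof (HLa z Hz). rewrite clog_cexp by (apply Rabs_def1; lra).
    replace (a * (La z + (0, th)))%C with (clog (v z) + (0, t2))%C.
    + rewrite cexp_plus, cexp_clog by now apply Hslit. rewrite <- cis_cexp. apply Huv.
    + unfold La. replace (a * (/ a * clog (v z) + (0, th)))%C with (clog (v z) + a * (0, th))%C by (field; exact Ha0).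
      f_equal. unfold th, Cmult, RtoC; simpl. f_equal; field; lra.
Qed.

(** * Open mapping and the complement of the image *)

Lemma continuity_along_line (G : C -> C) (u v : C) (s : R) :
  (exists l, cder G (u + RtoC s * v)%C l) -> continuity_pt (fun s => Cmod (G (u + RtoC s * v)%C)) s.
Proof.
  intros [l Hl] e He. destruct (cder_cont _ _ _ Hl e He) as [d [Hd H]].
  pose proof (Cmod_ge_0 v).
  exists (d / (Cmod v + 1)). split; [apply Rdiv_lt_0_compat; lra|].
  intros x [_ Hx]. simpl in *. unfold Rdist in *.
  eapply Rle_lt_trans; [apply Cmod_dist|]. apply H.
  replace (u + x * v - (u + s * v))%C with (RtoC (x - s) * v)%C by (rewrite RtoC_minus; ring).
  rewrite Cmod_mult, Cmod_R. apply (Rmult_lt_compat_r (Cmod v + 1)) in Hx; [|lra].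
  replace (d / (Cmod v + 1) * (Cmod v + 1)) with d in Hx by (field; lra).
  pose proof (Rabs_pos (x - s)). nra.
Qed.

Lemma cis_line (rho t : R) : 0 < rho -> cexp ((ln rho, 0) + RtoC t * (0, 1))%C = cis rho t.
Proof.
  intros H. replace ((ln rho, 0) + RtoC t * (0, 1))%C with ((ln rho, t) : C)
    by (unfold Cplus, Cmult, RtoC; simpl; f_equal; ring).
  unfold cexp, cis; cbn [fst snd]. now rewrite exp_ln.
Qed.

Lemma continuity_on_circle (F : C -> C) (rho t : R) : 0 < rho ->
  (exists l, cder F (cis rho t) l) -> continuity_pt (fun t => Cmod (F (cis rho t))) t.
Proof.
  intros Hr [l Hl].
  apply continuity_pt_ext with (fun s => Cmod ((fun z => F (cexp z)) ((ln rho, 0) + RtoC s * (0, 1))%C)).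
  - intros x. cbv beta. now rewrite cis_line.
  - apply (continuity_along_line (fun z => F (cexp z))). eexists.
    apply (cder_comp F cexp); [rewrite cis_line by exact Hr; exact Hl|apply cder_cexp].
Qed.

Lemma mean_value_at_0 (F : C -> C) (eta : C) (rho : R) : diff_on (fun z => Cmod z < 1) F -> 0 < rho < 1 ->
  cmean (fun z => eta * F z)%C rho = fst (eta * F 0)%C.
Proof.
  intros HF Hr.
  assert (HE : diff_on (fun z => Cmod z < 1) (fun z => eta * F z)%C) by (apply diff_mult; [apply diff_const|exact HF]).
  apply (cmean_lim _ (eta * F 0)%C); [exact (diff_on_sub _ _ _ punctured_disc HE)|exact Hr|].
  intros e He. destruct (HE 0%C) as [l Hl]; [rewrite Cmod_0; lra|].
  destruct (cder_cont _ _ _ Hl e He) as [d [Hd H]]. exists d. split; [exact Hd|].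
  intros z Hz. left. apply H. replace (z - 0)%C with z by ring. apply Hz.
Qed.

(** By injectivity [|phi - phi z0|] has a positive minimum [m] on the circle of radius [eps / 2]. If
    a value [w] closer than [m / 2] were omitted, [1 / (phi - w)] would be at most [2 / m] on the
    circle and larger at the centre, against the mean value property. *)
Lemma open_mapping (phi : C -> C) (z0 : C) (eps : R) :
  0 < eps -> (forall z, Cmod (z - z0)%C < eps -> exists l, cder phi z l) ->
  (forall z z', Cmod (z - z0)%C < eps -> Cmod (z' - z0)%C < eps -> phi z = phi z' -> z = z') ->
  exists m, 0 < m /\ forall w, Cmod (w - phi z0)%C < m -> exists z, Cmod (z - z0)%C < eps /\ phi z = w.
Proof.
  intros He Hd Hi. pose proof PI_RGT_0.
  set (F := fun z => phi (z0 + eps * z)%C).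
  assert (Hin : forall z, Cmod z < 1 -> Cmod (z0 + eps * z - z0)%C < eps).
  { intros z Hz. replace (z0 + eps * z - z0)%C with (RtoC eps * z)%C by ring.
    rewrite Cmod_mult, Cmod_R, Rabs_right by lra. pose proof (Cmod_ge_0 z). nra. }
  assert (HF : diff_on (fun z => Cmod z < 1) F).
  { intros z Hz. destruct (Hd _ (Hin z Hz)) as [l Hl]. eexists.
    apply (cder_comp phi (fun z => z0 + eps * z)%C); [exact Hl|].
    apply cder_plus; [apply cder_const|apply cder_scal, cder_id]. }
  assert (F0 : F 0%C = phi z0) by (unfold F; f_equal; ring).
  assert (Hc : forall t, Cmod (cis (1 / 2) t) < 1) by (intros; rewrite Cmod_cis; lra).
  destruct (continuity_ab_min (fun t => Cmod ((fun z => F z - F 0)%C (cis (1 / 2) t))) 0 (2 * PI)) as [tm [Hmin _]].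
  { lra. }
  { intros t _. apply (continuity_on_circle (fun z => F z - F 0)%C); [lra|].
    destruct (HF _ (Hc t)) as [l Hl]. eexists. apply cder_minus; [exact Hl|apply cder_const]. }
  set (m := Cmod (F (cis (1 / 2) tm) - F 0)%C) in *.
  assert (Hm : 0 < m).
  { apply Cmod_gt_0. intros E. apply Cminus_eq_0 in E. unfold F in E.
    apply Hi in E; try (apply Hin; rewrite ?Cmod_0; try apply Hc; lra).
    assert (E' : (RtoC eps * cis (1 / 2) tm)%C = 0%C).
    { replace (eps * cis (1 / 2) tm)%C with ((z0 + eps * cis (1 / 2) tm) - z0)%C by ring. rewrite E. ring. }
    apply (f_equal Cmod) in E'. rewrite Cmod_mult, Cmod_cis, Cmod_R, Cmod_0, Rabs_right in E' by lra. lra. }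
  exists (m / 2). split; [lra|]. intros w Hw. apply NNPP. intros Hno.
  assert (Hne : forall z, Cmod z < 1 -> (F z - w)%C <> 0%C).
  { intros z Hz E. apply Hno. exists (z0 + eps * z)%C. split; [now apply Hin|]. now apply Cminus_eq_0. }
  set (G := fun z => (/ (F z - w))%C).
  assert (HG : diff_on (fun z => Cmod z < 1) G) by (apply diff_inv; [apply diff_minus; [exact HF|apply diff_const]|exact Hne]).
  destruct (unimodular_align (G 0%C)) as [eta [Heta Ha]].
  assert (H00 : Cmod 0%C < 1) by (rewrite Cmod_0; lra).
  assert (Hrho : 0 < 1 / 2 < 1) by lra.
  pose proof (mean_value_at_0 G eta (1 / 2) HG Hrho) as HM. rewrite Ha in HM. simpl fst in HM.
  assert (HU : cmean (fun z => eta * G z)%C (1 / 2) <= 2 / m).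
  { assert (HE : diff_on (fun z => Cmod z < 1) (fun z => eta * G z)%C) by (apply diff_mult; [apply diff_const|exact HG]).
    apply cmean_le; [exact (diff_on_sub _ _ _ punctured_disc HE)|lra|].
    intros t. eapply Rle_trans; [apply Rle_abs|]. eapply Rle_trans; [apply Rabs_Re_le|].
    rewrite Cmod_mult, Heta, Rmult_1_l. unfold G. rewrite Cmod_inv by (apply Hne, Hc).
    replace (2 / m) with (/ (m / 2)) by (field; lra). apply Rinv_le_contravar; [lra|].
    destruct (C_polar_cis (cis (1 / 2) t)) as [t' [Ht' Et']].
    rewrite Cmod_cis in Et' by lra. rewrite <- cis_scal in Et'. rewrite Et'.
    assert (exists t'', 0 <= t'' <= 2 * PI /\ cis (1 / 2) t' = cis (1 / 2) t'') as [t'' [Ht'' Et'']].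
    { destruct (Rle_dec 0 t').
      - exists t'. split; [lra|reflexivity].
      - exists (t' + 2 * PI). split; [lra|]. rewrite !(cis_scal (1 / 2)).
        rewrite <- (cis_minus_2PI (t' + 2 * PI)). do 2 f_equal. ring. }
    rewrite Et''. specialize (Hmin t'' Ht''). cbv beta in Hmin. fold m in Hmin.
    assert (Htr : Cmod (F (cis (1 / 2) t'') - F 0)%C <= Cmod (F (cis (1 / 2) t'') - w)%C + Cmod (w - F 0)%C).
    { replace (F (cis (1 / 2) t'') - F 0)%C with ((F (cis (1 / 2) t'') - w) + (w - F 0))%C by ring. apply Cmod_triangle. }
    rewrite F0 in *. lra. }
  rewrite HM in HU. unfold G in HU. rewrite Cmod_inv in HU by (now apply Hne).
  rewrite F0 in HU. rewrite Cmod_sub_sym in HU.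
  assert (Hw0 : 0 < Cmod (w - phi z0)%C).
  { rewrite Cmod_sub_sym, <- F0. apply Cmod_gt_0. now apply Hne. }
  assert (/ (m / 2) < / Cmod (w - phi z0)%C) by (apply Rinv_lt_contravar; [nra|exact Hw]).
  replace (2 / m) with (/ (m / 2)) in HU by (field; lra). lra.
Qed.

Lemma difference_quotient_inverse_limit (phi : C -> C) (l : C) :
  cder phi 0%C l -> l <> 0%C -> forall e, 0 < e -> exists d, 0 < d /\ forall z, 0 < Cmod z < d ->
    Cmod (z / (phi z - phi 0) - / l)%C <= e.
Proof.
  intros H Hl e He. pose proof (proj1 (Cmod_gt_0 l) Hl) as Hm. set (m := Cmod l) in *.
  assert (Hmm : 0 < m * m) by nra.
  assert (He2 : 0 < Rmin (m / 2) (e * (m * m) / 2)).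
  { apply Rmin_pos; [lra|]. assert (0 < e * (m * m)) by (apply Rmult_lt_0_compat; lra). lra. }
  destruct (H _ He2) as [d [Hd H']]. exists d. split; [exact Hd|]. intros z Hz.
  specialize (H' z). replace (z - 0)%C with z in H' by ring. specialize (H' (proj2 Hz)).
  set (q := (phi z - phi 0)%C) in *. set (x := Cmod z) in *.
  assert (H1 : Cmod (q - l * z)%C <= m / 2 * x).
  { eapply Rle_trans; [exact H'|]. apply Rmult_le_compat_r; [lra|apply Rmin_l]. }
  assert (H2 : Cmod (q - l * z)%C <= e * (m * m) / 2 * x).
  { eapply Rle_trans; [exact H'|]. apply Rmult_le_compat_r; [lra|apply Rmin_r]. }
  assert (Hq : m / 2 * x <= Cmod q).
  { assert (Ht : Cmod (l * z)%C <= Cmod q + Cmod (q - l * z)%C).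
    { rewrite <- (Cmod_opp (q - l * z)%C). eapply Rle_trans; [|apply Cmod_triangle]. right. f_equal. ring. }
    rewrite Cmod_mult in Ht. fold m x in Ht. lra. }
  assert (Hq0 : 0 < Cmod q) by nra. assert (Hqn : q <> 0%C) by now apply Cmod_gt_0.
  replace (z / q - / l)%C with (- (q - l * z) / (l * q))%C by (field; auto).
  rewrite Cmod_div, Cmod_opp, Cmod_mult by now apply Cmult_neq_0. fold m.
  apply Rmult_le_reg_r with (m * Cmod q); [nra|]. unfold Rdiv. rewrite Rmult_assoc, Rinv_l, Rmult_1_r by nra.
  eapply Rle_trans; [exact H2|].
  assert (Hem : 0 < e * m) by (apply Rmult_lt_0_compat; lra).
  assert (e * m * (m / 2 * x) <= e * m * Cmod q) by (apply Rmult_le_compat_l; lra). lra.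
Qed.

(* If all [w] with [|w| > R0] were attained, [phi] would be proper near the circle and
   [|phi| > R] on a collar of the disc; then the mean of [z / (phi z - phi 0)] over a large
   circle would be smaller than its value [1 / phi'(0)] at the centre. *)
Lemma complement_unbounded (phi : C -> C) (l : C) (R0 : R) :
  diff_on unit_disc phi ->
  (forall z1 z2, unit_disc z1 -> unit_disc z2 -> phi z1 = phi z2 -> z1 = z2) ->
  cder phi 0%C l -> l <> 0%C ->
  (forall M, exists d, 0 < d /\ forall z, unit_disc z -> Cmod (z - 1)%C < d -> M < Cmod (phi z)) ->
  exists w, R0 < Cmod w /\ ~ disc_image phi w.
Proof.
  intros Hphi Hinj Hl Hl0 Hinf. apply NNPP. intros Hno. pose proof PI_RGT_0 as Hpi.
  assert (Hall : forall w, R0 < Cmod w -> disc_image phi w).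
  { intros w Hw. apply NNPP. intros Hn. apply Hno. now exists w. }
  pose proof (proj1 (Cmod_gt_0 l) Hl0) as Hlm. pose proof (Cmod_ge_0 (phi 0%C)) as Hp0.
  (* The circle [|w| = R1] lies where all values are assumed to be attained. The summands
     [Cmod (phi 0)] and [Cmod l] give the final contradiction [1 / (R1 - |phi 0|) < 1 / |l|]. *)
  set (R1 := Rabs R0 + Cmod (phi 0%C) + Cmod l + 1).
  pose proof (Rabs_pos R0). pose proof (Rle_abs R0).
  assert (HR1 : 0 < R1) by (unfold R1; lra).
  (* By openness the values near [cis R1 t] are attained near [zt], and by injectivity nowhere else;
     so their preimages keep a distance from the unit circle. *)
  assert (Hloc : forall t : R, exists d : posreal, forall t' z, Rabs (t' - t) < d -> unit_disc z -> phi z = cis R1 t' -> Cmod z < 1 - d).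
  { intros t. destruct (Hall (cis R1 t)) as [zt [Hzt Ezt]].
    { rewrite Cmod_cis by lra. unfold R1; lra. }
    unfold unit_disc in Hzt. set (dz := (1 - Cmod zt) / 2).
    assert (Hdz : 0 < dz) by (unfold dz; lra).
    assert (Hball : forall z, Cmod (z - zt)%C < dz -> Cmod z < 1 - dz).
    { intros z Hz. replace z with (zt + (z - zt))%C by ring. eapply Rle_lt_trans; [apply Cmod_triangle|]. unfold dz in *. lra. }
    destruct (open_mapping phi zt dz Hdz) as [m [Hm Hopen]].
    { intros z Hz. apply Hphi. unfold unit_disc. specialize (Hball z Hz). lra. }
    { intros z z' Hz Hz' E. apply Hinj; auto; unfold unit_disc; [specialize (Hball z Hz)|specialize (Hball z' Hz')]; lra. }
    assert (Hcont : exists e, 0 < e /\ forall t', Rabs (t' - t) < e -> Cmod (cis R1 t' - cis R1 t)%C < m).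
    { destruct (cder_cont _ _ _ (cder_cexp (ln R1, t)) m Hm) as [e [Hee Hc]]. exists e. split; [exact Hee|].
      intros t' Ht'.
      assert (Ec : forall x, cis R1 x = cexp (ln R1, x)) by (intros; unfold cis, cexp; cbn [fst snd]; rewrite exp_ln; auto).
      rewrite !Ec. apply Hc. eapply Rle_lt_trans; [apply (Cmod_le_Rabs (ln R1 - ln R1) (t' - t))|].
      replace (ln R1 - ln R1) with 0 by ring. rewrite Rabs_R0. lra. }
    destruct Hcont as [e [Hee Hc]].
    exists (mkposreal _ (Rmin_pos _ _ Hee Hdz)). simpl. intros t' z Ht' Hz Ez.
    destruct (Hopen (cis R1 t')) as [z' [Hz' Ez']].
    { rewrite Ezt. apply Hc. eapply Rlt_le_trans; [exact Ht'|apply Rmin_l]. }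
    assert (z = z') as ->.
    { apply Hinj; [exact Hz| |congruence]. unfold unit_disc. specialize (Hball z' Hz'). lra. }
    specialize (Hball z' Hz'). pose proof (Rmin_r e dz). lra. }
  apply choice in Hloc as [delta Hdelta].
  destruct (compactness_value_1d (- PI) PI delta) as [d Hd].
  pose proof (cond_pos d) as Hdpos.
  assert (Hcollar : forall z, unit_disc z -> 1 - d <= Cmod z -> Cmod (phi z) <> R1).
  { intros z Hz Hzd E. destruct (C_polar_cis (phi z)) as [t' [Ht' Et']]. rewrite E, <- cis_scal in Et'.
    apply (Hd t'); [lra|]. intros [t [_ [Ht Hdt]]].
    specialize (Hdelta t t' z Ht Hz Et'). lra. }
  destruct (Hinf R1) as [eta [Heta Hbig]].
  set (x := 1 - Rmin (Rmin (d / 2) (eta / 2)) (1 / 2)).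
  assert (Hx : 0 < x < 1 /\ 1 - d < x /\ 1 - eta < x).
  { unfold x. pose proof (Rmin_l (Rmin (d / 2) (eta / 2)) (1 / 2)). pose proof (Rmin_r (Rmin (d / 2) (eta / 2)) (1 / 2)).
    pose proof (Rmin_l (d / 2) (eta / 2)). pose proof (Rmin_r (d / 2) (eta / 2)).
    assert (0 < Rmin (Rmin (d / 2) (eta / 2)) (1 / 2)) by (repeat apply Rmin_pos; lra). lra. }
  assert (Hout : forall z, unit_disc z -> 0 < Cmod z -> 1 - d < Cmod z -> R1 < Cmod (phi z)).
  { intros z Hz Hz0 Hzd. unfold unit_disc in Hz.
    destruct (Rtotal_order (Cmod (phi z)) R1) as [L|[E|G]]; [exfalso| |exact G].
    2: { exfalso. apply (Hcollar z); [exact Hz|lra|exact E]. }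
    destruct (C_polar_cis z) as [tau [_ Etau]]. rewrite <- cis_scal in Etau.
    (* [exp (P + s Q)] joins [z] to the real point [x] inside the collar. Near 1, hence at [x],
       [|phi|] exceeds [R1]; a start below [R1] would force the excluded value [R1] in between. *)
    set (P := (ln (Cmod z), tau) : C). set (Q := (ln x - ln (Cmod z), - tau) : C).
    assert (HPQ : forall s, 0 <= s <= 1 -> unit_disc (cexp (P + RtoC s * Q)%C) /\ 1 - d < Cmod (cexp (P + RtoC s * Q)%C)).
    { intros s Hs. unfold unit_disc. rewrite Cmod_cexp.
      replace (fst (P + RtoC s * Q)%C) with ((1 - s) * ln (Cmod z) + s * ln x) by (unfold P, Q; simpl; ring).
      set (lo := Rmin (Cmod z) x). set (hi := Rmax (Cmod z) x).
      assert (Hlo : 0 < lo) by (apply Rmin_pos; lra).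
      assert (Hlo2 : 1 - d < lo) by (apply Rmin_glb_lt; lra).
      assert (Hhi : hi < 1) by (apply Rmax_lub_lt; lra).
      assert (L1 : ln lo <= ln (Cmod z)) by (apply ln_le; [exact Hlo|apply Rmin_l]).
      assert (L2 : ln lo <= ln x) by (apply ln_le; [exact Hlo|apply Rmin_r]).
      assert (L3 : ln (Cmod z) <= ln hi) by (apply ln_le; [exact Hz0|apply Rmax_l]).
      assert (L4 : ln x <= ln hi) by (apply ln_le; [lra|apply Rmax_r]).
      assert (B1 : ln lo <= (1 - s) * ln (Cmod z) + s * ln x) by nra.
      assert (B2 : (1 - s) * ln (Cmod z) + s * ln x <= ln hi) by nra.
      assert (Hhi0 : 0 < hi) by (eapply Rlt_le_trans; [exact Hz0|apply Rmax_l]).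
      assert (C1 : lo <= exp ((1 - s) * ln (Cmod z) + s * ln x)).
      { rewrite <- (exp_ln lo) by exact Hlo. destruct B1 as [B1|B1]; [left; now apply exp_increasing|rewrite B1; lra]. }
      assert (C2 : exp ((1 - s) * ln (Cmod z) + s * ln x) <= hi).
      { rewrite <- (exp_ln hi) by exact Hhi0. destruct B2 as [B2|B2]; [left; now apply exp_increasing|rewrite B2; lra]. }
      lra. }
    destruct (IVT_interv (fun s => Cmod ((fun z => phi (cexp z)) (P + RtoC s * Q)%C) - R1) 0 1) as [s [Hs Es]].
    - intros s Hs. apply continuity_pt_minus; [|apply continuity_pt_const; intros ? ?; reflexivity].
      apply (continuity_along_line (fun z => phi (cexp z))). destruct (HPQ s Hs) as [H1 _].
      destruct (Hphi _ H1) as [l' Hl']. eexists. apply (cder_comp phi cexp); [exact Hl'|apply cder_cexp].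
    - lra.
    - cbv beta. replace (P + RtoC 0 * Q)%C with P by ring. unfold P.
      replace (cexp (ln (Cmod z), tau)) with z; [lra|].
      rewrite Etau at 1. unfold cis, cexp; cbn [fst snd]. now rewrite exp_ln.
    - cbv beta. replace (P + RtoC 1 * Q)%C with ((ln x, 0) : C) by (unfold P, Q, Cplus, Cmult, RtoC; simpl; f_equal; ring).
      replace (cexp (ln x, 0)) with (RtoC x).
      2: { unfold cexp, RtoC; cbn [fst snd]. rewrite exp_ln, cos_0, sin_0 by lra. f_equal; ring. }
      assert (R1 < Cmod (phi (RtoC x))); [|lra]. apply Hbig.
      + unfold unit_disc. rewrite Cmod_R, Rabs_right; lra.
      + rewrite <- RtoC_minus, Cmod_R, Rabs_left; lra.
    - cbv beta in Es. destruct (HPQ s Hs) as [H1 H2]. apply (Hcollar _ H1); [lra|]. lra. }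
  set (G := fun z => (z / (phi z - phi 0))%C).
  assert (H00 : unit_disc 0%C) by (unfold unit_disc; rewrite Cmod_0; lra).
  assert (Hne : forall z, punctured z -> (phi z - phi 0)%C <> 0%C).
  { intros z Hz E. apply Cminus_eq_0 in E. apply Hinj in E; [|now apply punctured_disc|exact H00].
    now apply (punctured_neq_0 z Hz). }
  assert (HG : diff_on punctured G).
  { apply (diff_div punctured (fun z => z) (fun z => phi z - phi 0)%C); [|apply diff_minus; [|apply diff_const]|exact Hne].
    - intros z _. eexists. apply cder_id.
    - exact (diff_on_sub _ _ _ punctured_disc Hphi). }
  destruct (unimodular_align (/ l)%C) as [e1 [He1 Ee1]].
  assert (HeG : diff_on punctured (fun z => e1 * G z)%C) by (apply diff_mult; [apply diff_const|exact HG]).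
  assert (Hmean : cmean (fun z => e1 * G z)%C x = fst (e1 * / l)%C).
  { apply cmean_lim; [exact HeG|lra|]. intros e He.
    destruct (difference_quotient_inverse_limit phi l Hl Hl0 e He) as [d' [Hd' H']].
    exists d'. split; [exact Hd'|]. intros z Hz.
    replace (e1 * G z - e1 * / l)%C with (e1 * (G z - / l))%C by ring. rewrite Cmod_mult, He1, Rmult_1_l. now apply H'. }
  rewrite Ee1, Cmod_inv in Hmean by exact Hl0. simpl in Hmean.
  assert (HU : cmean (fun z => e1 * G z)%C x <= / (R1 - Cmod (phi 0%C))).
  { apply cmean_le; [exact HeG|lra|]. intros t.
    eapply Rle_trans; [apply Rle_abs|]. eapply Rle_trans; [apply Rabs_Re_le|].
    set (z := cis x t). assert (Hz : Cmod z = x) by (apply Cmod_cis; lra).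
    assert (Hzp : punctured z) by (unfold punctured; lra).
    assert (Ho : R1 < Cmod (phi z)) by (apply Hout; unfold unit_disc; lra).
    rewrite Cmod_mult, He1, Rmult_1_l. unfold G. rewrite Cmod_div, Hz by now apply Hne.
    assert (Ht : Cmod (phi z) <= Cmod (phi z - phi 0)%C + Cmod (phi 0%C)).
    { replace (phi z) with ((phi z - phi 0) + phi 0)%C at 1 by ring. apply Cmod_triangle. }
    assert (HR : 0 < R1 - Cmod (phi 0%C)) by (unfold R1; lra).
    apply Rle_trans with (1 * / Cmod (phi z - phi 0)%C).
    - apply Rmult_le_compat_r; [left; apply Rinv_0_lt_compat; lra|lra].
    - rewrite Rmult_1_l. apply Rinv_le_contravar; lra. }
  rewrite Hmean in HU.
  assert (/ (R1 - Cmod (phi 0%C)) < / Cmod l).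
  { apply Rinv_lt_contravar; [|unfold R1; lra]. apply Rmult_lt_0_compat; [exact Hlm|unfold R1; lra]. }
  lra.
Qed.

(** * Cones in the complement of the image *)

Lemma cis_1 (t : R) : cis 1 t = ((cos t, sin t) : C).
Proof. unfold cis. now rewrite !Rmult_1_l. Qed.

Lemma locally_C_Cmod (w : C) (Q : C -> Prop) :
  locally (T := C_UniformSpace) w Q <-> exists m, 0 < m /\ forall v, Cmod (v - w)%C < m -> Q v.
Proof.
  split.
  - intros [e He]. exists e. split; [apply cond_pos|]. intros v Hv. apply He.
    split; [change (Rabs (fst v - fst w) < e)|change (Rabs (snd v - snd w) < e)];
      (eapply Rle_lt_trans; [|exact Hv]); [apply (Rabs_Re_le (v - w)%C)|apply (Rabs_Im_le (v - w)%C)].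
  - intros [m [Hm H]]. assert (H2 : 0 < m / 2) by lra. exists (mkposreal _ H2). intros v [H1 H3]. apply H.
    change (Rabs (fst v - fst w) < m / 2) in H1. change (Rabs (snd v - snd w) < m / 2) in H3.
    eapply Rle_lt_trans; [apply (Cmod_le_Rabs (fst v - fst w) (snd v - snd w))|]. lra.
Qed.

Lemma analytic_diff_on (h : C -> C) : analytic_on_disc h -> diff_on unit_disc h.
Proof. intros H z Hz. destruct (H z Hz) as [l Hl]. exists l. now apply cder_is_derive. Qed.

Lemma image_open (alpha : R) (phi : C -> C) (w : C) :
  concave_univalent alpha phi -> disc_image phi w ->
  exists m, 0 < m /\ forall v, Cmod (v - w)%C < m -> disc_image phi v.
Proof.
  intros Hc [z [Hz Ez]]. pose proof (analytic_diff_on _ (cu_analytic _ _ Hc)) as Hd.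
  unfold unit_disc in Hz.
  assert (Hin : forall y, Cmod (y - z)%C < 1 - Cmod z -> unit_disc y).
  { intros y Hy. unfold unit_disc. replace y with (z + (y - z))%C by ring.
    eapply Rle_lt_trans; [apply Cmod_triangle|]. lra. }
  destruct (open_mapping phi z (1 - Cmod z)) as [m [Hm H]].
  - lra.
  - intros y Hy. apply Hd. now apply Hin.
  - intros y y' Hy Hy'. apply (cu_injective _ _ Hc); now apply Hin.
  - exists m. split; [exact Hm|]. intros v Hv. rewrite <- Ez in Hv. destruct (H v Hv) as [y [Hy Ey]].
    exists y. split; [now apply Hin|exact Ey].
Qed.

(** Ensures that the boundary is not empty: otherwise [dist_to_set] would be the default value 0 of
    [real p_infty]. The point is the supremum of the parameters of points of [Om] on the segment. *)
Lemma boundary_on_segment (Om : C -> Prop) (u v : C) : Om u -> ~ Om v -> exists w, boundary Om w.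
Proof.
  intros Hu Hv.
  set (pt := fun t : R => (u + RtoC t * (v - u))%C).
  assert (Hp0 : pt 0 = u) by (unfold pt; ring). assert (Hp1 : pt 1 = v) by (unfold pt; ring).
  destruct (completeness (fun t => 0 <= t <= 1 /\ Om (pt t))) as [ts [Hub Hlub]].
  { exists 1. intros t [Ht _]. lra. }
  { exists 0. split; [lra|]. now rewrite Hp0. }
  assert (Ht0 : 0 <= ts) by (apply Hub; split; [lra|now rewrite Hp0]).
  assert (Ht1 : ts <= 1) by (apply Hlub; intros t [Ht _]; lra).
  pose proof (Cmod_ge_0 (v - u)%C) as Hvu.
  assert (Hnear : forall m, 0 < m -> exists d, 0 < d /\ forall t, Rabs (t - ts) < d -> Cmod (pt t - pt ts)%C < m).
  { intros m Hm. exists (m / (Cmod (v - u)%C + 1)). split; [apply Rdiv_lt_0_compat; lra|]. intros t Ht.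
    unfold pt. replace (u + t * (v - u) - (u + ts * (v - u)))%C with (RtoC (t - ts) * (v - u))%C by (rewrite RtoC_minus; ring).
    rewrite Cmod_mult, Cmod_R. apply (Rmult_lt_compat_r (Cmod (v - u)%C + 1)) in Ht; [|lra].
    replace (m / (Cmod (v - u)%C + 1) * (Cmod (v - u)%C + 1)) with m in Ht by (field; lra).
    pose proof (Rabs_pos (t - ts)). nra. }
  exists (pt ts). split; intros H; apply locally_C_Cmod in H as [m [Hm H]]; destruct (Hnear m Hm) as [d [Hd Hd']].
  - destruct (Rle_lt_or_eq_dec ts 1 Ht1) as [L|E].
    + set (t := Rmin 1 (ts + d / 2)).
      assert (Ht : ts < t <= 1) by (split; [apply Rmin_glb_lt; lra|apply Rmin_l]).
      assert (t <= ts + d / 2) by apply Rmin_r.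
      assert (t <= ts); [|lra]. apply Hub. split; [lra|]. apply H, Hd'. rewrite Rabs_right; lra.
    + apply Hv. rewrite <- Hp1, <- E. apply H. replace (pt ts - pt ts)%C with (RtoC 0) by ring. now rewrite Cmod_0.
  - assert (exists t, (0 <= t <= 1 /\ Om (pt t)) /\ ts - d < t) as [t [[Ht Ho] Htd]].
    { apply NNPP. intros Hn. assert (ts <= ts - d); [|lra]. apply Hlub. intros t Ht.
      apply Rnot_lt_le. intros L. apply Hn. now exists t. }
    apply (H (pt t)); [|exact Ho]. apply Hd'. assert (t <= ts) by now apply Hub. apply Rabs_def1; lra.
Qed.

Lemma Glb_Rbar_approx (S : R -> Prop) (x0 eps : R) :
  S x0 -> (forall x, S x -> 0 <= x) -> 0 < eps -> exists x, S x /\ x < real (Glb_Rbar S) + eps.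
Proof.
  intros Hx0 Hpos He. destruct (Glb_Rbar_correct S) as [Hlb Hgl].
  assert (H0 : Rbar_le 0 (Glb_Rbar S)) by (apply Hgl; intros x Hx; apply (Hpos x Hx)).
  assert (H1 : Rbar_le (Glb_Rbar S) x0) by (apply Hlb, Hx0).
  destruct (Glb_Rbar S) as [g| |]; simpl in *; try contradiction.
  apply NNPP. intros Hn. assert (Hb : Rbar_le (g + eps) g); [|simpl in Hb; lra].
  apply Hgl. intros x Hx. simpl. apply Rnot_lt_le. intros L. apply Hn. now exists x.
Qed.

(** The image is open, so a boundary point that almost realises the distance belongs to the
    complement. *)
Lemma near_complement (alpha : R) (phi : C -> C) (w0 : C) (eps : R) :
  concave_univalent alpha phi -> ~ disc_image phi w0 -> 0 < eps ->
  exists p, ~ disc_image phi p /\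
    Cmod (p - phi 0%C)%C < dist_to_set (phi 0%C) (boundary (disc_image phi)) + eps.
Proof.
  intros Hc Hw0 He.
  assert (H00 : disc_image phi (phi 0%C)) by (exists 0%C; split; [unfold unit_disc; rewrite Cmod_0; lra|reflexivity]).
  destruct (boundary_on_segment _ _ _ H00 Hw0) as [w Hw].
  destruct (Glb_Rbar_approx (fun d => exists w, boundary (disc_image phi) w /\ d = Cmod (w - phi 0%C)%C) (Cmod (w - phi 0%C)%C) eps) as [x [[p [Hp ->]] Hx]].
  - now exists w.
  - intros x [y [_ ->]]. apply Cmod_ge_0.
  - exact He.
  - exists p. split; [|exact Hx]. intros Hi. apply (proj1 Hp). apply locally_C_Cmod.
    now apply (image_open alpha phi p Hc).
Qed.

Lemma dist_to_set_ge_0 (p : C) (S : C -> Prop) : 0 <= dist_to_set p S.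
Proof.
  unfold dist_to_set. destruct (Glb_Rbar_correct (fun d => exists w, S w /\ d = Cmod (w - p)%C)) as [_ H].
  assert (H0 : Rbar_le 0 (Glb_Rbar (fun d => exists w, S w /\ d = Cmod (w - p)%C))).
  { apply H. intros x [w [_ ->]]. apply Cmod_ge_0. }
  destruct (Glb_Rbar _); simpl in *; lra.
Qed.

(** Transport of a recession direction from [p'] to [p]: the point at the fraction [s / S] of the
    segment from [p] to the far point tends to [p + s e^(i t)] as [S] grows. *)
Lemma segment_to_far_point (E : C -> Prop) (p p' : C) (s t S : R) :
  convex_set E -> E p -> 0 <= s -> 0 < S -> s <= S -> E (p' + RtoC S * cis 1 t)%C ->
  exists q, E q /\ Cmod (q - (p + RtoC s * cis 1 t))%C <= s / S * Cmod (p' - p)%C.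
Proof.
  intros Hc Hp Hs HS HsS Hv. set (x := s / S).
  assert (Hx : 0 <= x <= 1).
  { unfold x. split; [apply Rdiv_le_0_compat; lra|]. apply Rmult_le_reg_r with S; [exact HS|]. unfold Rdiv. rewrite Rmult_assoc, Rinv_l; lra. }
  eexists. split; [exact (Hc p _ x Hp Hv Hx)|].
  replace (RtoC (1 - x) * p + RtoC x * (p' + S * cis 1 t) - (p + s * cis 1 t))%C with (RtoC x * (p' - p))%C.
  - rewrite Cmod_mult, Cmod_R, Rabs_right by lra. lra.
  - rewrite RtoC_minus. replace (RtoC s) with (RtoC x * RtoC S)%C by (rewrite <- RtoC_mult; f_equal; unfold x; field; lra). ring.
Qed.

Lemma cis_eq_range (x y : R) : 0 < x - y < 2 * PI -> cis 1 x <> cis 1 y.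
Proof.
  intros H E. rewrite !cis_1 in E. injection E as E1 E2.
  assert (x - y = 0); [|lra]. apply cos_eq_1_0; [lra|]. rewrite cos_minus, E1, E2.
  pose proof (sin2_cos2 y). unfold Rsqr in *. lra.
Qed.

(** Far out the image lies in a sector with vertex [p'] and opening less than [a PI], so the far
    part of the opposite cone at [p'] is omitted. Convexity and closedness of the complement carry
    the whole cone to every vertex [p]. *)
Lemma cone_from_angle (alpha a : R) (phi : C -> C) :
  concave_univalent alpha phi -> 1 <= alpha -> alpha < a <= 2 ->
  exists t1, (exists w, ~ disc_image phi w) /\ forall p s dt, ~ disc_image phi p -> 0 <= s -> Rabs dt <= (2 - a) * PI / 2 ->
    ~ disc_image phi (p + RtoC s * cis 1 (t1 + dt))%C.
Proof.
  intros Hc Ha1 Ha. pose proof PI_RGT_0 as Hpi.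
  set (S := fun gamma : R => 0 <= gamma /\ exists (p : C) (t0 rho : R),
      forall w : C, disc_image phi w -> rho < Cmod w -> sector p t0 gamma w).
  (* Without an element the infimum would be infinite and [real] would return 0. *)
  assert (HS2 : S (2 * PI)).
  { split; [lra|]. exists 0%C, 0, 0. intros w _ _. destruct (C_polar w) as [t [Ht E]].
    exists (Cmod w), t. split; [apply Cmod_ge_0|]. split; [apply Rabs_le; lra|]. rewrite E at 1. ring. }
  destruct (Glb_Rbar_approx S (2 * PI) (PI * (a - alpha))) as [g [[Hg0 [p' [t0 [rho Hsec]]]] Hg]].
  - exact HS2.
  - intros x [Hx _]. exact Hx.
  - apply Rmult_lt_0_compat; lra.
  - pose proof (cu_angle _ _ Hc) as Hang. unfold opening_angle_at_infinity in Hang. fold S in Hang.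
    assert (Hga : g < PI * a) by lra.
    exists (t0 + PI).
    assert (Hfar : forall dt R0, Rabs dt <= (2 - a) * PI / 2 -> exists S0, 0 < S0 /\ forall S1, S0 < S1 -> R0 < S1 /\ ~ disc_image phi (p' + RtoC S1 * cis 1 (t0 + PI + dt))%C).
    { intros dt R0 Hdt. apply Rabs_le_between in Hdt.
      exists (Rabs R0 + Rabs rho + Cmod p' + 1). pose proof (Rabs_pos R0). pose proof (Rabs_pos rho). pose proof (Cmod_ge_0 p').
      pose proof (Rle_abs R0). pose proof (Rle_abs rho).
      split; [lra|]. intros S1 HS1. split; [lra|]. intros Hi.
      set (v := (p' + RtoC S1 * cis 1 (t0 + PI + dt))%C) in *.
      assert (Hv : rho < Cmod v).
      { assert (Ht : Cmod (RtoC S1 * cis 1 (t0 + PI + dt))%C <= Cmod v + Cmod p').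
        { rewrite <- (Cmod_opp p'). eapply Rle_trans; [|apply Cmod_triangle]. right. f_equal. unfold v. ring. }
        rewrite Cmod_mult, Cmod_cis, Cmod_R, Rabs_right in Ht by lra. lra. }
      destruct (Hsec v Hi Hv) as [s' [t' [Hs' [Ht' Ev]]]]. unfold v in Ev. rewrite <- cis_1 in Ev.
      assert (Ev2 : (RtoC S1 * cis 1 (t0 + PI + dt))%C = (RtoC s' * cis 1 t')%C).
      { replace (RtoC S1 * cis 1 (t0 + PI + dt))%C with ((p' + RtoC S1 * cis 1 (t0 + PI + dt)) - p')%C by ring. rewrite Ev. ring. }
      assert (Es : s' = S1).
      { apply (f_equal Cmod) in Ev2. rewrite !Cmod_mult, !Cmod_cis, !Cmod_R, !Rabs_right in Ev2 by lra. lra. }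
      subst s'. apply Rabs_le_between in Ht'.
      (* The two angles differ by [PI + dt - (t' - t0)], where [|dt| + |t' - t0| < (2 - a) PI / 2 +
         a PI / 2 = PI]. *)
      apply (cis_eq_range (t0 + PI + dt) t'); [lra|].
      assert (HS0 : RtoC S1 <> 0%C) by (apply RtoC_neq_0; lra).
      replace (cis 1 (t0 + PI + dt)) with (/ RtoC S1 * (RtoC S1 * cis 1 (t0 + PI + dt)))%C by (field; exact HS0).
      rewrite Ev2. field. exact HS0. }
    split.
    { destruct (Hfar 0 0) as [S0 [HS0 H]]. { rewrite Rabs_R0. assert (0 <= (2 - a) * PI) by (apply Rmult_le_pos; lra). lra. }
      destruct (H (S0 + 1)) as [_ Hw]; [lra|]. eexists; exact Hw. }
    intros p s dt Hp Hs Hdt Hi.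
    destruct (image_open _ _ _ Hc Hi) as [m [Hm Hball]].
    pose proof (Cmod_ge_0 (p' - p)%C) as Hpp.
    (* Far enough for the error [s |p' - p| / S1] of [segment_to_far_point] to be smaller than
       [m]. *)
    destruct (Hfar dt (s + s * Cmod (p' - p)%C / m) Hdt) as [S0 [HS0 H]].
    destruct (H (S0 + 1)) as [H1 H2]; [lra|].
    assert (Hq0 : 0 <= s * Cmod (p' - p)%C / m) by (apply Rdiv_le_0_compat; [apply Rmult_le_pos; lra|exact Hm]).
    destruct (segment_to_far_point (fun w => ~ disc_image phi w) p p' s (t0 + PI + dt) (S0 + 1) (cu_convex _ _ Hc) Hp Hs) as [q [Hq Hqd]]; [lra|lra|exact H2|].
    apply Hq, Hball. eapply Rle_lt_trans; [exact Hqd|].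
    apply Rmult_lt_reg_r with (S0 + 1); [lra|].
    replace (s / (S0 + 1) * Cmod (p' - p)%C * (S0 + 1)) with (s * Cmod (p' - p)%C) by (field; lra).
    assert (Hlt : s * Cmod (p' - p)%C / m < S0 + 1) by lra.
    apply (Rmult_lt_compat_r m) in Hlt; [|exact Hm].
    replace (s * Cmod (p' - p)%C / m * m) with (s * Cmod (p' - p)%C) in Hlt by (field; lra). lra.
Qed.

Lemma concave_at_infinity (alpha : R) (phi : C -> C) : concave_univalent alpha phi ->
  forall M, exists d, 0 < d /\ forall z, unit_disc z -> Cmod (z - 1)%C < d -> M < Cmod (phi z).
Proof.
  intros Hc M. pose proof (cu_infinity _ _ Hc (fun y => M < y)) as H.
  assert (HP : Rbar_locally p_infty (fun y => M < y)) by (exists M; auto).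
  specialize (H HP). unfold filtermap, within in H.
  apply locally_C_Cmod in H as [d [Hd H]]. exists d. split; [exact Hd|]. intros z Hz Hzd. now apply H.
Qed.

(** The directions from [p] to omitted points tending to infinity accumulate at some [t1]. A point
    of the image on that ray would have a neighbourhood in the image, which the segments to those
    omitted points meet. *)
Lemma ray_from_unbounded (alpha : R) (phi : C -> C) (p : C) :
  concave_univalent alpha phi -> (forall R0, exists w, R0 < Cmod w /\ ~ disc_image phi w) ->
  ~ disc_image phi p ->
  exists t1, forall s, 0 <= s -> ~ disc_image phi (p + RtoC s * cis 1 t1)%C.
Proof.
  intros Hc Hunb Hp. pose proof PI_RGT_0 as Hpi.
  assert (K : forall n : nat, exists t : R, (-PI <= t <= PI) /\ exists S, INR n < S /\ ~ disc_image phi (p + RtoC S * cis 1 t)%C).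
  { intros n. destruct (Hunb (INR n + Cmod p)) as [w [Hw Hn]].
    destruct (C_polar_cis (w - p)%C) as [t [Ht E]]. exists t. split; [lra|]. exists (Cmod (w - p)%C). split.
    - assert (Cmod w <= Cmod (w - p)%C + Cmod p); [|lra].
      replace w with ((w - p) + p)%C at 1 by ring. apply Cmod_triangle.
    - rewrite <- E. replace (p + (w - p))%C with w by ring. exact Hn. }
  apply choice in K as [tau Htau].
  destruct (Bolzano_Weierstrass tau (fun x => -PI <= x <= PI)) as [t1 Ht1].
  - apply compact_P3.
  - intros n. apply Htau.
  - exists t1. intros s Hs Hi.
    destruct (image_open _ _ _ Hc Hi) as [m [Hm Hball]].
    assert (Hm2 : 0 < m / (s + 1)) by (apply Rdiv_lt_0_compat; lra).
    destruct (cder_cont _ _ _ (cder_cexp (0, t1)) _ Hm2) as [d [Hd Hcont]].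
    destruct (INR_unbounded s) as [N HN].
    destruct (Ht1 (disc t1 (mkposreal d Hd)) N) as [n [Hn Hdisc]].
    { exists (mkposreal d Hd). intros x Hx; exact Hx. }
    destruct (Htau n) as [_ [S [HS Hnot]]].
    assert (HNn : INR N <= INR n) by (apply le_INR; exact Hn).
    destruct (segment_to_far_point (fun w => ~ disc_image phi w) p p s (tau n) S (cu_convex _ _ Hc) Hp Hs) as [q [Hq Hqd]]; [lra|lra|exact Hnot|].
    replace (p - p)%C with (RtoC 0) in Hqd by ring. rewrite Cmod_0, Rmult_0_r in Hqd.
    apply Hq, Hball.
    assert (Eq : q = (p + s * cis 1 (tau n))%C).
    { apply Cminus_eq_0, Cmod_eq_0, Rle_antisym; [exact Hqd|apply Cmod_ge_0]. }
    rewrite Eq. replace (p + s * cis 1 (tau n) - (p + s * cis 1 t1))%C with (RtoC s * (cis 1 (tau n) - cis 1 t1))%C by ring.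
    rewrite Cmod_mult, Cmod_R, Rabs_right by lra.
    assert (Hd2 : Cmod (cis 1 (tau n) - cis 1 t1)%C < m / (s + 1)).
    { rewrite !cis_cexp. apply Hcont. eapply Rle_lt_trans; [apply (Cmod_le_Rabs (0 - 0) (tau n - t1))|].
      replace (0 - 0) with 0 by ring. rewrite Rabs_R0, Rplus_0_l. exact Hdisc. }
    apply (Rmult_lt_compat_l (s + 1)) in Hd2; [|lra].
    replace ((s + 1) * (m / (s + 1))) with m in Hd2 by (field; lra).
    pose proof (Cmod_ge_0 (cis 1 (tau n) - cis 1 t1)%C). nra.
Qed.

(** [((1 + r) / (1 - r))^a - 1], in a form that is visibly smooth in both [a] and [r]. *)
Definition sector_growth (a r : R) : R := exp (a * (ln (1 + r) - ln (1 - r))) - 1.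

Lemma omitted_cone_majorant (A : nat -> C) (h : C -> C) (p : C) (a t1 r : R) (N : nat) :
  pser A h -> 1 <= a <= 2 ->
  (forall z s dt, unit_disc z -> 0 <= s -> Rabs dt <= (2 - a) * PI / 2 -> h z <> (p + RtoC s * cis 1 (t1 + dt))%C) ->
  0 <= r <= 1 / 3 ->
  rsum (fun j => Cmod (A (S j)) * r ^ S j) N <= Cmod (p - h 0%C)%C * sector_growth a r.
Proof.
  intros HA Ha Hom Hr. pose proof PI_RGT_0 as Hpi.
  assert (Hdl : 0 <= (2 - a) * PI / 2) by (assert (0 <= (2 - a) * PI) by (apply Rmult_le_pos; lra); lra).
  assert (H00 : unit_disc 0%C) by (unfold unit_disc; rewrite Cmod_0; lra).
  set (k := (h 0%C - p)%C).
  assert (Hk : k <> 0%C).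
  { intros E. apply (Hom 0%C 0 0 H00); [lra|rewrite Rabs_R0; exact Hdl|].
    apply Cminus_eq_0 in E. rewrite E. ring. }
  pose proof (proj1 (Cmod_gt_0 k) Hk) as Hkm.
  destruct (C_polar_cis k) as [t0 [_ Ek]].
  (* Division by [k], of argument [t0], turns the axis direction [t1] into [t1 - t0]. It is written
     as [t2 + PI], and the polar form reduces [t2] to the range [-PI < t2 <= PI]. *)
  destruct (C_polar_cis (cis 1 (t1 - t0 - PI))) as [t2 [Ht2 Et2]].
  rewrite Cmod_cis in Et2 by lra. replace (1 * cis 1 t2)%C with (cis 1 t2) in Et2 by ring.
  set (u := fun z => (/ k * h z + - (p / k) * 1)%C).
  set (U := fun n => (/ k * A n + - (p / k) * (if Nat.eqb n 0 then RtoC 1 else RtoC 0))%C).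
  assert (H1 : pser (fun n => if Nat.eqb n 0 then RtoC 1 else RtoC 0) (fun _ => 1%C)).
  { intros z _ e He. exists 1%nat. intros [|n] Hn; [lia|].
    replace (csum _ (S n)) with (RtoC 1). { replace (1 - 1)%C with (RtoC 0) by ring. now rewrite Cmod_0. }
    rewrite csum_first. simpl. rewrite (csum_ext _ (fun _ => RtoC 0)) by (intros; ring).
    replace (csum (fun _ => RtoC 0) n) with (RtoC 0); [ring|].
    clear. induction n as [|n IH]; [reflexivity|]. simpl. rewrite <- IH. ring. }
  assert (HU : pser U u).
  { exact (pser_lin _ _ _ _ (/ k)%C (- (p / k))%C HA H1). }
  assert (Hmaj : rsum (fun j => Cmod (U (S j)) * r ^ S j) N <= exp (a * (ln (1 + r) - ln (1 - r))) - 1).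
  { apply (sector_omitting_majorant U u a t2 r N HU); auto.
    - unfold u, k. field. exact Hk.
    - intros z s dt Hz Hs Hdt E.
      apply (Hom z (s * Cmod k) dt Hz); [apply Rmult_le_pos; lra|exact Hdt|].
      replace (h z) with (p + k * u z)%C by (unfold u; field; exact Hk). rewrite E. f_equal.
      rewrite Ek at 1. rewrite RtoC_mult.
      replace (t2 + PI + dt) with (t2 + (PI + dt)) by ring. rewrite cis_add, <- Et2.
      replace (Cmod k * cis 1 t0 * (s * (cis 1 (t1 - t0 - PI) * cis 1 (PI + dt))))%C with
        (s * Cmod k * (cis 1 t0 * (cis 1 (t1 - t0 - PI) * cis 1 (PI + dt))))%C by ring.
      f_equal. rewrite <- !cis_add. f_equal. ring. }
  rewrite Cmod_sub_sym. fold k. unfold sector_growth.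
  apply Rle_trans with (Cmod k * rsum (fun j => Cmod (U (S j)) * r ^ S j) N).
  - rewrite <- rsum_scal. right. apply rsum_ext. intros j _. unfold U. simpl Nat.eqb. cbv iota.
    replace (/ k * A (S j) + - (p / k) * 0)%C with (/ k * A (S j))%C by ring.
    rewrite Cmod_mult, Cmod_inv by exact Hk. field. lra.
  - apply Rmult_le_compat_l; lra.
Qed.

(** * The upper bound *)

Lemma half_log_ge_0 (r : R) : 0 <= r < 1 -> 0 <= ln (1 + r) - ln (1 - r).
Proof. intros H. assert (ln (1 - r) <= ln (1 + r)) by (apply ln_le; lra). lra. Qed.

Lemma exp_le (x y : R) : x <= y -> exp x <= exp y.
Proof. intros [H|H]; [left; now apply exp_increasing|rewrite H; lra]. Qed.

Lemma sector_growth_ge_0 (a r : R) : 0 <= a -> 0 <= r < 1 -> 0 <= sector_growth a r.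
Proof.
  intros Ha Hr. unfold sector_growth.
  assert (H : exp 0 <= exp (a * (ln (1 + r) - ln (1 - r)))).
  { apply exp_le. apply Rmult_le_pos; [exact Ha|now apply half_log_ge_0]. }
  rewrite exp_0 in H. lra.
Qed.

Lemma perturbation_limit (x d alpha l s0 : R) : 0 < s0 ->
  (forall s, 0 < s < s0 -> x <= (d + s) * (exp ((alpha + s) * l) - 1)) -> x <= d * (exp (alpha * l) - 1).
Proof.
  intros Hs0 H. apply Rnot_lt_le. intros Hlt.
  set (g := fun s => (d + s) * (exp ((alpha + s) * l) - 1)).
  assert (Hc : continuity_pt g 0).
  { apply derivable_continuous_pt. eexists. apply is_derive_Reals. unfold g. auto_derive; [exact I|reflexivity]. }
  assert (G0 : g 0 = d * (exp (alpha * l) - 1)) by (unfold g; rewrite !Rplus_0_r; reflexivity).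
  destruct (Hc (x - g 0)) as [e [He H']]; [rewrite G0; lra|].
  set (s := Rmin (s0 / 2) (e / 2)).
  assert (Hs : 0 < s) by (apply Rmin_pos; lra).
  assert (s <= s0 / 2) by apply Rmin_l. assert (s <= e / 2) by apply Rmin_r.
  specialize (H s ltac:(lra)). fold (g s) in H.
  assert (Hd : Rabs (g s - g 0) < x - g 0).
  { apply (H' s). split; [split; [exact I|lra]|]. simpl. unfold Rdist. rewrite Rminus_0_r, Rabs_right; lra. }
  apply Rabs_def2 in Hd. lra.
Qed.

(** Chain rule [h'(0) = phi'(0) w'(0)]: local univalence of [h] gives [phi'(0) <> 0] without the
    theorem that univalent maps have no critical points. *)
Lemma derivative_at_0_neq_0 (phi h w : C -> C) :
  analytic_on_disc phi -> analytic_on_disc w -> analytic_on_disc h -> w 0%C = 0%C ->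
  (forall z, unit_disc z -> h z = phi (w z)) -> C_derive h 0%C <> 0%C ->
  exists l, cder phi 0%C l /\ l <> 0%C.
Proof.
  intros Hp Hw Hh Hw0 E Hne. assert (H00 : unit_disc 0%C) by (unfold unit_disc; rewrite Cmod_0; lra).
  destruct (analytic_diff_on _ Hp _ H00) as [l Hl]. destruct (analytic_diff_on _ Hw _ H00) as [lw Hlw].
  exists l. split; [exact Hl|]. intros ->. apply Hne.
  apply is_C_derive_unique. apply cder_is_derive.
  apply cder_ext_loc with (fun z => phi (w z)) 1; [lra| |].
  - intros z Hz. symmetry. apply E. unfold unit_disc. replace (z - 0)%C with z in Hz by ring. exact Hz.
  - apply cder_eq with (0 * lw)%C; [|ring]. apply (cder_comp phi w); [rewrite Hw0; exact Hl|exact Hlw].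
Qed.

Lemma has_coefficients_pser (h : C -> C) (a : nat -> C) : has_coefficients h a <-> pser a h.
Proof. split; intros H z Hz; apply is_pseries_iff, H, Hz. Qed.

Lemma admissible_majorant (K alpha r : R) (f h g : C -> C) (a b : nat -> C) (phi : C -> C) (N : nat) :
  1 <= alpha <= 2 -> admissible K alpha f h g a b phi -> 0 <= r <= 1 / 3 ->
  rsum (fun j => Cmod (a (S j)) * r ^ S j) N
  <= dist_to_set (phi 0%C) (boundary (disc_image phi)) * sector_growth alpha r.
Proof.
  intros Ha Had Hr. set (d := dist_to_set _ _).
  pose proof (adm_phi _ _ _ _ _ _ _ _ Had) as Hc. pose proof (adm_harmonic _ _ _ _ _ _ _ _ Had) as Hq.
  destruct (adm_subordinate _ _ _ _ _ _ _ _ Had) as [w [Hwa [Hwd [Hw0 Hhw]]]].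
  pose proof (proj1 (has_coefficients_pser _ _) (adm_h _ _ _ _ _ _ _ _ Had)) as Hps.
  assert (H00 : unit_disc 0%C) by (unfold unit_disc; rewrite Cmod_0; lra).
  assert (Eh0 : h 0%C = phi 0%C) by (rewrite Hhw by exact H00; now rewrite Hw0).
  assert (Him : forall z, unit_disc z -> disc_image phi (h z)).
  { intros z Hz. exists (w z). split; [now apply Hwd|]. symmetry. now apply Hhw. }
  assert (Hd : 0 <= d) by apply dist_to_set_ge_0.
  (* At [alpha = 2] the ray gives the exponent [alpha] itself and [s] is spent on the distance only;
     the exponent is then enlarged to [alpha + s], so that both cases end in the same limit. *)
  assert (Main : forall s, 0 < s < 1 -> alpha + s <= 2 \/ alpha = 2 ->
    rsum (fun j => Cmod (a (S j)) * r ^ S j) N <= (d + s) * sector_growth (alpha + s) r).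
  { intros s Hs Hcase. destruct (Req_dec alpha 2) as [E2|Hne].
    - destruct (derivative_at_0_neq_0 phi h w (cu_analytic _ _ Hc) Hwa (qc_analytic_h _ _ _ _ Hq) Hw0 Hhw
        (qc_locally_univalent _ _ _ _ Hq _ H00)) as [l [Hl Hl0]].
      assert (Hunb : forall R0, exists w, R0 < Cmod w /\ ~ disc_image phi w).
      { intros R0. apply (complement_unbounded phi l R0); auto.
        - exact (analytic_diff_on _ (cu_analytic _ _ Hc)).
        - exact (cu_injective _ _ Hc).
        - exact (concave_at_infinity _ _ Hc). }
      destruct (Hunb 0) as [w0 [_ Hw0n]].
      destruct (near_complement alpha phi w0 s Hc Hw0n) as [p [Hp Hpd]]; [lra|]. fold d in Hpd.
      destruct (ray_from_unbounded alpha phi p Hc Hunb Hp) as [t1 Ht1].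
      eapply Rle_trans; [apply (omitted_cone_majorant a h p alpha t1 r N Hps Ha)|].
      + intros z x dt Hz Hx Hdt E. rewrite E2 in Hdt. replace ((2 - 2) * PI / 2) with 0 in Hdt by field.
        assert (dt = 0) by (apply Rabs_le_between in Hdt; lra). subst dt. rewrite Rplus_0_r in E.
        apply (Ht1 x Hx). rewrite <- E. now apply Him.
      + exact Hr.
      + rewrite Eh0. apply Rmult_le_compat; [apply Cmod_ge_0|apply sector_growth_ge_0; lra|lra|].
        unfold sector_growth. apply Rplus_le_compat_r, exp_le. apply Rmult_le_compat_r; [apply half_log_ge_0; lra|lra].
    - destruct Hcase as [Hcase|]; [|contradiction].
      destruct (cone_from_angle alpha (alpha + s) phi Hc) as [t1 [[w0 Hw0n] Ht1]]; [lra|lra|].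
      destruct (near_complement alpha phi w0 s Hc Hw0n) as [p [Hp Hpd]]; [lra|]. fold d in Hpd.
      eapply Rle_trans; [apply (omitted_cone_majorant a h p (alpha + s) t1 r N Hps)|].
      + lra.
      + intros z x dt Hz Hx Hdt E. apply (Ht1 p x dt Hp Hx Hdt). rewrite <- E. now apply Him.
      + exact Hr.
      + rewrite Eh0. apply Rmult_le_compat_r; [apply sector_growth_ge_0; lra|lra]. }
  unfold sector_growth. destruct (Req_dec alpha 2) as [E2|Hne].
  - apply (perturbation_limit _ d alpha _ 1); [lra|]. intros s Hs. apply Main; auto.
  - apply (perturbation_limit _ d alpha _ (Rmin 1 (2 - alpha))); [apply Rmin_pos; lra|]. intros s Hs.
    pose proof (Rmin_l 1 (2 - alpha)). pose proof (Rmin_r 1 (2 - alpha)). apply Main; [lra|left; lra].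
Qed.

(** Bohr's theorem is applied to [g' = omega h']; integration from 0 to [r] removes the weights
    [n + 1] of the differentiated series. *)
Lemma integrate_majorant (u v : nat -> R) (k r : R) (N : nat) : 0 <= r ->
  (forall x, 0 <= x <= r -> rsum (fun n => INR (S n) * u (S n) * x ^ n) N <= k * rsum (fun n => INR (S n) * v (S n) * x ^ n) N) ->
  rsum (fun j => u (S j) * r ^ S j) N <= k * rsum (fun j => v (S j) * r ^ S j) N.
Proof.
  intros Hr H.
  set (e := fun n => match n with O => 0 | S _ => u n - k * v n end).
  assert (E1 : forall x, rsum (fun n => e n * x ^ n) (S N) = rsum (fun j => u (S j) * x ^ S j) N - k * rsum (fun j => v (S j) * x ^ S j) N).
  { intros x. clear. induction N as [|N IH]; [simpl; ring|].
    change (rsum (fun n => e n * x ^ n) (S (S N))) with (rsum (fun n => e n * x ^ n) (S N) + e (S N) * x ^ S N).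
    rewrite IH. cbn [rsum]. unfold e. ring. }
  assert (E2 : forall x, rsum (fun n => INR (S n) * e (S n) * x ^ n) N =
     rsum (fun n => INR (S n) * u (S n) * x ^ n) N - k * rsum (fun n => INR (S n) * v (S n) * x ^ n) N).
  { intros x. unfold e. clear. induction N as [|N IH]; [simpl; ring|].
    cbn [rsum]. rewrite IH. ring. }
  assert (D : rsum (fun n => e n * r ^ n) (S N) <= rsum (fun n => e n * 0 ^ n) (S N)).
  { apply (decreasing_from_0 (fun x => rsum (fun n => e n * x ^ n) (S N)) (fun x => rsum (fun n => INR (S n) * e (S n) * x ^ n) N)); [exact Hr| |].
    - intros x Hx. apply rsum_deriv.
    - intros x Hx. rewrite E2. specialize (H x Hx). lra. }
  rewrite !E1 in D.
  assert (Z : forall q : nat -> R, rsum (fun j => q (S j) * 0 ^ S j) N = 0).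
  { intros q. rewrite (rsum_ext _ (fun _ => 0)) by (intros; simpl; ring). clear. induction N; simpl; lra. }
  rewrite !Z in D. lra.
Qed.

Lemma admissible_g_majorant (K alpha r : R) (f h g : C -> C) (a b : nat -> C) (phi : C -> C) (N : nat) :
  admissible K alpha f h g a b phi -> 0 <= r <= 1 / 3 ->
  rsum (fun j => Cmod (b (S j)) * r ^ S j) N <= (K - 1) / (K + 1) * rsum (fun j => Cmod (a (S j)) * r ^ S j) N.
Proof.
  intros Had Hr. pose proof (adm_harmonic _ _ _ _ _ _ _ _ Had) as Hq.
  pose proof (proj1 (has_coefficients_pser _ _) (adm_h _ _ _ _ _ _ _ _ Had)) as Ha.
  pose proof (proj1 (has_coefficients_pser _ _) (adm_g _ _ _ _ _ _ _ _ Had)) as Hb.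
  destruct (pser_deriv _ _ Ha) as [h1 [Hh1 Dh]]. destruct (pser_deriv _ _ Hb) as [g1 [Hg1 Dg]].
  assert (Eh : forall z, unit_disc z -> C_derive h z = h1 z) by (intros z Hz; apply is_C_derive_unique, cder_is_derive, Dh, Hz).
  assert (Eg : forall z, unit_disc z -> C_derive g z = g1 z) by (intros z Hz; apply is_C_derive_unique, cder_is_derive, Dg, Hz).
  assert (Hn : forall z, unit_disc z -> h1 z <> 0%C) by (intros z Hz; rewrite <- Eh by exact Hz; now apply (qc_locally_univalent _ _ _ _ Hq)).
  apply (integrate_majorant (fun n => Cmod (b n)) (fun n => Cmod (a n))); [lra|].
  intros x Hx.
  pose proof (dilatation_majorant _ _ h1 g1 (fun z => g1 z / h1 z)%C ((K - 1) / (K + 1)) x N Hh1 Hg1) as HM.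
  rewrite (rsum_ext _ (fun n => Cmod (INR (S n) * b (S n))%C * x ^ n)).
  2: { intros n _. rewrite Cmod_mult, Cmod_R, Rabs_right by apply Rle_ge, pos_INR. ring. }
  rewrite (rsum_ext (fun n => INR (S n) * Cmod (a (S n)) * x ^ n) (fun n => Cmod (INR (S n) * a (S n))%C * x ^ n)).
  2: { intros n _. rewrite Cmod_mult, Cmod_R, Rabs_right by apply Rle_ge, pos_INR. ring. }
  apply HM.
  - apply diff_div; [exact (pser_diff _ _ Hg1)|exact (pser_diff _ _ Hh1)|exact Hn].
  - intros z Hz. rewrite <- Eh, <- Eg by exact Hz. now apply (qc_quasiconformal _ _ _ _ Hq).
  - intros z Hz. specialize (Hn z Hz). field. exact Hn.
  - lra.
Qed.

Lemma sum_n_rsum (f : nat -> R) (n : nat) : sum_n f n = rsum f (S n).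
Proof.
  induction n as [|n IH]; [rewrite sum_O; simpl; ring|]. rewrite sum_Sn, IH. reflexivity.
Qed.

(** Convergence is not established separately: the two bounds on the partial sums exclude the
    infinite values of [Lim_seq]. *)
Lemma Series_le_bound (f : nat -> R) (M : R) : (forall n, 0 <= f n) -> (forall n, rsum f n <= M) -> Series f <= M.
Proof.
  intros H0 H. unfold Series.
  assert (L1 : Rbar_le (Lim_seq (sum_n f)) (Lim_seq (fun _ => M))).
  { apply Lim_seq_le_loc. exists 0%nat. intros n _. rewrite sum_n_rsum. apply H. }
  assert (L2 : Rbar_le (Lim_seq (fun _ => 0)) (Lim_seq (sum_n f))).
  { apply Lim_seq_le_loc. exists 0%nat. intros n _. rewrite sum_n_rsum. apply rsum_ge_0. intros; apply H0. }
  rewrite Lim_seq_const in L1, L2. destruct (Lim_seq (sum_n f)); simpl in *; try contradiction; exact L1.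
Qed.

Lemma f_alpha_growth (alpha r : R) : 0 <= r < 1 -> f_alpha alpha r = 1 / (2 * alpha) * sector_growth alpha r.
Proof.
  intros Hr. unfold f_alpha, sector_growth, Rpower. rewrite ln_div by lra. reflexivity.
Qed.

(** [|h (z^m)|] is at most [|a_0|] plus the majorant series at [r^m]. Apart from [|a_0| = |phi 0|],
    everything is thus bounded by multiples of [d], and the condition on the growths says that these
    multiples add up to at most 1. *)
Lemma bohr_upper (K alpha lambda : R) (m : nat) (f h g : C -> C) (a b : nat -> C) (phi : C -> C) (z : C) :
  1 <= K -> 1 <= alpha <= 2 -> 0 < lambda -> (1 <= m)%nat ->
  admissible K alpha f h g a b phi -> Cmod z <= 1 / 3 ->
  sector_growth alpha (Cmod z ^ m) + 2 * K * lambda / (K + 1) * sector_growth alpha (Cmod z) <= 1 ->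
  bohr_inequality lambda m h a b phi z.
Proof.
  intros HK Ha Hl Hm Had Hz Hrad. unfold bohr_inequality.
  change (phi (RtoC 0)) with (phi 0%C). set (d := dist_to_set _ _).
  pose proof (Cmod_ge_0 z) as Hz0. set (r := Cmod z) in *.
  pose proof (dist_to_set_ge_0 (phi 0%C) (boundary (disc_image phi))) as Hd. fold d in Hd.
  assert (Hrm0 : 0 <= r ^ m) by (apply pow_le; lra).
  assert (Hrm : r ^ m <= 1 / 3).
  { destruct m as [|m]; [lia|]. simpl. assert (r ^ m <= 1) by (rewrite <- (pow1 m); apply pow_incr; lra).
    assert (0 <= r ^ m) by (apply pow_le; lra). nra. }
  pose proof (fun N => admissible_majorant K alpha r f h g a b phi N Ha Had ltac:(lra)) as M1. fold d in M1.
  pose proof (fun N => admissible_majorant K alpha (r ^ m) f h g a b phi N Ha Had ltac:(lra)) as M2. fold d in M2.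
  pose proof (fun N => admissible_g_majorant K alpha r f h g a b phi N Had ltac:(lra)) as M3.
  pose proof (proj1 (has_coefficients_pser _ _) (adm_h _ _ _ _ _ _ _ _ Had)) as Hps.
  set (k := (K - 1) / (K + 1)) in *.
  assert (Hk : 0 <= k) by (apply Rdiv_le_0_compat; lra).
  assert (Ek : 1 + k = 2 * K / (K + 1)) by (unfold k; field; lra).
  set (G := sector_growth alpha r) in *. set (Gm := sector_growth alpha (r ^ m)) in *.
  assert (S1 : Series (fun n => (Cmod (a (S n)) + Cmod (b (S n))) * r ^ S n) <= (1 + k) * (d * G)).
  { apply Series_le_bound.
    - intros n. apply Rmult_le_pos; [|apply pow_le; lra].
      pose proof (Cmod_ge_0 (a (S n))). pose proof (Cmod_ge_0 (b (S n))). lra.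
    - intros n. rewrite (rsum_ext _ (fun j => Cmod (a (S j)) * r ^ S j + Cmod (b (S j)) * r ^ S j)) by (intros; ring).
      rewrite rsum_plus. specialize (M1 n). specialize (M3 n).
      set (X := rsum (fun j => Cmod (a (S j)) * r ^ S j) n) in *.
      assert (k * X <= k * (d * G)) by (apply Rmult_le_compat_l; assumption). lra. }
  assert (Ezm : Cmod (z ^ m)%C = r ^ m) by (rewrite Cmod_pow; reflexivity).
  assert (S2 : Cmod (h (z ^ m)%C) <= Cmod (phi 0%C) + d * Gm).
  { assert (E0 : phi 0%C = a 0%nat).
    { rewrite <- (pser_at_0 a h Hps). destruct (adm_subordinate _ _ _ _ _ _ _ _ Had) as [w [_ [_ [Hw0 Hhw]]]].
      rewrite Hhw by (unfold unit_disc; rewrite Cmod_0; lra). now rewrite Hw0. }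
    apply (C_series_le _ _ _ 1%nat (Hps (z ^ m)%C ltac:(rewrite Ezm; lra))).
    intros [|n] Hn; [lia|]. rewrite csum_first.
    eapply Rle_trans; [apply Cmod_triangle|]. apply Rplus_le_compat.
    - rewrite E0. simpl. rewrite Cmult_1_r. lra.
    - eapply Rle_trans; [apply Cmod_csum|]. eapply Rle_trans; [|apply (M2 n)]. right.
      apply rsum_ext. intros j _. rewrite Cmod_mult, Cmod_pow, Ezm. reflexivity. }
  assert (lambda * Series (fun n => (Cmod (a (S n)) + Cmod (b (S n))) * r ^ S n) <= lambda * ((1 + k) * (d * G))) by (apply Rmult_le_compat_l; lra).
  rewrite Ek in H.
  replace (lambda * (2 * K / (K + 1) * (d * G))) with (d * (2 * K * lambda / (K + 1) * G)) in H by (field; lra).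
  assert (d * (Gm + 2 * K * lambda / (K + 1) * G) <= d * 1) by (apply Rmult_le_compat_l; assumption).
  lra.
Qed.

(** * The radius and the extremal function *)

Lemma sector_growth_0 (a : R) : sector_growth a 0 = 0.
Proof.
  unfold sector_growth. rewrite Rplus_0_r, Rminus_0_r, Rminus_diag, Rmult_0_r, exp_0. ring.
Qed.

Lemma sector_growth_lt (a r s : R) : 1 <= a -> 0 <= r < s -> s < 1 -> sector_growth a r < sector_growth a s.
Proof.
  intros Ha Hr Hs. unfold sector_growth. apply Rplus_lt_compat_r, exp_increasing.
  apply Rmult_lt_compat_l; [lra|].
  assert (ln (1 + r) < ln (1 + s)) by (apply ln_increasing; lra).
  assert (ln (1 - s) < ln (1 - r)) by (apply ln_increasing; lra). lra.
Qed.

(** The radius equation multiplied by [2 alpha], with the constant term moved to the right, so that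
    it reads [= 1]. *)
Definition bohr_radius_function (alpha c : R) (m : nat) (r : R) : R :=
  sector_growth alpha (r ^ m) + c * sector_growth alpha r.

Lemma pow_lt_mono (r s : R) (m : nat) : (1 <= m)%nat -> 0 <= r < s -> s < 1 -> 0 <= r ^ m < s ^ m /\ s ^ m < 1.
Proof.
  intros Hm Hr Hs. repeat split.
  - apply pow_le; lra.
  - destruct m as [|m]; [lia|]. clear Hm. induction m as [|m IH]; [simpl; lra|].
    change (r ^ S (S m)) with (r * r ^ S m). change (s ^ S (S m)) with (s * s ^ S m).
    assert (0 <= r ^ S m) by (apply pow_le; lra). nra.
  - destruct m as [|m]; [lia|]. simpl. assert (s ^ m <= 1) by (rewrite <- (pow1 m); apply pow_incr; lra).
    assert (0 <= s ^ m) by (apply pow_le; lra). nra.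
Qed.

Lemma bohr_radius_function_lt (alpha c r s : R) (m : nat) : 1 <= alpha -> 0 < c -> (1 <= m)%nat ->
  0 <= r < s -> s < 1 -> bohr_radius_function alpha c m r < bohr_radius_function alpha c m s.
Proof.
  intros Ha Hc Hm Hr Hs. unfold bohr_radius_function.
  destruct (pow_lt_mono r s m Hm Hr Hs) as [H1 H2].
  pose proof (sector_growth_lt alpha (r ^ m) (s ^ m) Ha H1 H2).
  pose proof (sector_growth_lt alpha r s Ha Hr Hs). nra.
Qed.

Lemma sector_growth_continuous (a r : R) : 0 <= r < 1 -> continuity_pt (sector_growth a) r.
Proof.
  intros Hr. apply derivable_continuous_pt. eexists. apply is_derive_Reals. unfold sector_growth.
  auto_derive; [lra|reflexivity].
Qed.

Lemma bohr_radius_exists (alpha c : R) (m : nat) : 1 <= alpha -> 0 < c -> (1 <= m)%nat ->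
  exists r, 0 < r < 1 /\ bohr_radius_function alpha c m r = 1.
Proof.
  intros Ha Hc Hm.
  (* At [r1 = 1 - s] the growth is at least [(1 + r1) / (1 - r1) - 1 = 2 r1 / s >= 1 / s >= 2 / c],
     so the function exceeds 1 there. *)
  set (s := Rmin (1 / 2) (c / 2)).
  assert (Hs : 0 < s) by (apply Rmin_pos; lra).
  assert (Hs1 : s <= 1 / 2) by apply Rmin_l. assert (Hs2 : s <= c / 2) by apply Rmin_r.
  set (r1 := 1 - s).
  assert (H0 : bohr_radius_function alpha c m 0 = 0).
  { unfold bohr_radius_function. destruct m as [|m]; [lia|]. rewrite pow_i by lia. rewrite sector_growth_0. ring. }
  assert (H1 : 1 < bohr_radius_function alpha c m r1).
  { assert (Hr1 : 0 <= r1 < 1) by (unfold r1; lra).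
    assert (G1 : 2 * r1 / s <= sector_growth alpha r1).
    { unfold sector_growth. set (l := ln (1 + r1) - ln (1 - r1)).
      assert (Hl : 0 <= l) by now apply half_log_ge_0.
      assert (He : exp l = (1 + r1) / s).
      { unfold l, Rminus at 1. rewrite exp_plus, exp_Ropp, !exp_ln by lra. unfold r1. field. lra. }
      assert (exp l <= exp (alpha * l)) by (apply exp_le; nra).
      rewrite He in H. replace (2 * r1 / s) with ((1 + r1) / s - 1) by (unfold r1; field; lra). lra. }
    assert (G2 : 0 <= sector_growth alpha (r1 ^ m)).
    { apply sector_growth_ge_0; [lra|]. split; [apply pow_le; lra|]. apply (pow_lt_mono 0 r1 m Hm); unfold r1; lra. }
    unfold bohr_radius_function.
    assert (2 <= c * (2 * r1 / s)).
    { apply Rmult_le_reg_r with s; [exact Hs|]. replace (c * (2 * r1 / s) * s) with (c * (2 * r1)) by (field; lra).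
      unfold r1. nra. }
    assert (c * (2 * r1 / s) <= c * sector_growth alpha r1) by (apply Rmult_le_compat_l; lra). lra. }
  destruct (IVT_interv (fun r => bohr_radius_function alpha c m r - 1) 0 r1) as [r [Hr Er]].
  - intros r Hr. apply continuity_pt_minus; [|apply continuity_pt_const; intros ? ?; reflexivity].
    unfold bohr_radius_function. apply continuity_pt_plus.
    + apply (continuity_pt_comp (fun r => r ^ m) (sector_growth alpha)).
      * apply derivable_continuous_pt, derivable_pt_pow.
      * apply sector_growth_continuous. split; [apply pow_le; lra|].
        destruct m as [|m']; [lia|]. simpl.
        assert (r ^ m' <= 1) by (rewrite <- (pow1 m'); apply pow_incr; unfold r1 in *; lra).
        assert (0 <= r ^ m') by (apply pow_le; lra). unfold r1 in *. nra.
    + apply (continuity_pt_scal (sector_growth alpha)). apply sector_growth_continuous. unfold r1 in *; lra.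
  - unfold r1; lra.
  - rewrite H0; lra.
  - lra.
  - exists r. split; [|lra]. split; [|unfold r1 in *; lra].
    destruct (proj1 Hr) as [L|E]; [exact L|]. rewrite <- E in Er. rewrite H0 in Er. lra.
Qed.

Lemma radius_equation_iff (K alpha lambda : R) (m : nat) (r : R) : 1 <= K -> 1 <= alpha -> (1 <= m)%nat -> 0 < r < 1 ->
  (radius_equation K alpha lambda m r <-> bohr_radius_function alpha (2 * K * lambda / (K + 1)) m r = 1).
Proof.
  intros HK Ha Hm Hr. unfold radius_equation, bohr_radius_function.
  assert (Hrm : 0 <= r ^ m < 1) by (destruct (pow_lt_mono 0 r m Hm) as [H1 H2]; [lra|lra|]; split; [apply pow_le; lra|exact H2]).
  rewrite !f_alpha_growth by lra. set (c := 2 * K * lambda / (K + 1)).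
  set (u := sector_growth alpha (r ^ m)). set (v := sector_growth alpha r).
  replace (1 / (2 * alpha) * u + c * (1 / (2 * alpha) * v) - 1 / (2 * alpha)) with ((u + c * v - 1) / (2 * alpha)) by (field; lra).
  split; intros H.
  - apply (Rmult_eq_compat_r (2 * alpha)) in H. unfold Rdiv in H. rewrite Rmult_assoc, Rinv_l, Rmult_0_l in H by lra. lra.
  - rewrite H. unfold Rdiv. ring.
Qed.

(** * The extremal sector map *)

Lemma zero_in_half_pi : - (PI / 2) < 0 < PI / 2.
Proof. pose proof PI_RGT_0. lra. Qed.

Lemma half_plane_log_strip (z : C) : Cmod z < 1 -> Rabs (snd (half_plane_log 0 z)) < PI / 2.
Proof.
  intros Hz. set (w := (half_plane_map 0 z * cis 1 (- 0))%C).
  assert (Hw : 0 < fst w) by (apply half_plane_pos; [apply zero_in_half_pi|exact Hz]).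
  unfold half_plane_log. fold w. replace (snd (clog w + (0, 0))%C) with (carg w) by (simpl; ring).
  pose proof (carg_bound w) as Hb. pose proof (f_equal fst (cexp_clog w (pos_slit w Hw))) as E.
  unfold cexp, clog in E; cbn [fst snd] in E.
  assert (Hc : 0 < cos (carg w)).
  { pose proof (exp_pos (ln (Cmod w))). apply Rnot_le_lt. intros L.
    assert (exp (ln (Cmod w)) * cos (carg w) <= 0) by nra. lra. }
  apply Rabs_def1; apply Rnot_le_lt; intros L.
  - assert (cos (carg w) <= 0) by (apply cos_le_0; lra). lra.
  - assert (cos (- carg w) <= 0) by (apply cos_le_0; lra). rewrite cos_neg in H. lra.
Qed.

(** The logarithmic description also covers [alpha = 2], where the sector is the slit plane. The
    preimage is the Moebius image of [exp (v / alpha)]. *)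
Lemma sector_image (alpha : R) (w : C) : 1 <= alpha ->
  disc_image (sector_map alpha 0) w <-> exists v, Rabs (snd v) < alpha * PI / 2 /\ w = cexp v.
Proof.
  intros Ha. pose proof PI_RGT_0 as Hpi. split.
  - intros [z [Hz E]]. exists (alpha * half_plane_log 0 z)%C. split; [|now symmetry].
    pose proof (half_plane_log_strip z Hz) as H.
    replace (snd (alpha * half_plane_log 0 z)%C) with (alpha * snd (half_plane_log 0 z)) by (simpl; ring).
    rewrite Rabs_mult, Rabs_right by lra. replace (alpha * PI / 2) with (alpha * (PI / 2)) by field.
    apply Rmult_lt_compat_l; lra.
  - intros [v [Hv E]].
    assert (Ha0 : RtoC alpha <> 0%C) by (apply RtoC_neq_0; lra).
    set (v' := (/ RtoC alpha * v)%C).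
    assert (Hv' : Rabs (snd v') < PI / 2).
    { unfold v'. rewrite <- RtoC_inv by lra.
      replace (snd (RtoC (/ alpha) * v)%C) with (snd v / alpha) by (simpl; field; lra).
      unfold Rdiv at 1. rewrite Rabs_mult, (Rabs_right (/ alpha)) by (left; apply Rinv_0_lt_compat; lra).
      apply Rmult_lt_reg_r with alpha; [lra|]. rewrite Rmult_assoc, Rinv_l, Rmult_1_r by lra. lra. }
    set (g := cexp v').
    assert (Hg : 0 < fst g).
    { unfold g, cexp; cbn [fst]. apply Rabs_def2 in Hv'. apply Rmult_lt_0_compat; [apply exp_pos|apply cos_gt_0; lra]. }
    assert (Hlt : Cmod (g - 1)%C < Cmod (g + 1)%C).
    { apply Rsqr_incrst_0; try apply Cmod_ge_0. unfold Rsqr. rewrite !Cmod_sqr. destruct g as [g1 g2]; simpl in *. nra. }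
    assert (Hg1 : (g + 1)%C <> 0%C) by (apply Cmod_gt_0; pose proof (Cmod_ge_0 (g - 1)%C); lra).
    exists ((g - 1) / (g + 1))%C. split.
    + unfold unit_disc. rewrite Cmod_div by exact Hg1. pose proof (Cmod_ge_0 (g - 1)%C).
      apply Rmult_lt_reg_r with (Cmod (g + 1)%C); [lra|]. unfold Rdiv. rewrite Rmult_assoc, Rinv_l; lra.
    + rewrite E. unfold sector_map, half_plane_log, half_plane_map.
      rewrite Rmult_0_r, Ropp_0, cis_0.
      assert (H2 : RtoC 2 <> 0%C) by (apply RtoC_neq_0; lra).
      replace ((1 + 1 * ((g - 1) / (g + 1))) / (1 - (g - 1) / (g + 1)) * 1)%C with g.
      2: { replace (1 - (g - 1) / (g + 1))%C with (2 / (g + 1))%C by (field; exact Hg1). field. auto. }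
      unfold g. rewrite clog_cexp by (eapply Rlt_trans; [exact Hv'|lra]).
      f_equal. unfold v'. replace ((0, 0) : C) with (RtoC 0) by reflexivity. field. exact Ha0.
Qed.

(** An intersection of three half-planes, which makes convexity immediate. For [alpha = 2] the last
    two leave the real line, and the first selects its nonpositive half. *)
Lemma sector_complement (alpha : R) (w : C) : 1 <= alpha <= 2 ->
  ~ disc_image (sector_map alpha 0) w <->
  fst w <= 0 /\ fst w * sin (alpha * PI / 2) - snd w * cos (alpha * PI / 2) <= 0
  /\ fst w * sin (alpha * PI / 2) + snd w * cos (alpha * PI / 2) <= 0.
Proof.
  intros Ha. pose proof PI_RGT_0 as Hpi. set (k := alpha * PI / 2).
  assert (Hk : PI / 2 <= k <= PI) by (unfold k; nra).
  rewrite sector_image by lra. fold k. split.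
  - intros Hn. destruct (Req_dec (Cmod w) 0) as [E|E].
    + apply Cmod_eq_0 in E. rewrite E. simpl. lra.
    + destruct (C_polar_cis w) as [t [Ht Et]]. pose proof (Cmod_ge_0 w).
      assert (Hlarge : k <= Rabs t).
      { apply Rnot_lt_le. intros L. apply Hn. exists (ln (Cmod w), t). split; [exact L|].
        rewrite Et at 1. unfold cis, cexp, Cmult, RtoC; cbn [fst snd]. rewrite exp_ln by lra. f_equal; ring. }
      assert (E1 : fst w = Cmod w * cos t) by (rewrite Et at 1; simpl; ring).
      assert (E2 : snd w = Cmod w * sin t) by (rewrite Et at 1; simpl; ring).
      rewrite E1, E2.
      replace (Cmod w * cos t * sin k - Cmod w * sin t * cos k) with (Cmod w * sin (k - t)) by (rewrite sin_minus; ring).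
      replace (Cmod w * cos t * sin k + Cmod w * sin t * cos k) with (Cmod w * sin (k + t)) by (rewrite sin_plus; ring).
      assert (Hc : cos t <= 0 /\ sin (k - t) <= 0 /\ sin (k + t) <= 0).
      { destruct (Rle_dec 0 t).
        - rewrite Rabs_right in Hlarge by lra. repeat split.
          + apply cos_le_0; lra.
          + replace (k - t) with (- (t - k)) by ring. rewrite sin_neg. assert (0 <= sin (t - k)) by (apply sin_ge_0; lra). lra.
          + apply sin_le_0; lra.
        - rewrite Rabs_left in Hlarge by lra. repeat split.
          + rewrite <- cos_neg. apply cos_le_0; lra.
          + apply sin_le_0; lra.
          + replace (k + t) with (- (- t - k)) by ring. rewrite sin_neg. assert (0 <= sin (- t - k)) by (apply sin_ge_0; lra). lra. }
      nra.
  - intros [H1 [H2 H3]] [v [Hv E]]. subst w. unfold cexp in *; cbn [fst snd] in *.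
    set (t := snd v) in *. set (e := exp (fst v)) in *. assert (He : 0 < e) by apply exp_pos.
    replace (e * cos t * sin k - e * sin t * cos k) with (e * sin (k - t)) in H2 by (rewrite sin_minus; ring).
    replace (e * cos t * sin k + e * sin t * cos k) with (e * sin (k + t)) in H3 by (rewrite sin_plus; ring).
    apply Rabs_def2 in Hv.
    (* Together with [A2] and [k <= PI] this forces [t = 0], and [H1] excludes the positive real
       axis. *)
    assert (A1 : PI <= k - t).
    { apply Rnot_lt_le. intros L. assert (0 < sin (k - t)) by (apply sin_gt_0; lra). nra. }
    assert (A2 : PI <= k + t).
    { apply Rnot_lt_le. intros L. assert (0 < sin (k + t)) by (apply sin_gt_0; lra). nra. }
    assert (t = 0) by lra. rewrite H, cos_0 in H1. lra.
Qed.

Lemma real_Glb_le (S : R -> Prop) (x : R) : S x -> (forall y, S y -> 0 <= y) -> real (Glb_Rbar S) <= x.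
Proof.
  intros Hx Hpos. destruct (Glb_Rbar_correct S) as [Hlb Hgl].
  assert (H0 : Rbar_le 0 (Glb_Rbar S)) by (apply Hgl; intros y Hy; apply (Hpos y Hy)).
  assert (H1 : Rbar_le (Glb_Rbar S) x) by (apply Hlb, Hx).
  destruct (Glb_Rbar S); simpl in *; try contradiction; lra.
Qed.

Lemma exp_Re_half_plane_log (z : C) : Cmod z < 1 -> exp (fst (half_plane_log 0 z)) = Cmod (1 + z)%C / Cmod (1 - z)%C.
Proof.
  intros Hz. rewrite <- Cmod_cexp, cexp_half_plane_log by (apply zero_in_half_pi || exact Hz).
  unfold half_plane_map. rewrite Rmult_0_r, cis_0, Cmod_div by now apply one_minus_neq_0.
  f_equal. f_equal. ring.
Qed.

Lemma sector_concave (alpha : R) : 1 <= alpha <= 2 -> concave_univalent alpha (sector_map alpha 0).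
Proof.
  intros Ha. pose proof PI_RGT_0 as Hpi. constructor.
  - intros z Hz. eexists. apply cder_is_derive. apply cder_sector_map; [apply zero_in_half_pi|exact Hz].
  - intros z1 z2 H1 H2 E. unfold sector_map in E.
    pose proof (half_plane_log_strip z1 H1) as B1. pose proof (half_plane_log_strip z2 H2) as B2.
    assert (Ha0 : RtoC alpha <> 0%C) by (apply RtoC_neq_0; lra).
    apply cexp_inj in E.
    + assert (EL : half_plane_log 0 z1 = half_plane_log 0 z2).
      { replace (half_plane_log 0 z1) with (/ alpha * (alpha * half_plane_log 0 z1))%C by (field; exact Ha0).
        rewrite E. field. exact Ha0. }
      apply (f_equal cexp) in EL. rewrite !cexp_half_plane_log in EL by (apply zero_in_half_pi || assumption).
      unfold half_plane_map in EL. rewrite Rmult_0_r, cis_0 in EL.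
      pose proof (one_minus_neq_0 z1 H1) as N1. pose proof (one_minus_neq_0 z2 H2) as N2.
      assert (Ec : ((1 + 1 * z1) * (1 - z2) = (1 + 1 * z2) * (1 - z1))%C).
      { replace (1 + 1 * z1)%C with ((1 + 1 * z1) / (1 - z1) * (1 - z1))%C by (field; exact N1). rewrite EL. field. exact N2. }
      apply Cminus_eq_0. assert (H2n : RtoC 2 <> 0%C) by (apply RtoC_neq_0; lra).
      replace (z1 - z2)%C with (((1 + 1 * z1) * (1 - z2) - (1 + 1 * z2) * (1 - z1)) / 2)%C by (field; exact H2n).
      rewrite Ec. unfold Cdiv. ring.
    + replace (snd (alpha * half_plane_log 0 z1)%C - snd (alpha * half_plane_log 0 z2)%C) with
        (alpha * (snd (half_plane_log 0 z1) - snd (half_plane_log 0 z2))) by (simpl; ring).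
      apply Rabs_def2 in B1. apply Rabs_def2 in B2. apply Rabs_def1; nra.
  - intros Q [M HM]. unfold filtermap, within.
    assert (L : exists d, 0 < d /\ forall z, Cmod (z - 1)%C < d -> unit_disc z -> Q (Cmod (sector_map alpha 0 z))).
    (* For [|1 - z| < d] one has [|1 + z| >= 1] and [1 / |1 - z| > |M| + 1]; an exponent
       [alpha >= 1] only enlarges a quotient that exceeds 1. *)
    { set (d := Rmin 1 (/ (Rabs M + 1))). pose proof (Rabs_pos M).
      assert (Hd : 0 < d) by (apply Rmin_pos; [lra|apply Rinv_0_lt_compat; lra]).
      exists d. split; [exact Hd|]. intros z Hz Hzu. apply HM. unfold sector_map. rewrite Cmod_cexp.
      replace (fst (alpha * half_plane_log 0 z)%C) with (alpha * fst (half_plane_log 0 z)) by (simpl; ring).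
      set (x := fst (half_plane_log 0 z)).
      pose proof (exp_Re_half_plane_log z Hzu) as Ex. fold x in Ex.
      assert (D1 : d <= 1) by apply Rmin_l. assert (D2 : d <= / (Rabs M + 1)) by apply Rmin_r.
      rewrite Cmod_sub_sym in Hz. pose proof (proj1 (Cmod_gt_0 _) (one_minus_neq_0 z Hzu)) as Hp.
      assert (Hnum : 1 <= Cmod (1 + z)%C).
      { assert (Ht : Cmod 2%C <= Cmod (1 + z)%C + Cmod (1 - z)%C).
        { replace (RtoC 2) with ((1 + z) + (1 - z))%C; [apply Cmod_triangle|].
          replace (RtoC 2) with (1 + 1)%C by (rewrite <- RtoC_plus; f_equal). ring. }
        rewrite Cmod_R, Rabs_right in Ht by lra. lra. }
      assert (He : Rabs M + 1 < exp x).
      { rewrite Ex. apply Rlt_le_trans with (1 * / Cmod (1 - z)%C).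
        - rewrite Rmult_1_l, <- (Rinv_inv (Rabs M + 1)). apply Rinv_lt_contravar; [|lra].
          apply Rmult_lt_0_compat; [exact Hp|apply Rinv_0_lt_compat; lra].
        - apply Rmult_le_compat_r; [left; now apply Rinv_0_lt_compat|exact Hnum]. }
      assert (Hx : 0 <= x).
      { apply Rnot_lt_le. intros L. apply exp_increasing in L. rewrite exp_0 in L. lra. }
      assert (exp x <= exp (alpha * x)) by (apply exp_le; nra).
      pose proof (Rle_abs M). lra. }
    destruct L as [d [Hd L]].
    apply locally_C_Cmod. exists d. split; [exact Hd|exact L].
  - intros u v t Hu Hv Ht. apply sector_complement in Hu; [|exact Ha]. apply sector_complement in Hv; [|exact Ha].
    apply sector_complement; [exact Ha|]. destruct u as [u1 u2], v as [v1 v2]. cbn [fst snd] in *.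
    replace (fst (RtoC (1 - t) * (u1, u2) + RtoC t * (v1, v2))%C) with ((1 - t) * u1 + t * v1) by (simpl; ring).
    replace (snd (RtoC (1 - t) * (u1, u2) + RtoC t * (v1, v2))%C) with ((1 - t) * u2 + t * v2) by (simpl; ring).
    set (S := sin _) in *. set (K := cos _) in *.
    destruct Hu as [U1 [U2 U3]], Hv as [V1 [V2 V3]].
    repeat split.
    + nra.
    + replace (((1 - t) * u1 + t * v1) * S - ((1 - t) * u2 + t * v2) * K) with ((1 - t) * (u1 * S - u2 * K) + t * (v1 * S - v2 * K)) by ring. nra.
    + replace (((1 - t) * u1 + t * v1) * S + ((1 - t) * u2 + t * v2) * K) with ((1 - t) * (u1 * S + u2 * K) + t * (v1 * S + v2 * K)) by ring. nra.
  - unfold opening_angle_at_infinity. apply real_Glb_le; [|intros y [Hy _]; exact Hy].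
    split; [apply Rmult_le_pos; lra|]. exists 0%C, 0, 0. intros w Hw _.
    apply sector_image in Hw; [|lra]. destruct Hw as [v [Hv ->]].
    exists (exp (fst v)), (snd v). split; [left; apply exp_pos|]. split.
    + rewrite Rminus_0_r. lra.
    + unfold cexp, Cplus, Cmult, RtoC; cbn [fst snd]. f_equal; ring.
Qed.

Lemma sector_map_at_0 (alpha : R) : sector_map alpha 0 0%C = 1%C.
Proof.
  unfold sector_map. rewrite half_plane_log_0 by apply zero_in_half_pi.
  replace (alpha * 0)%C with (RtoC 0) by ring. apply cexp_0.
Qed.

(** The vertex 0 of the sector is a boundary point at distance 1 from the central value. To violate
    the inequality, an upper bound for its right side is enough. *)
Lemma sector_dist (alpha : R) : 1 <= alpha <= 2 ->
  dist_to_set (sector_map alpha 0 0%C) (boundary (disc_image (sector_map alpha 0))) <= 1.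
Proof.
  intros Ha. pose proof PI_RGT_0. rewrite sector_map_at_0. unfold dist_to_set. apply real_Glb_le.
  - exists 0%C. split.
    + assert (H0 : ~ disc_image (sector_map alpha 0) 0%C) by (apply sector_complement; [exact Ha|simpl; lra]).
      split; intros Hl; apply locally_C_Cmod in Hl as [m [Hm Hl]].
      * apply H0, Hl. replace (0 - 0)%C with (RtoC 0) by ring. now rewrite Cmod_0.
      * apply (Hl (RtoC (m / 2))).
        { replace (RtoC (m / 2) - 0)%C with (RtoC (m / 2)) by ring. rewrite Cmod_R, Rabs_right; lra. }
        apply sector_image; [lra|]. exists (RtoC (ln (m / 2))). split.
        { simpl. rewrite Rabs_R0. nra. }
        { unfold cexp, RtoC; cbn [fst snd]. rewrite cos_0, sin_0, exp_ln by lra. f_equal; ring. }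
    + replace (0 - 1)%C with (- (1))%C by ring. now rewrite Cmod_opp, Cmod_1.
  - intros y [w [_ ->]]. apply Cmod_ge_0.
Qed.

(** The invariant [|v| <= u] keeps [(2 + b) u - b v] nonnegative. At [c = 1] the coefficients are
    thus nonnegative, and the majorant series is the function itself. *)
Lemma sder_state_real (b : R) (n : nat) : 0 <= b ->
  exists e u v, sder_coef b 1%C n = RtoC e /\ sder_u b 1%C n = RtoC u /\ sder_v b 1%C n = RtoC v /\ 0 <= e /\ Rabs v <= u.
Proof.
  intros Hb. induction n as [|n [e [u [v [E1 [E2 [E3 [He Hv]]]]]]]].
  - exists 1, 0, 0. repeat split; try reflexivity; [lra|rewrite Rabs_R0; lra].
  - destruct (sder_step b 1%C n) as [U [V E]]. rewrite E1, E2 in U. rewrite E1, E3 in V. rewrite U, V in E.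
    assert (Hn : 0 < INR (S n)) by (apply lt_0_INR; lia).
    assert (Hv' : Rabs (- (v + e)) <= u + e).
    { rewrite Rabs_Ropp. eapply Rle_trans; [apply Rabs_triang|]. rewrite (Rabs_right e) by lra. lra. }
    exists (((2 + b) * (u + e) - b * (- (v + e))) / INR (S n)), (u + e), (- (v + e)).
    assert (EU : sder_u b 1%C (S n) = RtoC (u + e)) by (rewrite U, RtoC_plus; reflexivity).
    assert (EV : sder_v b 1%C (S n) = RtoC (- (v + e))) by (rewrite V, RtoC_opp, RtoC_plus; ring).
    repeat split; auto.
    + assert (HN : RtoC (INR (S n)) <> 0%C) by (apply RtoC_neq_0; lra).
      replace (sder_coef b 1%C (S n)) with (INR (S n) * sder_coef b 1%C (S n) / INR (S n))%C by (field; exact HN).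
      rewrite E. rewrite RtoC_div by lra. f_equal.
      rewrite RtoC_minus, !RtoC_mult, RtoC_opp, !RtoC_plus. ring.
    + apply Rdiv_le_0_compat; [|exact Hn]. apply Rabs_le_between in Hv'. nra.
Qed.

Lemma sector_coef_real (alpha : R) (n : nat) : 1 <= alpha ->
  sector_coef alpha 1%C n = RtoC (Cmod (sector_coef alpha 1%C n)).
Proof.
  intros Ha. assert (K : exists x, 0 <= x /\ sector_coef alpha 1%C n = RtoC x).
  { destruct n as [|n]; [exists 1; split; [lra|reflexivity]|].
    destruct (sder_state_real (alpha - 1) n) as [e [_ [_ [E [_ [_ [He _]]]]]]]; [lra|].
    assert (Hn : 0 < INR (S n)) by (apply lt_0_INR; lia).
    exists (alpha * 2 * e / INR (S n)). split.
    - apply Rdiv_le_0_compat; [|exact Hn]. repeat apply Rmult_le_pos; lra.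
    - unfold sector_coef. rewrite E, RtoC_div, !RtoC_mult by lra. f_equal. f_equal. f_equal. rewrite <- RtoC_plus. f_equal. }
  destruct K as [x [Hx ->]]. rewrite Cmod_R, Rabs_right; [reflexivity|lra].
Qed.

Lemma sector_map_real (alpha r : R) : 0 <= r < 1 -> sector_map alpha 0 (RtoC r) = RtoC (1 + sector_growth alpha r).
Proof.
  intros Hr. unfold sector_map, half_plane_log, half_plane_map. rewrite Rmult_0_r, Ropp_0, cis_0.
  replace ((1 + 1 * r) / (1 - r) * 1)%C with (RtoC ((1 + r) / (1 - r))).
  2: { rewrite RtoC_div, RtoC_plus, RtoC_minus by lra. unfold Cdiv. ring. }
  assert (Hq : 0 < (1 + r) / (1 - r)) by (apply Rdiv_lt_0_compat; lra).
  assert (E : (clog (RtoC ((1 + r) / (1 - r))) + (0, 0))%C = RtoC (ln (1 + r) - ln (1 - r))).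
  { unfold clog, carg. rewrite Cmod_R, Rabs_right by lra. rewrite ln_div by lra.
    unfold Cplus, RtoC; cbn [fst snd]. unfold Rdiv at 1. rewrite Rmult_0_l, atan_0. f_equal; ring. }
  rewrite E, <- RtoC_mult. unfold sector_growth, cexp, RtoC; cbn [fst snd]. rewrite cos_0, sin_0. f_equal; ring.
Qed.

Lemma rsum_is_series (f : nat -> R) (l : R) :
  (forall e, 0 < e -> exists N, forall n, (N <= n)%nat -> Rabs (rsum f n - l) < e) -> is_series f l.
Proof.
  intros H Q [e He]. destruct (H e (cond_pos e)) as [N HN]. exists N. intros n Hn. apply He.
  rewrite sum_n_rsum. change (Rabs (rsum f (S n) - l) < e). apply HN. lia.
Qed.

Lemma rsum_first (f : nat -> R) (n : nat) : rsum f (S n) = f 0%nat + rsum (fun k => f (S k)) n.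
Proof. induction n as [|n IH]; [simpl; ring|]. cbn [rsum] in *. rewrite IH. ring. Qed.

(** The coefficients are nonnegative, so the series of moduli is the power series of the extremal
    map at the real point [r]. *)
Lemma sector_series (alpha r : R) : 1 <= alpha <= 2 -> 0 <= r < 1 ->
  is_series (fun n => Cmod (sector_coef alpha 1%C (S n)) * r ^ S n) (sector_growth alpha r).
Proof.
  intros Ha Hr. apply rsum_is_series. intros e He.
  pose proof (pser_sector_map alpha 0 Ha zero_in_half_pi) as HP. rewrite Rmult_0_r, cis_0 in HP.
  assert (Hz : Cmod (RtoC r) < 1) by (rewrite Cmod_R, Rabs_right; lra).
  destruct (HP (RtoC r) Hz e He) as [N HN]. exists N. intros n Hn. specialize (HN (S n) ltac:(lia)).
  rewrite sector_map_real in HN by exact Hr.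
  assert (E : csum (fun k => sector_coef alpha 1%C k * RtoC r ^ k)%C (S n) = RtoC (rsum (fun k => Cmod (sector_coef alpha 1%C k) * r ^ k) (S n))).
  { generalize (S n). clear n Hn HN. intros n. induction n as [|n IH]; [reflexivity|]. simpl.
    rewrite IH, RtoC_plus, RtoC_mult, <- RtoC_pow, <- sector_coef_real by lra. reflexivity. }
  rewrite E, <- RtoC_minus, Cmod_R, rsum_first in HN.
  replace (rsum (fun n => Cmod (sector_coef alpha 1%C (S n)) * r ^ S n) n - sector_growth alpha r) with
    (Cmod (sector_coef alpha 1%C 0) * r ^ 0 + rsum (fun k => Cmod (sector_coef alpha 1%C (S k)) * r ^ S k) n - (1 + sector_growth alpha r)).
  - exact HN.
  - simpl (sector_coef alpha 1%C 0). rewrite Cmod_1. simpl pow. ring.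
Qed.

Definition extremal_g (K alpha : R) (z : C) : C := (RtoC ((K - 1) / (K + 1)) * (sector_map alpha 0 z - 1))%C.
Definition extremal_b (K alpha : R) (n : nat) : C :=
  match n with O => RtoC 0 | S _ => (RtoC ((K - 1) / (K + 1)) * sector_coef alpha 1%C n)%C end.

Lemma extremal_admissible (K alpha : R) : 1 <= K -> 1 <= alpha <= 2 ->
  admissible K alpha (fun z => sector_map alpha 0 z + Cconj (extremal_g K alpha z))%C
    (sector_map alpha 0) (extremal_g K alpha) (sector_coef alpha 1%C) (extremal_b K alpha) (sector_map alpha 0).
Proof.
  intros HK Ha. set (k := (K - 1) / (K + 1)).
  assert (Hk : 0 <= k < 1).
  { unfold k. split; [apply Rdiv_le_0_compat; lra|]. apply Rmult_lt_reg_r with (K + 1); [lra|].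
    unfold Rdiv. rewrite Rmult_assoc, Rinv_l; lra. }
  set (D := fun z => (alpha * (1 + cis 1 (2 * 0)) * sector_der (alpha - 1) 0 z)%C).
  assert (HD : forall z, unit_disc z -> cder (sector_map alpha 0) z (D z)).
  { intros z Hz. apply cder_sector_map; [apply zero_in_half_pi|exact Hz]. }
  assert (HDg : forall z, unit_disc z -> cder (extremal_g K alpha) z (k * D z)%C).
  { intros z Hz. unfold extremal_g. apply cder_scal. eapply cder_eq; [apply cder_minus; [apply HD, Hz|apply cder_const]|ring]. }
  assert (HD0 : forall z, unit_disc z -> D z <> 0%C).
  { intros z Hz. unfold D. rewrite Rmult_0_r, cis_0. apply Cmult_neq_0; [apply Cmult_neq_0|].
    - apply RtoC_neq_0; lra.
    - rewrite <- RtoC_plus. apply RtoC_neq_0; lra.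
    - now apply sector_der_neq_0. }
  assert (Eh : forall z, unit_disc z -> C_derive (sector_map alpha 0) z = D z) by (intros z Hz; apply is_C_derive_unique, cder_is_derive, HD, Hz).
  assert (Eg : forall z, unit_disc z -> C_derive (extremal_g K alpha) z = (k * D z)%C) by (intros z Hz; apply is_C_derive_unique, cder_is_derive, HDg, Hz).
  assert (Edil : forall z, unit_disc z -> Cmod (dilatation (sector_map alpha 0) (extremal_g K alpha) z) = k).
  { intros z Hz. unfold dilatation. rewrite Eh, Eg by exact Hz.
    replace (k * D z / D z)%C with (RtoC k) by (field; now apply HD0). rewrite Cmod_R, Rabs_right; lra. }
  pose proof (pser_sector_map alpha 0 Ha zero_in_half_pi) as HP. rewrite Rmult_0_r, cis_0 in HP.
  constructor.
  - constructor.
    + intros z Hz. eexists. apply cder_is_derive, HD, Hz.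
    + intros z Hz. eexists. apply cder_is_derive, HDg, Hz.
    + reflexivity.
    + intros z Hz. rewrite Eh by exact Hz. now apply HD0.
    + intros z Hz. rewrite Edil by exact Hz. lra.
    + intros z Hz. rewrite Edil by exact Hz. fold k. lra.
  - now apply has_coefficients_pser.
  - apply has_coefficients_pser.
    assert (H1 : pser (fun n => match n with O => RtoC 1 | S _ => RtoC 0 end) (fun _ => 1%C)).
    { intros z _ e He. exists 1%nat. intros [|n] Hn; [lia|]. rewrite csum_first. simpl.
      rewrite (csum_ext _ (fun _ => RtoC 0)) by (intros; ring).
      replace (csum (fun _ => RtoC 0) n) with (RtoC 0) by (clear; induction n as [|n IH]; [reflexivity|simpl; rewrite <- IH; ring]).
      replace (1 * 1 + 0 - 1)%C with (RtoC 0) by ring. now rewrite Cmod_0. }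
    eapply pser_ext; [| |exact (pser_lin _ _ _ _ (RtoC k) (- RtoC k)%C HP H1)].
    + intros [|n]; cbv beta; unfold extremal_b; fold k; [simpl; ring|ring].
    + intros z _. cbv beta. unfold extremal_g. fold k. ring.
  - reflexivity.
  - now apply sector_concave.
  - exists (fun z => z). repeat split; auto. intros z _. eexists. apply cder_is_derive, cder_id.
Qed.

(** At [z = r] the left side of the inequality equals 1 plus [bohr_radius_function], which exceeds
    2, while the right side is at most [1 + 1]. *)
Lemma extremal_violates (K alpha lambda r : R) (m : nat) : 1 <= K -> 1 <= alpha <= 2 -> 0 < lambda -> (1 <= m)%nat ->
  0 < r < 1 -> 1 < bohr_radius_function alpha (2 * K * lambda / (K + 1)) m r ->
  ~ bohr_inequality lambda m (sector_map alpha 0) (sector_coef alpha 1%C) (extremal_b K alpha) (sector_map alpha 0) (RtoC r).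
Proof.
  intros HK Ha Hl Hm Hr Hbig H. unfold bohr_inequality in H.
  pose proof (sector_dist alpha Ha) as Hd. rewrite sector_map_at_0, Cmod_1 in H. rewrite sector_map_at_0 in Hd.
  rewrite (Cmod_R r), (Rabs_right r) in H by lra.
  assert (Hrm : 0 <= r ^ m < 1).
  { split; [apply pow_le; lra|]. apply (pow_lt_mono 0 r m Hm); lra. }
  rewrite <- RtoC_pow, sector_map_real, Cmod_R in H by exact Hrm.
  pose proof (sector_growth_ge_0 alpha (r ^ m) ltac:(lra) Hrm) as Hg.
  rewrite Rabs_right in H by lra.
  set (k := (K - 1) / (K + 1)).
  assert (Hk : 0 <= k) by (unfold k; apply Rdiv_le_0_compat; lra).
  assert (HS : Series (fun n => (Cmod (sector_coef alpha 1%C (S n)) + Cmod (extremal_b K alpha (S n))) * r ^ S n) = (1 + k) * sector_growth alpha r).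
  { rewrite (Series_ext _ (fun n => (1 + k) * (Cmod (sector_coef alpha 1%C (S n)) * r ^ S n))).
    - rewrite Series_scal_l. f_equal. apply is_series_unique. apply sector_series; lra.
    - intros n. unfold extremal_b. fold k. rewrite Cmod_mult, Cmod_R, Rabs_right by lra. ring. }
  rewrite HS in H. unfold bohr_radius_function in Hbig.
  replace (2 * K * lambda / (K + 1) * sector_growth alpha r) with (lambda * ((1 + k) * sector_growth alpha r)) in Hbig
    by (unfold k; field; lra).
  lra.
Qed.

Theorem theorem4p2 (K alpha lambda : R) (m : nat)
    (hK : 1 <= K) (halpha : 1 <= alpha <= 2) (hlambda : 0 < lambda)
    (hm : (1 <= m)%nat) :
  exists Rstar : R,
    unique (fun r : R => 0 < r < 1 /\ radius_equation K alpha lambda m r)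
      Rstar /\
    (forall (f h g : C -> C) (a b : nat -> C) (phi : C -> C),
       admissible K alpha f h g a b phi ->
       forall z : C, Cmod z <= Rmin (1 / 3) Rstar ->
         bohr_inequality lambda m h a b phi z) /\
    (Rstar <= 1 / 3 ->
     forall rho : R, Rstar < rho ->
       ~ (forall (f h g : C -> C) (a b : nat -> C) (phi : C -> C),
            admissible K alpha f h g a b phi ->
            forall z : C, Cmod z <= rho ->
              bohr_inequality lambda m h a b phi z)).
Proof.
  set (c := 2 * K * lambda / (K + 1)).
  assert (Hc : 0 < c) by (apply Rdiv_lt_0_compat; [repeat apply Rmult_lt_0_compat; lra|lra]).
  destruct (bohr_radius_exists alpha c m (proj1 halpha) Hc hm) as [Rs [HRs ERs]].
  exists Rs. split; [split|split].
  - split; [exact HRs|]. apply radius_equation_iff; try assumption; lra.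
  - intros r [Hr Er]. apply radius_equation_iff in Er; try assumption; [|lra]. fold c in Er.
    destruct (Rtotal_order Rs r) as [L|[E|L]]; [|exact E|].
    + pose proof (bohr_radius_function_lt alpha c Rs r m (proj1 halpha) Hc hm ltac:(lra) ltac:(lra)). lra.
    + pose proof (bohr_radius_function_lt alpha c r Rs m (proj1 halpha) Hc hm ltac:(lra) ltac:(lra)). lra.
  - intros f h g a b phi Had z Hz.
    pose proof (Rmin_l (1 / 3) Rs). pose proof (Rmin_r (1 / 3) Rs). pose proof (Cmod_ge_0 z).
    apply (bohr_upper K alpha lambda m f h g); try assumption; [lra|]. fold c.
    change (bohr_radius_function alpha c m (Cmod z) <= 1).
    destruct (Req_dec (Cmod z) Rs) as [E|Hne]; [rewrite E; lra|].
    pose proof (bohr_radius_function_lt alpha c (Cmod z) Rs m (proj1 halpha) Hc hm ltac:(lra) ltac:(lra)). lra.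
  - intros _ rho Hrho Hall.
    (* As [rho] may exceed 1, the midpoint is taken below [Rmin rho 1], so that it lies in the
       disc. *)
    set (r := (Rs + Rmin rho 1) / 2).
    assert (Rs < Rmin rho 1) by (apply Rmin_glb_lt; lra).
    pose proof (Rmin_l rho 1). pose proof (Rmin_r rho 1).
    assert (Hr : Rs < r < 1) by (unfold r; lra).
    apply (extremal_violates K alpha lambda r m hK halpha hlambda hm); [lra| |].
    + fold c. rewrite <- ERs. apply bohr_radius_function_lt; try assumption; lra.
    + apply (Hall _ _ _ _ _ _ (extremal_admissible K alpha hK halpha)).
      rewrite Cmod_R, Rabs_right by lra. unfold r; lra.
Qed.
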